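(* Let $\alpha\in(1,2)$ and let $\mu$ be an unbounded complex-valued function on $[0,1]^2$. For $M>0$ let $\mu_M(x,y)=\mu(x,y)$ if $|\mu(x,y)|\le M$ and $\mu_M(x,y)=M$ otherwise. Suppose that $\mu_M$ is Riemann-integrable for every $M>0$ and that $\{\mu_M\}_M$ converges pointwise to $\mu$ as $M\to\infty$. Let $\{\bar\mu_{h(n)}\}_n$ be a sequence of complex numbers such that $h^\alpha\bar\mu_{h(n)}=o(1)$ as $n\to\infty$, where $h=h(n)=\frac1{n+1}$, and let $\hat B_{\mathbf n}=T_{\mathbf n}(t_\alpha)$, $\mathbf n=(n,n)$. Then, for each of the two choices $P_{\mathbf n}=\tau(\hat B_{\mathbf n})$ and $P_{\mathbf n}=\tau(\hat B_{\mathbf n})+h^\alpha\bar\mu_{h(n)}I_{n^2}$ (in statements (q2) and (q4) $P_{\mathbf n}$ is assumed invertible): (q1) $\{P_{\mathbf n}\}_n\sim_{\rm GLT}t_\alpha$ and $\{P_{\mathbf n}\}_n\sim_{\sigma}t_\alpha$; (q2) $\left\{P_{\mathbf n}^{-1}\left(\hat B_{\mathbf n}+h^\alpha D_{\mathbf n}(\mu)\right)\right\}_n\sim_{\rm GLT}1$ and $\left\{P_{\mathbf n}^{-1}\left(\hat B_{\mathbf n}+h^\alpha D_{\mathbf n}(\mu)\right)\right\}_n\sim_{\sigma}1$. If moreover $\mu$ and $\{\bar\mu_{h(n)}\}_n$ are real-valued, then (q3) $\{P_{\mathbf n}\}_n\sim_\lambda t_\alpha$; (q4) $\left\{P_{\mathbf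 n}^{-1}\left(\hat B_{\mathbf n}+h^\alpha D_{\mathbf n}(\mu)\right)\right\}_n\sim_\lambda 1$.
   Context: **Matrices.** For $n\in\mathbb N$ put $\mathbf n=(n,n)$ and $h=h(n)=\frac{1}{n+1}$; all matrix sequences below are indexed by $n\to\infty$ and consist of matrices of size $d_n=n^2$. Rows and columns are indexed by pairs $\mathbf i=(i_1,i_2)$, $1\le i_1,i_2\le n$, in lexicographic order. For $f\in L^1([-\pi,\pi]^2)$, $T_{\mathbf n}(f)=[\hat f_{\mathbf i-\mathbf j}]_{\mathbf i,\mathbf j}$ with $\hat f_{\mathbf k}=\frac1{(2\pi)^2}\int_{[-\pi,\pi]^2}f(\theta_1,\theta_2)e^{-\mathrm i(k_1\theta_1+k_2\theta_2)}\,d\theta_1d\theta_2$. The function $t_\alpha$ is $t_\alpha(\theta_1,\theta_2)=\left[4\sin^2(\theta_1/2)+4\sin^2(\theta_2/2)\right]^{\alpha/2}$. $D_{\mathbf n}(\mu)$ is the $n^2\times n^2$ diagonal matrix with diagonal entries $\mu(ih,jh)$, $1\le i,j\le n$, in lexicographic order. $\|\cdot\|$ is the spectral norm. **The $\tau$ preconditioner.** For a real symmetric $n\times n$ Toeplitz matrix $T$ with first column $[a_0,a_1,\dots,a_{n-1}]^\top$, $\tau(T)=T-H(T)$, where $H(T)$ is the Hankel matrix with first row $[a_2,a_3,\dots,a_{n-1},0,0]$ and last column $[0,0,a_{n-1},\dots,a_3,a_2]^\top$. For the 2-level matrix $T_{\mathbf n}(f)$ with $f$ real and even in each variable, $\tau$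 is obtained by applying this correction level by level: writing $S_0=I_n$ and, for $1\le k\le n-1$, $S_k$ for the $n\times n$ symmetric Toeplitz matrix with ones exactly where $|i-j|=k$, one has $T_{\mathbf n}(f)=\sum_{k_1,k_2=0}^{n-1}\hat f_{(k_1,k_2)}S_{k_1}\otimes S_{k_2}$ and $\tau(T_{\mathbf n}(f))=\sum_{k_1,k_2=0}^{n-1}\hat f_{(k_1,k_2)}\,\tau(S_{k_1})\otimes\tau(S_{k_2})$. **Distributions.** Let $\psi:D\subset\mathbb R^t\to\mathbb C$ be measurable with $0<|D|<\infty$. $\{A_n\}_n\sim_\sigma\psi$ means $\lim_{n\to\infty}\frac1{d_n}\sum_{i=1}^{d_n}F(\sigma_i(A_n))=\frac1{|D|}\int_D F(|\psi(x)|)\,dx$ for every continuous compactly supported $F:\mathbb R\to\mathbb C$, where $\sigma_i$ denotes singular values. $\{A_n\}_n\sim_\lambda\psi$ means $\lim_{n\to\infty}\frac1{d_n}\sum_{i=1}^{d_n}F(\lambda_i(A_n))=\frac1{|D|}\int_D F(\psi(x))\,dx$ for every continuous compactly supported $F:\mathbb C\to\mathbb C$, where $\lambda_i$ denotes eigenvalues. For $t_\alpha$ take $D=[-\pi,\pi]^2$; $1$ denotes the constant function. **GLT sequences (2-level, scalar).** A class $\{\{B_{n,m}\}_n\}_m$ is an approximating class of sequences (a.c.s.) for $\{A_n\}_n$ if for every $m$ there is $n_m$ such that for all $n\ge n_m$ one has $A_n=B_{n,m}+R_{n,m}+N_{n,m}$ with $\mathrm{rank}\,R_{n,m}\le c(m)d_n$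 and $\|N_{n,m}\|\le\omega(m)$, where $n_m$, $c(m)$, $\omega(m)$ depend only on $m$ and $c(m),\omega(m)\to0$ as $m\to\infty$. For a measurable $\kappa:[0,1]^2\times[-\pi,\pi]^2\to\mathbb C$, $\{A_n\}_n\sim_{\rm GLT}\kappa$ (generalized locally Toeplitz sequence with symbol $\kappa$) means: for each $m\in\mathbb N$ there are finitely many functions $a_{i,m}\in C^\infty([0,1]^2)$ and trigonometric polynomials $f_{i,m}$ in two variables, $i=1,\dots,N_m$, such that $\sum_i a_{i,m}(\mathbf x)f_{i,m}(\boldsymbol\theta)\to\kappa(\mathbf x,\boldsymbol\theta)$ in measure as $m\to\infty$ and $\{\{\sum_{i}\mathrm{diag}_{\mathbf j}\big(a_{i,m}(\mathbf j/n)\big)\,T_{\mathbf n}(f_{i,m})\}_n\}_m$ is an a.c.s. for $\{A_n\}_n$. A function of $\boldsymbol\theta$ only, such as $t_\alpha$, is regarded as a function of $(\mathbf x,\boldsymbol\theta)$. *)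

(* Defs.v *)
From HB Require Import structures.
From mathcomp Require Import all_boot all_order all_algebra spectral.
From mathcomp Require Import all_classical all_reals all_analysis.
From mathcomp Require Import complex mxtens.

Set Implicit Arguments.
Unset Strict Implicit.
Unset Printing Implicit Defensive.

Import Order.TTheory GRing.Theory Num.Theory.
Import numFieldNormedType.Exports.

Local Open Scope classical_set_scope.
Local Open Scope ring_scope.
Local Open Scope complex_scope.
Local Open Scope sesquilinear_scope.

(* Naming the numClosedFieldType, rather than its carrier R[i], lets the
   topology that the library puts on any numClosedFieldType be inferred. *)
Definition CC (R : realType) : numClosedFieldType := R[i].

Definition cmod (R : realType) (z : CC R) : R := complex.Re `|z|.

(* exp(i t) *)
Definition cis (R : realType) (t : R) : CC R := cos t +i* sin t.

Section Integration.
Context {R : realType} {d : measure_display} {T : measurableType d}.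

Definition cmeasurable (D : set T) (f : T -> CC R) : Prop :=
  measurable_fun D (fun x => complex.Re (f x) : R) /\
  measurable_fun D (fun x => complex.Im (f x) : R).

Definition cintegral (nu : {measure set T -> \bar R}) (D : set T)
    (f : T -> CC R) : CC R :=
  (\int[nu]_(x in D) complex.Re (f x)) +i* (\int[nu]_(x in D) complex.Im (f x)).

Definition cvg_in_measure (nu : {measure set T -> \bar R}) (D : set T)
    (g : nat -> T -> CC R) (f : T -> CC R) : Prop :=
  forall e : R, 0 < e ->
    nu (D `&` [set x | e < cmod (g m x - f x)]) @[m --> \oo] --> 0%E.

End Integration.

Notation plane R := (measurableTypeR R * measurableTypeR R)%type.

Definition leb2 (R : realType) : set (plane R) -> \bar R :=
  (@lebesgue_measure R \x @lebesgue_measure R)%E.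
Arguments leb2 : clear implicits.

HB.instance Definition _ (R : realType) := Measure.on (leb2 R).

(* The library's sigma-finiteness instance for \x is not found by inference
   (it is shadowed by the one for product subprobabilities). *)
Lemma leb2_sigma_finite (R : realType) : sigma_finite setT (leb2 R).
Proof.
have /sigma_finiteP[F [TF ndF Foo]] :=
  sigma_finiteT (@lebesgue_measure R).
exists (fun n => F n `*` F n).
  rewrite -setXTT TF predeqE => -[x y]; split.
    move=> [/= [n _ Fnx] [k _ Fky]]; exists (maxn n k) => //; split.
    - by move: x Fnx; exact/subsetPset/ndF/leq_maxl.
    - by move: y Fky; exact/subsetPset/ndF/leq_maxr.
  by move=> [n _ []/= ? ?]; split; exists n.
move=> k; have [mF Fk] := Foo k.
split; first exact: measurableX.
by rewrite /leb2 product_measure1E// lte_mul_pinfty// ge0_fin_numE.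
Qed.

HB.instance Definition _ (R : realType) :=
  Measure_isSigmaFinite.Build _ _ _ (leb2 R) (@leb2_sigma_finite R).

Definition leb4 (R : realType) : {measure set (plane R * plane R) -> \bar R} :=
  (leb2 R \x leb2 R)%E.

Definition unit_square (R : realType) : set (plane R) :=
  `[0, 1]%classic `*` `[0, 1]%classic.

Definition torus (R : realType) : set (plane R) :=
  `[- pi, pi]%classic `*` `[- pi, pi]%classic.

Arguments unit_square : clear implicits.
Arguments torus : clear implicits.

Section Spectra.
Context {R : realType}.

(* Roots of the characteristic polynomial, with algebraic multiplicity. *)
Definition eigvals n (A : 'M[CC R]_n) : seq (CC R) :=
  sval (closed_field_poly_normal (char_poly A)).

Definition singvals n (A : 'M[CC R]_n) : seq R :=
  [seq Num.sqrt (complex.Re z) | z <- eigvals (A ^t* *m A)].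

Definition specnorm n (A : 'M[CC R]_n) : R :=
  \big[Num.max/0]_(s <- singvals A) s.

End Spectra.

(* A sequence of matrices whose n-th term has size d_n = n ^ 2.  The two-level
   index (i_1, i_2) is encoded in 'I_(n * n), in lexicographic order, by
   mxtens_index / mxtens_unindex; indices are 0-based. *)
Definition mxseq (R : realType) := forall n : nat, 'M[CC R]_(n * n).

Section Toeplitz.
Context {R : realType}.

Definition fourier (f : plane R -> CC R) (k1 k2 : int) : CC R :=
  ((2 * pi) ^- 2)%:C *
  cintegral (leb2 R) (torus R)
    (fun th => f th * cis (- (k1%:~R * th.1 + k2%:~R * th.2))).

Definition toeplitz (f : plane R -> CC R) : mxseq R := fun n =>
  \matrix_(i, j)
    let: (i1, i2) := mxtens_unindex i in
    let: (j1, j2) := mxtens_unindex j in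
    fourier f (i1%:Z - j1%:Z) (i2%:Z - j2%:Z).

(* Diagonal entries a (g i_1, g i_2) for 1 <= i_1, i_2 <= n. *)
Definition sampling (g : nat -> R) (a : plane R -> CC R) n : 'M[CC R]_(n * n) :=
  diag_mx (\row_i let: (i1, i2) := mxtens_unindex i in a (g i1.+1, g i2.+1)).

Definition step (n : nat) : R := n.+1%:R^-1.

Definition Dmx (mu : plane R -> CC R) : mxseq R := fun n =>
  sampling (fun i => i%:R * step n) mu n.

End Toeplitz.

Section Tau.
Context {K : pzRingType}.

(* With a_k the entries of the first column of T and 0-based indices, the
   anti-diagonal i + j = s of H(T) carries a_(s+2) if s + 2 < n, a_(2n-s) if
   n < s, and 0 otherwise. *)
Definition tau n : 'M[K]_n -> 'M[K]_n :=
  match n with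
  | 0 => id
  | m.+1 => fun T =>
      T - \matrix_(i < m.+1, j < m.+1)
            (if (i + j + 2 < m.+1)%N then T (inord (i + j + 2)%N) ord0
             else if (m.+1 < i + j)%N then T (inord (2 * m.+1 - (i + j))%N) ord0
             else 0)
  end.

Definition toepS n (k : nat) : 'M[K]_n :=
  \matrix_(i, j) ((i == j + k :> nat)%N || (j == i + k :> nat)%N)%:R.

End Tau.

(* tau (T_n(f)), for f real and even in each variable. *)
Definition tau2 (R : realType) (f : plane R -> CC R) : mxseq R := fun n =>
  \sum_(k1 < n) \sum_(k2 < n)
    fourier f k1%:Z k2%:Z *: (tau (toepS n k1) *t tau (toepS n k2)).

Section Distributions.
Context {R : realType} {d : measure_display} {T : measurableType d}.
Variables (nu : {measure set T -> \bar R}).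

Definition compact_support (V : topologicalType) (F : V -> CC R) : Prop :=
  compact (closure [set x | F x != 0]).

Definition admissible (D : set T) (psi : T -> CC R) : Prop :=
  [/\ measurable D, (0 < nu D)%E, (nu D < +oo)%E & cmeasurable D psi].

Definition sigma_distr (A : mxseq R) (D : set T) (psi : T -> CC R) : Prop :=
  admissible D psi /\
  forall F : R -> CC R, continuous F -> compact_support F ->
    (n * n)%:R^-1 * \sum_(s <- singvals (A n)) F s @[n --> \oo] -->
      ((fine (nu D))^-1%:C * cintegral nu D (fun x => F (cmod (psi x))) : CC R).

Definition lambda_distr (A : mxseq R) (D : set T) (psi : T -> CC R) : Prop :=
  admissible D psi /\
  forall F : CC R -> CC R, continuous F -> compact_support F ->
    (n * n)%:R^-1 * \sum_(z <- eigvals (A n)) F z @[n --> \oo] -->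
      ((fine (nu D))^-1%:C * cintegral nu D (fun x => F (psi x)) : CC R).

End Distributions.

Section GLT.
Context {R : realType}.

Fixpoint Ck (k : nat) (f : R * R -> R) : Prop :=
  continuous f /\
  if k is k'.+1 then
    [/\ forall x, derivable f x (1, 0), forall x, derivable f x (0, 1),
        Ck k' ('D_(1, 0) f) & Ck k' ('D_(0, 1) f)]
  else True.

(* Elements of C^oo([0,1]^2) are represented by smooth extensions to the
   plane; only the values on [0,1]^2 are ever used. *)
Definition csmooth (a : R * R -> CC R) : Prop :=
  forall k, Ck k (fun x => complex.Re (a x)) /\ Ck k (fun x => complex.Im (a x)).

Definition trig_poly (f : R * R -> CC R) : Prop :=
  exists s : seq (CC R * (int * int)), forall th,
    f th = \sum_(p <- s) p.1 * cis (p.2.1%:~R * th.1 + p.2.2%:~R * th.2).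

(* B m n is the matrix B_{n,m}. *)
Definition is_acs (B : nat -> mxseq R) (A : mxseq R) : Prop :=
  exists (n_ : nat -> nat) (c w : nat -> R),
    [/\ c m @[m --> \oo] --> 0, w m @[m --> \oo] --> 0 &
      forall m n, (n_ m <= n)%N ->
        exists Rk Nm : 'M[CC R]_(n * n),
          [/\ A n = B m n + Rk + Nm,
              (\rank Rk)%:R <= c m * (n * n)%:R &
              specnorm Nm <= w m]].

(* The symbol kappa takes the pair (x, theta) in [0,1]^2 x [-pi,pi]^2. *)
Definition is_GLT (A : mxseq R) (kappa : plane R * plane R -> CC R) : Prop :=
  let dom := unit_square R `*` torus R in
  cmeasurable dom kappa /\
  exists (N : nat -> nat) (a f : nat -> nat -> plane R -> CC R),
    [/\ forall m i, (i < N m)%N -> csmooth (a m i) /\ trig_poly (f m i),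
        cvg_in_measure (leb4 R) dom
          (fun m p => \sum_(i < N m) a m i p.1 * f m i p.2) kappa &
        is_acs (fun m n => \sum_(i < N m)
                  sampling (fun j => j%:R / n%:R) (a m i) n *m
                  toeplitz (f m i) n) A].

End GLT.

Section Symbols.
Context {R : realType}.

Definition t_symb (alpha : R) (th : plane R) : CC R :=
  ((4 * sin (th.1 / 2) ^+ 2 + 4 * sin (th.2 / 2) ^+ 2) `^ (alpha / 2))%:C.

(* mu_M *)
Definition trunc (mu : plane R -> CC R) (M : R) : plane R -> CC R :=
  fun x => if cmod (mu x) <= M then mu x else M%:C.

Definition subdivision (p : nat) (s : nat -> R) (delta : R) : Prop :=
  [/\ s 0%N = 0, s p = 1 &
      forall i, (i < p)%N -> s i <= s i.+1 /\ s i.+1 - s i < delta].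

(* Riemann integrability on [0,1]^2: the Riemann sums over tagged rectangular
   grids converge as the mesh goes to 0. *)
Definition riemann_integrable (f : plane R -> CC R) : Prop :=
  exists I : CC R, forall e : R, 0 < e ->
    exists2 delta : R, 0 < delta &
      forall (p q : nat) (s t : nat -> R) (xi : nat -> nat -> plane R),
        subdivision p s delta -> subdivision q t delta ->
        (forall i j, (i < p)%N -> (j < q)%N ->
           s i <= (xi i j).1 <= s i.+1 /\ t j <= (xi i j).2 <= t j.+1) ->
        cmod (\sum_(i < p) \sum_(j < q)
                ((s i.+1 - s i) * (t j.+1 - t j))%:C * f (xi i j) - I) < e.

End Symbols.

(* Main.v *)
(* Write t for the symbol and V for the two-level sine transform, which is real,
   symmetric and orthogonal.  All tau matrices are diagonal in the basis V, so
   P = V diag(p) V, the p_i being explicit cosine sums at the grid points.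

   Approximating t uniformly on the torus by cosine polynomials (Weierstrass)
   and using Bessel's inequality, the Frobenius norms of T(t) - tau(T(t)), of
   T(t) - T(q) for a cosine polynomial q close to t, and of the error
   p_i - t(grid point) are o(n) up to the approximation error.  Hence, by
   Markov's inequality, each of these is the sum of a matrix of rank o(n^2) and
   of a matrix of norm o(1) ("small" below).  This gives the GLT property of P,
   and its distributions reduce to averages of F(t) over the grid.

   X - P, with X = T(t) + h^alpha D(mu), is small as well: were |mu| large at a
   positive proportion of the sample points for arbitrarily large bounds,
   integrability of the truncations would produce sets of measure bounded below
   on which |mu| exceeds every integer.  As t vanishes only at the origin, P^-1
   is bounded off a subspace of small dimension, so P^-1 X - 1 is small, which
   gives the GLT property and, by counting singular values, the singular value
   distribution.

   P^-1 X need not be normal, and P need not be positive definite.  The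
   eigenvalue count uses that P^-1 X is self-adjoint for the indefinite form P,
   which is positive definite on a subspace of small codimension: only few
   eigenvalues can then be nonreal or far from 1. *)

Require Import Defs.
From HB Require Import structures.
From mathcomp Require Import all_boot all_order all_algebra spectral.
From mathcomp Require Import all_classical all_reals all_analysis.
From mathcomp Require Import measurable_realfun.
From mathcomp Require Import complex mxtens.
From mathcomp Require Import ring lra zify.
Set Implicit Arguments.
Unset Strict Implicit.
Unset Printing Implicit Defensive.
Import Order.TTheory GRing.Theory Num.Theory.
Import numFieldNormedType.Exports.
Local Open Scope classical_set_scope.
Local Open Scope ring_scope.
Local Open Scope complex_scope.
Local Open Scope sesquilinear_scope.

(** * Moduli, conjugate transposes and quadratic forms *)

(** The matrix [invmx P *m X] may have Jordan blocks and [P] may have negative eigenvalues, so its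
    eigenvalues are counted on invariant subspaces, with [P] as a Hermitian form. Root subspaces for
    z and w are P-orthogonal unless z is the conjugate of w. Hence [P] vanishes on the sum of those
    for the open upper half plane; such a subspace meets the one where [P] is positive only in 0, so
    its dimension is at most the codimension of the latter. On the invariant subspace of the real
    eigenvalues farther than eta from 1, with induced map A, the matrix (A - 1)^2 - eta^2 has
    positive spectrum, hence is the square of a real polynomial in A, which is P-self-adjoint. With
    Z = X - P this makes Z P^-1 Z - eta^2 P a pull-back of [P], nonnegative on a small codimension,
    although it is negative where Z is small and [P] large. The same count with P = 1 and X = Q^* Q
    serves the singular values of Q.

    Bessel stands in for decay of the Fourier coefficients: frequencies below a fixed degree are
    few, and the others carry only the energy of a uniformly small remainder. *)

Section ComplexBasics.
Context {R : realType}.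
Local Notation C := (CC R).
Local Notation re z := (complex.Re (z : C)).
Local Notation im z := (complex.Im (z : C)).
Implicit Types z w : C.

Lemma ReD z w : re (z + w) = re z + re w. Proof. by case: z w => a b []. Qed.
Lemma ImD z w : im (z + w) = im z + im w. Proof. by case: z w => a b []. Qed.
Lemma ReN z : re (- z) = - re z. Proof. by case: z. Qed.
Lemma ImN z : im (- z) = - im z. Proof. by case: z. Qed.
Lemma ReM z w : re (z * w) = re z * re w - im z * im w.
Proof. by case: z w => a b []. Qed.
Lemma ImM z w : im (z * w) = re z * im w + im z * re w.
Proof. by case: z w => a b [c d] /=; rewrite addrC. Qed.
Lemma ReC (x : R) : re x%:C = x. Proof. by []. Qed.
Lemma ImC (x : R) : im x%:C = 0. Proof. by []. Qed.
Lemma Re_conj z : re (Num.conj z) = re z. Proof. by case: z. Qed.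
Lemma Im_conj z : im (Num.conj z) = - im z. Proof. by case: z. Qed.

Lemma complex_eqP z w : re z = re w -> im z = im w -> z = w.
Proof. by case: z w => a b [c d] /= -> ->. Qed.

Lemma Re_sum I (r : seq I) (P : pred I) (F : I -> C) :
  re (\sum_(i <- r | P i) F i) = \sum_(i <- r | P i) re (F i).
Proof. by apply: (big_morph (fun z => re z)) => //; exact: ReD. Qed.

Lemma Im_sum I (r : seq I) (P : pred I) (F : I -> C) :
  im (\sum_(i <- r | P i) F i) = \sum_(i <- r | P i) im (F i).
Proof. by apply: (big_morph (fun z => im z)) => //; exact: ImD. Qed.

Lemma RC_sum I (r : seq I) (P : pred I) (F : I -> R) :
  ((\sum_(i <- r | P i) F i)%:C = \sum_(i <- r | P i) (F i)%:C :> C).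
Proof. by rewrite rmorph_sum. Qed.

Lemma normCmod z : `|z| = (cmod z)%:C.
Proof. by rewrite /cmod normc_def ReC. Qed.

Lemma cmodE z : cmod z = Num.sqrt (re z ^+ 2 + im z ^+ 2).
Proof. by rewrite /cmod normc_def. Qed.

Lemma cmod_ge0 z : 0 <= cmod z. Proof. by rewrite cmodE sqrtr_ge0. Qed.

Lemma sqr_cmod z : cmod z ^+ 2 = re z ^+ 2 + im z ^+ 2.
Proof. by rewrite cmodE sqr_sqrtr// addr_ge0// sqr_ge0. Qed.

Lemma RC_inj (x y : R) : (x%:C = y%:C :> C) -> x = y.
Proof. by case. Qed.

Lemma cmodM z w : cmod (z * w) = cmod z * cmod w.
Proof. by apply: RC_inj; rewrite -normCmod normrM !normCmod rmorphM. Qed.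

Lemma le_cmodD z w : cmod (z + w) <= cmod z + cmod w.
Proof. by rewrite -lecR rmorphD -!normCmod ler_normD. Qed.

Lemma cmodN z : cmod (- z) = cmod z. Proof. by rewrite /cmod normrN. Qed.

Lemma cmodC (x : R) : cmod (x%:C) = `|x|.
Proof. by rewrite cmodE expr0n addr0 sqrtr_sqr. Qed.

Lemma cmod0_eq0 z : cmod z = 0 -> z = 0.
Proof. by move=> h; apply: normr0_eq0; rewrite normCmod h. Qed.

Lemma Re_le_cmod z : `|re z| <= cmod z.
Proof.
rewrite -ler_sqr ?nnegrE ?cmod_ge0// real_normK ?num_real//.
by rewrite sqr_cmod lerDl sqr_ge0.
Qed.

Lemma Im_le_cmod z : `|im z| <= cmod z.
Proof.
rewrite -ler_sqr ?nnegrE ?cmod_ge0// real_normK ?num_real//.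
by rewrite sqr_cmod lerDr sqr_ge0.
Qed.

Lemma cmod_le_ReIm z : cmod z <= `|re z| + `|im z|.
Proof.
rewrite -ler_sqr ?nnegrE ?cmod_ge0 ?addr_ge0// sqr_cmod.
rewrite sqrrD !real_normK ?num_real// -addrA lerD2l lerDr.
by rewrite mulrn_wge0// mulr_ge0.
Qed.

Lemma cmod_sum I (r : seq I) (P : pred I) (F : I -> C) :
  cmod (\sum_(i <- r | P i) F i) <= \sum_(i <- r | P i) cmod (F i).
Proof.
rewrite -lecR RC_sum -normCmod; apply: (le_trans (ler_norm_sum _ _ _)).
by apply: ler_sum => i _; rewrite normCmod.
Qed.

Lemma cmod_dist z w : `|cmod z - cmod w| <= cmod (z - w).
Proof.
rewrite ler_norml; apply/andP; split.
  have := le_cmodD z (w - z).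
  by rewrite addrC subrK -[cmod (w - z)]cmodN opprB => h; lra.
by have := le_cmodD (z - w) w; rewrite subrK => h; lra.
Qed.

End ComplexBasics.

(** * Squared norms, Hermitian forms and operator bounds on row vectors *)

Section RowForms.
Context {R : realType}.
Local Notation C := (CC R).
Local Notation re z := (complex.Re (z : C)).
Local Notation im z := (complex.Im (z : C)).

Definition sqn n (v : 'rV[C]_n) : R := \sum_j cmod (v 0 j) ^+ 2.

(** Real-valued for every [M]; for Hermitian [M] the discarded imaginary part is zero. *)
Definition qform n (M : 'M[C]_n) (v : 'rV[C]_n) : R := re ((v *m M *m v^t*) 0 0).

Lemma trmxC_mul m n p (A : 'M[C]_(m, n)) (B : 'M[C]_(n, p)) :
  (A *m B)^t* = B^t* *m A^t*.
Proof. by rewrite trmx_mul map_mxM. Qed.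

Lemma trmxC_add m n (A B : 'M[C]_(m, n)) : (A + B)^t* = A^t* + B^t*.
Proof. by rewrite linearD/= map_mxD. Qed.

Lemma trmxC_opp m n (A : 'M[C]_(m, n)) : (- A)^t* = - A^t*.
Proof. by rewrite linearN/= map_mxN. Qed.

Lemma trmxC1 n : (1%:M : 'M[C]_n)^t* = 1%:M.
Proof. by rewrite trmx1 map_mx1. Qed.

Lemma trmxC_scale m n (c : R) (A : 'M[C]_(m, n)) :
  (c%:C *: A)^t* = c%:C *: A^t*.
Proof.
apply/matrixP => i j; rewrite !mxE rmorphM/=; congr (_ * _).
by apply: complex_eqP => /=; rewrite ?oppr0.
Qed.

Lemma trmxC_unit n (A : 'M[C]_n) : (A^t* \in unitmx) = (A \in unitmx).
Proof. by rewrite map_unitmx unitmx_tr. Qed.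

Lemma mxrank_trmxC m n (A : 'M[C]_(m, n)) : \rank (A^t*) = \rank A.
Proof. by rewrite mxrank_map mxrank_tr. Qed.

Lemma mulmx_trmxC n (v : 'rV[C]_n) : v *m v^t* = (sqn v)%:C%:M.
Proof.
apply/matrixP => i j; rewrite !mxE !ord1 eqxx mulr1n RC_sum.
apply: eq_bigr => k _; rewrite !mxE; apply: complex_eqP.
  by rewrite ReM Re_conj Im_conj ReC sqr_cmod; ring.
by rewrite ImM Re_conj Im_conj ImC; ring.
Qed.

Lemma qform1 n (v : 'rV[C]_n) : qform 1%:M v = sqn v.
Proof. by rewrite /qform mulmx1 mulmx_trmxC mxE eqxx. Qed.

Lemma qformD n (M N : 'M[C]_n) v : qform (M + N) v = qform M v + qform N v.
Proof. by rewrite /qform mulmxDr mulmxDl mxE ReD. Qed.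

Lemma qformN n (M : 'M[C]_n) v : qform (- M) v = - qform M v.
Proof. by rewrite /qform mulmxN mulNmx mxE ReN. Qed.

Lemma qformZ n (c : R) (M : 'M[C]_n) v : qform (c%:C *: M) v = c * qform M v.
Proof. by rewrite /qform -scalemxAr -scalemxAl mxE ReM ReC ImC mul0r subr0. Qed.

Lemma qform_congr m n (X : 'M[C]_(m, n)) (M : 'M[C]_n) v :
  qform (X *m M *m X^t*) v = qform M (v *m X).
Proof. by rewrite /qform trmxC_mul !mulmxA. Qed.

Lemma qform_mulC n (M : 'M[C]_n) v : qform (M *m M^t*) v = sqn (v *m M).
Proof. by rewrite -qform1 -(mulmx1 M) -qform_congr !mulmx1. Qed.

Lemma sqn_ge0 n (v : 'rV[C]_n) : 0 <= sqn v.
Proof. by apply: sumr_ge0 => j _; rewrite sqr_ge0. Qed.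

Lemma sqn_eq0 n (v : 'rV[C]_n) : (sqn v == 0) = (v == 0).
Proof.
apply/eqP/eqP => [h|->]; last first.
  by rewrite /sqn big1// => j _; rewrite mxE /cmod normr0 ReC expr0n.
apply/rowP => j; rewrite mxE; apply: cmod0_eq0; apply/eqP.
rewrite -sqrf_eq0; move/eqP: h; rewrite psumr_eq0//; last first.
  by move=> i _; rewrite sqr_ge0.
by move=> /allP/(_ j (mem_index_enum _)).
Qed.

Lemma sqn_gt0 n (v : 'rV[C]_n) : v != 0 -> 0 < sqn v.
Proof. by move=> v0; rewrite lt_neqAle sqn_ge0 andbT eq_sym sqn_eq0. Qed.

Lemma sqnDl n (s : R) (v w : 'rV[C]_n) : 0 < s ->
  sqn (v + w) <= (1 + s) * sqn v + (1 + s^-1) * sqn w.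
Proof.
move=> s0; rewrite /sqn !mulr_sumr -big_split/=; apply: ler_sum => j _.
rewrite mxE !sqr_cmod ReD ImD.
have key (a b : R) : (a + b) ^+ 2 <= (1 + s) * a ^+ 2 + (1 + s^-1) * b ^+ 2.
  have : 0 <= s^-1 * (s * a - b) ^+ 2 by rewrite mulr_ge0 ?sqr_ge0// invr_ge0 ltW.
  suff -> : s^-1 * (s * a - b) ^+ 2
    = s * a ^+ 2 - 2 * (a * b) + s^-1 * b ^+ 2 by move=> h; nra.
  by field; rewrite gt_eqF.
by have := key (re (v 0 j)) (re (w 0 j)); have := key (im (v 0 j)) (im (w 0 j)); lra.
Qed.

Lemma sqnD n (v w : 'rV[C]_n) : sqn (v + w) <= 2 * sqn v + 2 * sqn w.
Proof. by have := @sqnDl n 1 v w ltr01; rewrite invr1. Qed.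

(** An operator-norm bound that avoids singular values, so that sums and products are immediate;
    [specnorm_le] converts it to the spectral norm at the end. *)
Definition bounded_by n (N : 'M[C]_n) (w : R) :=
  forall v, sqn (v *m N) <= w ^+ 2 * sqn v.

Lemma bounded_byM n (M N : 'M[C]_n) a b :
  bounded_by M a -> bounded_by N b -> bounded_by (M *m N) (a * b).
Proof.
move=> hM hN v; rewrite mulmxA; apply: (le_trans (hN _)).
by apply: (le_trans (ler_wpM2l (sqr_ge0 b) (hM v))); rewrite exprMn mulrA [b ^+ 2 * _]mulrC.
Qed.

(** The factor 2 is the price of using [sqnD] instead of the triangle inequality; it is harmless in
    an epsilon argument. *)
Lemma bounded_byD n (M N : 'M[C]_n) a b : 0 <= a -> 0 <= b ->
  bounded_by M a -> bounded_by N b -> bounded_by (M + N) (2 * (a + b)).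
Proof.
move=> a0 b0 hM hN v; rewrite mulmxDr; apply: (le_trans (sqnD _ _)).
have := hM v; have := hN v; have := sqn_ge0 v.
set x := sqn (v *m M); set y := sqn (v *m N); set z := sqn v => z0 yz xz.
have : 0 <= (4 * (a * b) + a ^+ 2 + b ^+ 2) * z.
  apply: mulr_ge0 => //.
  by have := mulr_ge0 a0 b0; have := sqr_ge0 a; have := sqr_ge0 b; lra.
by lra.
Qed.

Lemma bounded_byS n (M : 'M[C]_n) a b : 0 <= a -> a <= b ->
  bounded_by M a -> bounded_by M b.
Proof.
move=> a0 ab hM v; apply: (le_trans (hM v)).
by rewrite ler_wpM2r ?sqn_ge0// ler_sqr ?nnegrE// (le_trans a0).
Qed.

(* |y|^2 = <x, y N^*> with y = x N, and 2 Re <a, b> <= w^2 |a|^2 + |b|^2 / w^2 *)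
Lemma bounded_by_adj n (N : 'M[C]_n) w : 0 < w ->
  bounded_by N w -> bounded_by (N^t*) w.
Proof.
move=> w0 hN x; set y := x *m N^t*.
have w2 : 0 < w ^+ 2 by rewrite exprn_gt0.
have /= := hN y; set z := y *m N => hz.
have e : sqn y = re ((x *m z^t*) 0 0).
  by rewrite /z trmxC_mul mulmxA -/y mulmx_trmxC mxE eqxx.
have h : 0 <= sqn (w%:C *: x - w^-1%:C *: z) := sqn_ge0 _.
have eq1 : sqn (w%:C *: x - w^-1%:C *: z)
    = w ^+ 2 * sqn x - 2 * re ((x *m z^t*) 0 0) + (w ^+ 2)^-1 * sqn z.
  rewrite !mxE Re_sum /sqn !mulr_sumr -sumrB -big_split/=.
  apply: eq_bigr => j _; rewrite !mxE !sqr_cmod ReD ImD ReN ImN.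
  rewrite ReM !ReM !ImM !Re_conj !Im_conj !ReC !ImC.
  by field; rewrite gt_eqF.
have : (w ^+ 2)^-1 * sqn z <= sqn y by rewrite mulrC ler_pdivrMr// mulrC.
by rewrite eq1 -e in h; move=> h2; lra.
Qed.

Lemma bounded_by_scalar n (c : C) : bounded_by (c%:M : 'M[C]_n) (cmod c).
Proof.
move=> v; rewrite mul_mx_scalar /sqn mulr_sumr; apply: ler_sum => j _.
by rewrite mxE cmodM exprMn.
Qed.

Lemma bounded_by_diag n (d : 'rV[C]_n) w : (forall i, cmod (d 0 i) <= w) ->
  bounded_by (diag_mx d) w.
Proof.
move=> h v; rewrite /sqn mulr_sumr; apply: ler_sum => j _.
rewrite mul_mx_diag mxE cmodM exprMn mulrC ler_wpM2r ?sqr_ge0//.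
by rewrite ler_sqr ?nnegrE ?cmod_ge0// (le_trans (cmod_ge0 _) (h j)).
Qed.

Lemma bounded_by_unitary n (U : 'M[C]_n) : U *m U^t* = 1%:M -> bounded_by U 1.
Proof. by move=> h v; rewrite -qform_mulC h qform1 expr1n mul1r. Qed.

End RowForms.

(** * Eigenvalue counts for Hermitian pencils *)

Lemma char_poly_conj (F : fieldType) n (B A : 'M[F]_n) : B \in unitmx ->
  char_poly (B *m A *m invmx B) = char_poly A.
Proof.
move=> uB; rewrite /char_poly.
have -> : char_poly_mx (B *m A *m invmx B) =
    map_mx polyC B *m char_poly_mx A *m map_mx polyC (invmx B).
  rewrite /char_poly_mx mulmxBr mulmxBl -!map_mxM; congr (_ - _).
  by rewrite mul_mx_scalar -scalemxAl -map_mxM mulmxV// map_mx1 scalemx1.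
rewrite !det_mulmx mulrC mulrA -det_mulmx -map_mxM mulVmx// map_mx1 det1.
by rewrite mul1r.
Qed.

Lemma char_poly_lblock (F : fieldType) n1 n2 (A : 'M[F]_n1) (B : 'M[F]_(n2, n1))
    (D : 'M[F]_n2) :
  char_poly (block_mx A 0 B D) = char_poly A * char_poly D.
Proof.
rewrite /char_poly /char_poly_mx map_block_mx scalar_mx_block opp_block_mx.
by rewrite add_block_mx map_mx0 subr0 sub0r det_lblock.
Qed.

(** Induction on the selected roots: an eigenvector for the first one, completed to a basis, makes
    [A] block triangular, and the remaining roots belong to the lower right block. Multiplicities
    are respected without any diagonalizability, and [s] may be any part of the spectrum. *)
Lemma invariant_subspace (F : fieldType) (s : seq F) n (A : 'M[F]_n) (h : {poly F}) :
  char_poly A = \prod_(z <- s) ('X - z%:P) * h ->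
  exists (X : 'M[F]_(size s, n)) (A1 : 'M[F]_(size s)),
    [/\ row_free X, X *m A = A1 *m X &
        char_poly A1 = \prod_(z <- s) ('X - z%:P)].
Proof.
elim: s n A h => [|z s IH] n A h E.
  exists 0, 0; split; first by rewrite /row_free mxrank0.
    by rewrite !mul0mx.
  by rewrite big_nil /char_poly det_mx00.
have : eigenvalue A z by rewrite eigenvalue_root_char E big_cons !rootM root_XsubC eqxx.
case/eigenvalueP => v vA v0.
case: n A E v vA v0 => [|n] A E v vA v0; first by rewrite thinmx0 eqxx in v0.
pose B : 'M[F]_(1 + n) := row_ebase v; have uB : B \in unitmx := row_ebase_unit v.
have rv : \rank v = 1%N by rewrite rank_rV v0.
pose e : 'rV[F]_(1 + n) := row_mx 1%:M 0.
(* As [v] has rank 1, the first row of [row_ebase v] is a nonzero multiple of [v]. *)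
have [c c0 vE] : exists2 c, c != 0 & v = c *: (e *m B).
  exists (col_ebase v 0 0).
    apply: contraNneq v0 => c0; rewrite -(mulmx_ebase v).
    by rewrite [col_ebase v]mx11_scalar c0 -scalemx1 scale0r !mul0mx.
  rewrite -{1}(mulmx_ebase v) rv {1}[col_ebase v]mx11_scalar -mulmxA.
  by rewrite mul_scalar_mx (pid_mx_row _ n 1).
pose A' : 'M[F]_(1 + n) := B *m A *m invmx B.
have eA : e *m A' = z *: e.
  have : e *m B *m A = z *: (e *m B).
    apply: (scalerI c0); rewrite scalerA mulrC -scalerA -vE -vA.
    by rewrite {1}vE -scalemxAl.
  rewrite /A' !mulmxA => ->; rewrite -scalemxAl -mulmxA mulmxV//.
  by rewrite mulmx1.
have A'E : A' = block_mx z%:M 0 (dlsubmx A') (drsubmx A').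
  rewrite -{1}(submxK A'); move: eA; rewrite /e -{1}(submxK A') mul_row_block.
  rewrite !mul1mx !mul0mx !addr0 scale_row_mx scaler0 scalemx1 => /eq_row_mx[].
  by move=> -> ->.
have BA : B *m A = A' *m B by rewrite /A' -[RHS]mulmxA mulVmx// mulmx1.
have : char_poly (drsubmx A') = \prod_(z0 <- s) ('X - z0%:P) * h.
  apply: (@mulfI _ ('X - z%:P)); first by rewrite polyXsubC_eq0.
  rewrite mulrA; move: (E); rewrite big_cons => <-; have -> : char_poly A = char_poly A' by rewrite /A' char_poly_conj.
  rewrite [in RHS]A'E.
  by rewrite char_poly_lblock; congr (_ * _); rewrite /char_poly det_mx11 !mxE.
case/IH => X1 [A1] [fX XA cA].
(* The subspace found for the quotient is lifted and the eigenvector is added in front; the lower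
   left block of [A2] records the coupling with that eigenvector. *)
pose X2 : 'M[F]_(1 + size s, 1 + n) := block_mx 1%:M 0 0 X1.
pose A2 : 'M[F]_(1 + size s) := block_mx z%:M 0 (X1 *m dlsubmx A') A1.
have XA2 : X2 *m A' = A2 *m X2.
  rewrite [in LHS]A'E !mulmx_block !mul1mx !mul0mx !mulmx0 !mulmx1 !addr0 !add0r.
  by rewrite XA.
exists (X2 *m B), A2; split.
- rewrite /row_free mxrankMfree; last by rewrite row_free_unit.
  have -> := rank_diag_block_mx (1%:M : 'M[F]_1) X1.
  by rewrite mxrank1 (eqP fX).
- by rewrite -mulmxA BA mulmxA XA2 mulmxA.
- apply: (etrans (@char_poly_lblock F 1 (size s) z%:M (X1 *m dlsubmx A') A1)); rewrite cA big_cons; congr (_ * _).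
  by rewrite /char_poly det_mx11 !mxE.
Qed.

(* [S ^ 2 - p] vanishes modulo the partial product [g]; the next root [l] is
   absorbed by adding [c g], where [c] solves a quadratic equation whose
   discriminant is [4 p(l)]. *)
Lemma real_sqrt_mod (R : rcfType) (p : {poly R}) (s : seq R) :
  {in s, forall l, 0 < p.[l]} ->
  exists S w : {poly R}, S ^+ 2 - p = \prod_(l <- s) ('X - l%:P) * w.
Proof.
elim: s => [_|l s IH hs].
  by exists 0, (- p); rewrite big_nil expr0n sub0r mul1r.
have [x xs|S [w E]] := IH; first by apply: hs; rewrite inE xs orbT.
have pl : 0 < p.[l] by apply: hs; rewrite inE eqxx.
set g := \prod_(l0 <- s) _ in E.
have El : S.[l] ^+ 2 - p.[l] = g.[l] * w.[l].
  by rewrite -hornerM -E hornerD hornerN horner_exp.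
have [c hc] : exists c, w.[l] + 2 * S.[l] * c + c ^+ 2 * g.[l] = 0.
  have [g0|g0] := eqVneq g.[l] 0.
    have S0 : S.[l] != 0.
      by apply/eqP => S0; move: El; rewrite S0 g0 expr0n mul0r sub0r; lra.
    by exists (- w.[l] / (2 * S.[l])); rewrite g0; field.
  exists ((Num.sqrt p.[l] - S.[l]) / g.[l]).
  have sq := sqr_sqrtr (ltW pl).
  have -> : w.[l] = (S.[l] ^+ 2 - Num.sqrt p.[l] ^+ 2) / g.[l].
    by rewrite sq El mulrAC mulfV// mul1r.
  by field.
have /factor_theorem[w' hw'] : root (w + (2 * c)%:P * S + (c ^+ 2)%:P * g) l.
  by rewrite /root !(hornerD, hornerM, hornerC); apply/eqP; rewrite -hc; ring.
exists (S + c%:P * g), w'.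
rewrite big_cons -/g.
transitivity (g * (w' * ('X - l%:P))); last by ring.
rewrite -hw'.
have -> : p = S ^+ 2 - g * w by rewrite -E; ring.
rewrite polyCM polyC_exp.
have -> : (2 : R)%:P = 2%:R :> {poly R} by rewrite -polyC_natr.
by ring.
Qed.

Lemma horner_mx_intertwine (F : fieldType) m n (A : 'M[F]_m.+1) (B : 'M[F]_n.+1)
    (N : 'M[F]_(m.+1, n.+1)) (p : {poly F}) :
  A *m N = N *m B -> horner_mx A p *m N = N *m horner_mx B p.
Proof.
move=> h; elim/poly_ind: p => [|p c IH].
  by rewrite !rmorph0 mul0mx mulmx0.
rewrite !rmorphD !rmorphM/= !horner_mx_X !horner_mx_C.
rewrite mulmxDl mulmxDr -!mulmxE -mulmxA h mulmxA IH -mulmxA.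
by rewrite mul_scalar_mx mul_mx_scalar.
Qed.

(** Turns an argument on vectors into a bound for [k]: below, [M] factors through constraint
    matrices of small rank. *)
Lemma row_free_bound (F : fieldType) k p (M : 'M[F]_(k, p)) :
  (forall v : 'rV_k, v *m M = 0 -> v = 0) -> k = \rank M.
Proof.
move=> h; apply/esym/eqP; rewrite -/(row_free M) -kermx_eq0.
by apply/eqP/row_matrixP => i; rewrite row0; apply: h; rewrite -row_mul mulmx_ker row0.
Qed.

(** * Spectra of [invmx P *m X] through the form [P] *)

Section Pencil.
Context {R : realType}.
Local Notation C := (CC R).
Local Notation re z := (complex.Re (z : C)).
Local Notation im z := (complex.Im (z : C)).

Lemma eigvalsE n (A : 'M[C]_n) :
  char_poly A = \prod_(z <- eigvals A) ('X - z%:P).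
Proof.
rewrite /eigvals; case: closed_field_poly_normal => r /= E.
by rewrite {1}E (monicP (char_poly_monic A)) scale1r.
Qed.

Lemma unitmx_sub_scalar n (A : 'M[C]_n) a :
  ~~ root (char_poly A) a -> A - a%:M \in unitmx.
Proof.
rewrite -eigenvalue_root_char /eigenvalue /eigenspace negbK kermx_eq0.
by rewrite row_free_unit.
Qed.

(* The Gram matrix of [P] on an invariant subspace on which the spectrum avoids
   its own conjugate solves a homogeneous Sylvester equation, hence is zero. *)
Lemma sylvester_eq0 k (A N : 'M[C]_k) (s : seq C) :
  char_poly A = \prod_(z <- s) ('X - z%:P) ->
  {in s &, forall z w, z != Num.conj w} ->
  A *m N = N *m A^t* -> N = 0.
Proof.
case: k A N => [|k] A N cA hs AN; first by apply/matrixP => -[].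
have := horner_mx_intertwine (char_poly A) AN.
rewrite Cayley_Hamilton mul0mx => /esym/eqP.
(* [char_poly A] evaluated at [A^t*] is a product of factors [A^t* - z%:M], each invertible because
   the conjugate of [z] is not a root of [char_poly A]. *)
suff u : horner_mx (A^t*) (char_poly A) \in unitmx.
  by move/eqP/(congr1 (mulmx^~ (invmx (horner_mx (A^t*) (char_poly A)))));
     rewrite mulmxK// mul0mx.
have : {in s, forall z, A^t* - z%:M \in unitmx}.
  move=> z zs; rewrite -trmxC_unit trmxC_add trmxCK trmxC_opp.
  rewrite tr_scalar_mx map_scalar_mx; apply: unitmx_sub_scalar.
  rewrite cA root_prod_XsubC; apply/negP => zs'.
  by have := hs _ _ zs' zs; rewrite eqxx.
rewrite cA rmorph_prod/= => h; elim: s {cA hs} h => [|z s IH] h.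
  by rewrite big_nil; exact: unitmx1.
rewrite big_cons -mulmxE unitmx_mul; apply/andP; split; last first.
  by apply: IH => w ws; apply: h; rewrite inE ws orbT.
by rewrite rmorphB/= horner_mx_X horner_mx_C; apply: h; rewrite inE eqxx.
Qed.

Local Notation rc := (real_complex R : {rmorphism R -> C}).

(** Conjugation fixes real coefficients. This is why the square root used in [count_real] has to be
    a real polynomial. *)
Lemma horner_mx_adj k (A : 'M[C]_k.+1) (p : {poly R}) :
  horner_mx (A^t*) (map_poly rc p) = (horner_mx A (map_poly rc p))^t*.
Proof.
elim/poly_ind: p => [|p c IH]; first by rewrite !rmorph0 trmx0 map_mx0.
rewrite !rmorphD !rmorphM/= !map_polyX !map_polyC/= !horner_mx_X !horner_mx_C.
rewrite IH trmxC_add tr_scalar_mx map_scalar_mx; congr (_ + _%:M); last first.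
  by apply: complex_eqP; rewrite ?Re_conj ?Im_conj ?ImC ?oppr0.
rewrite -!mulmxE -trmxC_mul; congr (_^t*).
by apply: (comm_mx_horner _ (comm_mx_refl A)).
Qed.

Lemma mxrank_row_mx m n1 n2 (A : 'M[C]_(m, n1)) (B : 'M[C]_(m, n2)) :
  (\rank (row_mx A B) <= \rank A + \rank B)%N.
Proof.
rewrite -mxrank_tr tr_row_mx -addsmxE -(mxrank_tr A) -(mxrank_tr B).
exact: (mxrank_adds_leqif _ _).1.
Qed.

Lemma leq_count_predU T (a b c : pred T) (s : seq T) :
  (forall x, a x -> b x || c x) -> (count a s <= count b s + count c s)%N.
Proof.
move=> h; rewrite -count_predUI; apply: leq_trans (leq_addr _ _).
by apply: sub_count => x /h.
Qed.

Section PencilCluster.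
Variables (n : nat) (P X : 'M[C]_n).
Hypotheses (hP : P^t* = P) (hX : X^t* = X) (uP : P \in unitmx).
Let Z := X - P.
Let s := eigvals (invmx P *m X).

(** The rows of [Y] span the invariant subspace of [X *m invmx P] for the eigenvalues in [a]. The
    last clause says that the induced map is self-adjoint for the Gram matrix of [P]; it holds
    because [Y *m X *m Y^t*] is Hermitian. *)
Lemma pencil_invariant (a : pred C) :
  exists (Y : 'M[C]_(count a s, n)) (A : 'M[C]_(count a s)),
    [/\ row_free Y, Y *m X = A *m Y *m P,
        char_poly A = \prod_(z <- seq.filter a s) ('X - z%:P) &
        A *m (Y *m P *m Y^t*) = (Y *m P *m Y^t*) *m A^t*].
Proof.
have cA : char_poly (X *m invmx P) = \prod_(z <- seq.filter a s) ('X - z%:P) *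
    \prod_(z <- seq.filter (predC a) s) ('X - z%:P).
  rewrite -(@char_poly_conj _ _ (invmx P)) ?unitmx_inv// invmxK.
  by rewrite !mulmxA mulmxKV// eigvalsE !big_filter (bigID a).
have [Y [A [fY YA cA1]]] := invariant_subspace cA.
move: Y A fY YA cA1; rewrite size_filter => Y A fY YA cA1.
have YX : Y *m X = A *m Y *m P by rewrite -YA mulmxA mulmxKV.
exists Y, A; split => //.
rewrite !mulmxA -YX -hX; have := congr1 (fun M => M^t*) YX.
by rewrite !trmxC_mul hX hP -!mulmxA => <-.
Qed.

Variables (p2 p : nat) (K2 : 'M[C]_(n, p2)) (K : 'M[C]_(n, p)) (eta : R).
Hypothesis pos : forall v, v *m K2 = 0 -> v != 0 -> 0 < qform P v.

(** [P] vanishes on the invariant subspace by [sylvester_eq0], while it is positive on the kernel of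
    [K2]; the two meet only in 0. *)
Lemma count_neutral (a : pred C) : {in seq.filter a s &, forall z w, z != Num.conj w} ->
  (count a s <= \rank K2)%N.
Proof.
move=> ha; have [Y [A [fY YX cA AN]]] := pencil_invariant a.
have N0 := sylvester_eq0 cA ha AN.
suff -> : count a s = \rank (Y *m K2) by exact: mxrankM_maxr.
apply: row_free_bound => v; rewrite mulmxA => /pos h.
apply/eqP; apply: contraT => v0.
have := h; rewrite mulmx_free_eq0// => /(_ v0).
by rewrite -qform_congr N0 /qform mulmx0 mul0mx mxE ltxx.
Qed.

Hypothesis eta0 : 0 < eta.
Hypothesis small : forall v, v *m K = 0 -> v != 0 ->
  qform (Z *m invmx P *m Z) v < eta ^+ 2 * qform P v.

(** With [S1] a square root of (A - 1)^2 - eta^2 that is self-adjoint for the Gram matrix, [key]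
    exhibits the form Z P^-1 Z - eta^2 P on the subspace as [P] evaluated on [v *m S1 *m Y]. *)
Lemma count_real : (count (fun z : C => (im z == 0%R) && (eta < `|re z - 1|)%R) s
  <= \rank K2 + \rank K)%N.
Proof.
set a := (fun z : C => _).
have := pencil_invariant a; case: (count a s) => [//|k] [Y [A [fY YX cA AN]]].
set N := Y *m P *m Y^t* in AN.
pose q : {poly R} := ('X - 1) ^+ 2 - (eta ^+ 2)%:P.
have [S [w E]] : exists S w : {poly R}, S ^+ 2 - q =
    \prod_(l <- [seq re z | z <- seq.filter a s]) ('X - l%:P) * w.
  apply: real_sqrt_mod => l /mapP[z]; rewrite mem_filter => /andP[/andP[_ h] _] ->.
  rewrite /q !(hornerD, hornerN, hornerX, hornerC, horner_exp) subr_gt0.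
  by rewrite -[ltRHS]real_normK ?num_real// ltr_sqr ?nnegrE// ltW.
have cA' : map_poly rc (\prod_(l <- [seq re z | z <- seq.filter a s]) ('X - l%:P)) =
    char_poly A.
  rewrite cA rmorph_prod/= big_map !big_seq; apply: eq_bigr => z.
  rewrite mem_filter => /andP[/andP[/eqP z0 _] _].
  rewrite rmorphB/= map_polyX map_polyC; congr (_ - _%:P).
  by apply: complex_eqP.
pose S1 := horner_mx A (map_poly rc S).
have qE : horner_mx A (map_poly rc q) = (A - 1) ^+ 2 - ((eta ^+ 2)%:C)%:M.
  rewrite /q rmorphB/= map_polyC rmorphB/= horner_mx_C; congr (_ - _).
  by rewrite !rmorphXn/= !rmorphB/= map_polyX !rmorph1 horner_mx_X.
have S2 : S1 *m S1 = (A - 1) ^+ 2 - ((eta ^+ 2)%:C)%:M.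
  have : horner_mx A (map_poly rc (S ^+ 2 - q)) = 0.
    by rewrite E !rmorphM/= cA' Cayley_Hamilton mul0r.
  rewrite rmorphB/= rmorphB/= qE => /eqP; rewrite subr_eq0 => /eqP <-.
  by rewrite !rmorphXn/= expr2 mulmxE.
have A1Y : (A - 1) *m Y *m P = Y *m Z.
  by rewrite mulmxBl mulmxBl -YX mul1mx -mulmxBr.
have key : Y *m (Z *m invmx P *m Z) *m Y^t* - (eta ^+ 2)%:C *: N =
    S1 *m Y *m P *m (S1 *m Y)^t*.
  have -> : S1 *m Y *m P *m (S1 *m Y)^t* = S1 *m S1 *m N.
    have SN : S1 *m N = N *m S1^t*.
      by rewrite -horner_mx_adj (horner_mx_intertwine _ AN).
    transitivity (S1 *m N *m S1^t*); first by rewrite /N trmxC_mul !mulmxA.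
    by rewrite -mulmxA -SN mulmxA.
  rewrite S2 [RHS]mulmxBl mul_scalar_mx; congr (_ - _).
  have AN1 : (A - 1) *m N = Y *m Z *m Y^t* by rewrite /N !mulmxA A1Y.
  by rewrite expr2 -mulmxE -[RHS]mulmxA AN1 !mulmxA -A1Y mulmxK.
(* A nonzero vector killed by both blocks would give the form in [key] a negative value, by [small],
   and a nonnegative one, by [pos]. *)
suff -> : k.+1 = \rank (row_mx (Y *m K) (S1 *m Y *m K2)).
  apply: (leq_trans (mxrank_row_mx _ _)); rewrite addnC leq_add//; exact: mxrankM_maxr.
apply: row_free_bound => v; rewrite mul_mx_row -row_mx0 => /eq_row_mx[h1 h2].
apply/eqP; apply: contraT => v0.
have := @small (v *m Y); rewrite -(mulmxA v) => /(_ h1).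
rewrite mulmx_free_eq0// => /(_ v0); rewrite -!qform_congr -/N.
have : 0 <= qform (S1 *m Y *m P *m (S1 *m Y)^t*) v.
  rewrite qform_congr; case: (eqVneq (v *m (S1 *m Y)) 0) => [->|u0].
    by rewrite /qform !mul0mx mxE.
  by apply: ltW; apply: pos u0; move: h2; rewrite !mulmxA.
by rewrite -key qformD qformN qformZ; lra.
Qed.

(** One [\rank K2] for each open half plane, in which no two numbers are conjugate to each other,
    and one for the real eigenvalues far from 1. *)
Lemma pencil_cluster :
  (count (fun z : C => ~~ ((im z == 0%R) && (`|re z - 1| <= eta)%R)) s
   <= 3 * \rank K2 + \rank K)%N.
Proof.
have h1 : (count (fun z : C => (0 < im z)%R) s <= \rank K2)%N.
  apply: count_neutral => z w; rewrite !mem_filter => /andP[z0 _] /andP[w0 _].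
  by apply/eqP => zw; move: z0; rewrite zw Im_conj; lra.
have h2 : (count (fun z : C => (im z < 0)%R) s <= \rank K2)%N.
  apply: count_neutral => z w; rewrite !mem_filter => /andP[z0 _] /andP[w0 _].
  by apply/eqP => zw; move: z0; rewrite zw Im_conj; lra.
have := count_real.
set c3 := count _ s => h3.
apply: (@leq_trans (count (fun z : C => (0 < im z)%R) s +
  (count (fun z : C => (im z < 0)%R) s + c3))%N); last by lia.
apply: leq_trans.
  apply: (@leq_count_predU _ _ (fun z : C => (0 < im z)%R)
    (fun z : C => (im z < 0)%R || (im z == 0%R) && (eta < `|re z - 1|)%R)) => z.
  rewrite negb_and -ltNge; case: (ltgtP (im z) 0) => //=.
rewrite leq_add2l; exact: leq_count_predU.
Qed.

End PencilCluster.
End Pencil.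

(** * Small-rank plus small-norm matrices *)

Section Small.
Context {R : realType}.
Local Notation C := (CC R).
Local Notation re z := (complex.Re (z : C)).
Local Notation im z := (complex.Im (z : C)).

Lemma rank_diag_mx_le (F : fieldType) n (d : 'rV[F]_n) :
  (\rank (diag_mx d) <= #|[pred i | (d 0 i != 0)%R]|)%N.
Proof.
have -> : diag_mx d = \sum_(i in [pred i | (d 0 i != 0)%R]) d 0 i *: delta_mx i i.
  rewrite diag_mx_sum_delta (bigID (fun i => i \in [pred i | (d 0 i != 0)%R]))/=.
  rewrite [X in _ + X]big1 ?addr0// => i; rewrite inE negbK => /eqP ->.
  by rewrite scale0r.
rewrite -sum1_card; elim/big_rec2: _ => [|i k M _ h]; first by rewrite mxrank0.
apply: (leq_trans (mxrank_add _ _)); rewrite leq_add//.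
by apply: (leq_trans (mxrank_scale _ _)); rewrite mxrank_delta.
Qed.

(** The square of the Frobenius norm. *)
Definition fro m n (E : 'M[C]_(m, n)) : R := \sum_i sqn (row i E).

Lemma froE m n (E : 'M[C]_(m, n)) : fro E = \sum_i \sum_j cmod (E i j) ^+ 2.
Proof. by apply: eq_bigr => i _; apply: eq_bigr => j _; rewrite mxE. Qed.

Lemma sqn_unitary n (U : 'M[C]_n) (v : 'rV_n) : U *m U^t* = 1%:M ->
  sqn (v *m U) = sqn v.
Proof. by move=> h; rewrite -qform_mulC h qform1. Qed.

Lemma fro_mulr_unitary m n (E : 'M[C]_(m, n)) (U : 'M[C]_n) : U *m U^t* = 1%:M ->
  fro (E *m U) = fro E.
Proof. by move=> h; apply: eq_bigr => i _; rewrite row_mul sqn_unitary. Qed.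

Lemma fro_adj m n (E : 'M[C]_(m, n)) : fro (E^t*) = fro E.
Proof.
rewrite !froE exchange_big/=; apply: eq_bigr => i _; apply: eq_bigr => j _.
by rewrite !mxE !sqr_cmod Re_conj Im_conj sqrrN.
Qed.

Lemma fro_mull_unitary m n (E : 'M[C]_(m, n)) (U : 'M[C]_m) : U^t* *m U = 1%:M ->
  fro (U *m E) = fro E.
Proof.
by move=> h; rewrite -fro_adj trmxC_mul fro_mulr_unitary ?fro_adj// trmxCK.
Qed.

(** A single parameter bounds both the relative rank and the norm, in the shape of one term of an
    approximating class of sequences. *)
Definition small (eps : R) n (E : 'M[C]_n) :=
  exists A N : 'M[C]_n,
    [/\ E = A + N, (\rank A)%:R <= eps * n%:R & bounded_by N eps].

Lemma smallD a b n (E F : 'M[C]_n) : 0 <= a -> 0 <= b ->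
  small a E -> small b F -> small (2 * (a + b)) (E + F).
Proof.
move=> a0 b0 [A [N [-> h1 h2]]] [B [M [-> h3 h4]]].
exists (A + B), (N + M); split; first by rewrite addrACA.
  apply: (@le_trans _ _ (\rank A + \rank B)%:R).
    by rewrite ler_nat mxrank_add.
  have := ler0n R n; rewrite natrD => n0.
  have : 0 <= (a + b) * n%:R by rewrite mulr_ge0// addr_ge0.
  by lra.
exact: bounded_byD.
Qed.

Lemma smallN a n (E : 'M[C]_n) : small a E -> small a (- E).
Proof.
move=> [A [N [-> h1 h2]]]; exists (- A), (- N); split; first by rewrite opprD.
  by rewrite mxrank_opp.
move=> v; rewrite mulmxN; apply: le_trans (h2 v).
by apply: ler_sum => j _; rewrite mxE cmodN.
Qed.

Lemma small_scalar (c : C) eps n : cmod c <= eps -> small eps (c%:M : 'M[C]_n).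
Proof.
move=> h; exists 0, c%:M; split; first by rewrite add0r.
  by rewrite mxrank0 mulr_ge0// (le_trans (cmod_ge0 c)).
by apply: bounded_byS (bounded_by_scalar c) => //; exact: cmod_ge0.
Qed.

Lemma small_diag eps n (d : 'rV[C]_n) : 0 <= eps ->
  #|[pred i | (eps < cmod (d 0 i))%R]|%:R <= eps * n%:R -> small eps (diag_mx d).
Proof.
move=> e0 h.
exists (diag_mx (\row_i (if eps < cmod (d 0 i) then d 0 i else 0))).
exists (diag_mx (\row_i (if eps < cmod (d 0 i) then 0 else d 0 i))); split.
- rewrite -linearD/=; congr diag_mx; apply/rowP => i; rewrite !mxE.
  by case: ifP => _; rewrite ?addr0 ?add0r.
- apply: le_trans h; rewrite ler_nat; apply: (leq_trans (rank_diag_mx_le _)).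
  apply/subset_leq_card/fintype.subsetP => i; rewrite !inE mxE.
  by case: ifP => //; rewrite eqxx.
- apply: bounded_by_diag => i; rewrite mxE; case: ltP => // _.
  by rewrite -[0]/(0%:C) cmodC normr0.
Qed.

Lemma qform_diag n (u : 'rV[C]_n) (r : 'I_n -> R) :
  qform (diag_mx (\row_i (r i)%:C)) u = \sum_i r i * cmod (u 0 i) ^+ 2.
Proof.
rewrite /qform mul_mx_diag mxE Re_sum; apply: eq_bigr => i _.
rewrite !mxE -mulrA mulrC -mulrA ReM ReC ImC mul0r subr0; congr (_ * _).
by rewrite sqr_cmod ReM Re_conj Im_conj; ring.
Qed.

(* Markov's inequality for the singular values of [E]. *)
Lemma small_fro eps n (E : 'M[C]_n) : 0 < eps ->
  fro E <= eps ^+ 3 * n%:R -> small eps E.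
Proof.
move=> e0 hE.
have [[W dg]/= uW EE] : exists2 sp : 'M[C]_n * 'rV_n, sp.1 \is unitarymx &
    E *m E^t* = invmx sp.1 *m diag_mx sp.2 *m sp.1.
  by apply/orthomx_spectral_subproof/normalmxP; rewrite trmxC_mul trmxCK.
have WW : W *m W^t* = 1%:M by apply/unitarymxP.
have WW' : W^t* *m W = 1%:M by apply: mulmx1C.
pose Y := W *m E; pose r i := sqn (row i Y).
have YY : Y *m Y^t* = diag_mx (\row_i (r i)%:C).
  have e1 : Y *m Y^t* = diag_mx dg.
    rewrite /Y trmxC_mul !mulmxA -(mulmxA W) EE invmx_unitary//.
    by rewrite !mulmxA WW mul1mx -mulmxA WW mulmx1.
  rewrite e1; congr diag_mx; apply/rowP => i; rewrite mxE.
  have : (Y *m Y^t*) i i = dg 0 i by rewrite e1 mxE eqxx mulr1n.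
  move=> <-; have := mulmx_trmxC (row i Y); move/matrixP/(_ 0 0).
  rewrite [RHS]mxE eqxx mulr1n => <-; rewrite !mxE.
  by apply: eq_bigr => j _; rewrite !mxE.
have sr : \sum_i r i <= eps ^+ 3 * n%:R by rewrite -/(fro Y) fro_mull_unitary.
(* The rows of [Y] are orthogonal and the [r i] are the squared singular values of [E]. Their sum is
   at most [eps ^+ 3 * n%:R], so at most [eps * n%:R] of them exceed [eps ^+ 2]: hence the exponent
   3. *)
pose b := \row_(i < n) ((r i <= eps ^+ 2)%R%:R : C).
pose b' := \row_(i < n) ((eps ^+ 2 < r i)%R%:R : C).
have bb : diag_mx b' + diag_mx b = 1%:M.
  rewrite -linearD/= -diag_const_mx; congr diag_mx; apply/rowP => i; rewrite !mxE.
  by case: ltP; rewrite ?addr0 ?add0r.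
exists (W^t* *m diag_mx b' *m Y), (W^t* *m diag_mx b *m Y); split.
- rewrite -mulmxDl -mulmxDr bb mulmx1 /Y mulmxA WW' mul1mx//.
- apply: (@le_trans _ _ #|[pred i | (eps ^+ 2 < r i)%R]|%:R).
    rewrite ler_nat; apply: (leq_trans (mxrankM_maxl _ _)).
    apply: (leq_trans (mxrankM_maxr _ _)); apply: (leq_trans (rank_diag_mx_le _)).
    apply/subset_leq_card/fintype.subsetP => i; rewrite !inE mxE.
    by case: (eps ^+ 2 < r i) => //; rewrite eqxx.
  have e2 : 0 < eps ^+ 2 by rewrite exprn_gt0.
  rewrite -(ler_pM2l e2) mulrA -exprSr; apply: le_trans sr.
  rewrite [leRHS](bigID (fun i => i \in [pred i | (eps ^+ 2 < r i)%R]))/=.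
  rewrite -[leLHS]addr0; apply: lerD; last by apply: sumr_ge0 => i _; exact: sqn_ge0.
  rewrite mulr_natr -sumr_const; apply: ler_sum => i; rewrite inE; exact: ltW.
- move=> v; rewrite 2!(mulmxA v) -qform_mulC YY; set u := v *m W^t*.
  have -> : sqn v = sqn u by rewrite /u sqn_unitary// trmxCK.
  rewrite qform_diag mulr_sumr; apply: ler_sum => i _.
  rewrite mul_mx_diag !mxE cmodM exprMn; case: (leP (r i) (eps ^+ 2)) => h.
    rewrite {2}/cmod normr1 expr1n mulr1.
    by rewrite ler_wpM2r ?sqr_ge0.
  by rewrite {2}/cmod normr0 expr0n !mulr0 mulr_ge0// sqr_ge0.
Qed.

Lemma mem_eigvals n (A : 'M[C]_n) z : z \in eigvals A = root (char_poly A) z.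
Proof. by rewrite eigvalsE root_prod_XsubC. Qed.

Lemma specnorm_le n (N : 'M[C]_n) w : 0 < w -> bounded_by N w -> specnorm N <= w.
Proof.
move=> w0 /(bounded_by_adj w0) hN; rewrite /specnorm big_seq.
apply: (big_ind (fun x => x <= w)); first exact: ltW.
  by move=> x y xw yw; rewrite ge_max xw.
move=> s /mapP[z]; rewrite mem_eigvals -eigenvalue_root_char => /eigenvalueP[v vz v0].
move=> ->.
rewrite -(ger0_norm (ltW w0)) -sqrtr_sqr ler_sqrt ?sqr_ge0//.
have := hN v; rewrite -qform_mulC trmxCK /qform -mulmxA mulmxA vz.
rewrite -scalemxAl mulmx_trmxC mxE mxE eqxx mulr1n ReM ReC ImC mulr0 subr0.
by rewrite ler_pM2r// sqn_gt0.
Qed.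

Lemma pencil_small n (P X : 'M[C]_n) (p2 : nat) (K2 : 'M[C]_(n, p2)) (A N : 'M[C]_n)
    delta w eta :
  P^t* = P -> X^t* = X -> P \in unitmx -> 0 < delta -> 0 < eta -> 0 <= w ->
  w < eta * delta -> X - P = A + N -> bounded_by N w ->
  (forall v, v *m K2 = 0 -> delta * sqn v <= qform P v) ->
  (forall v, v *m K2 = 0 -> qform (invmx P) v <= delta^-1 * sqn v) ->
  (count (fun z : C => ~~ ((im z == 0%R) && (`|re z - 1| <= eta)%R))
    (eigvals (invmx P *m X)) <= 5 * \rank K2 + \rank A)%N.
Proof.
move=> hP hX uP d0 e0 w0 hw ZE hN h1 h2.
(* The three blocks ensure that [P] is at least [delta] at [v], that [X - P] acts on [v] as [N], and
   that [v *m (X - P)] stays where [invmx P] is at most [delta^-1]. Then Z P^-1 Z is at most w^2 /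
   delta, which is below eta^2 delta. As [K2] occurs twice, the factor 3 becomes 5. *)
pose K := row_mx K2 (row_mx A ((X - P) *m K2)).
apply: (@leq_trans (3 * \rank K2 + \rank K)%N).
  apply: pencil_cluster => // v.
    by move=> /h1 h v0; apply: lt_le_trans h; rewrite mulr_gt0// sqn_gt0.
  rewrite /K !mul_mx_row => /eqP; rewrite !row_mx_eq0 => /and3P[/eqP k1 /eqP k2 /eqP k3].
  move=> v0; have hZ : (X - P)^t* = X - P by rewrite trmxC_add trmxC_opp hX hP.
  have := qform_congr (X - P) (invmx P) v; rewrite hZ => ->.
  have vZ : v *m (X - P) = v *m N by rewrite ZE mulmxDr k2 add0r.
  have := h2 (v *m (X - P)); rewrite -mulmxA => /(_ k3) h3.
  apply: (le_lt_trans h3); rewrite vZ.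
  apply: (@lt_le_trans _ _ (eta ^+ 2 * (delta * sqn v))); last first.
    by rewrite ler_pM2l ?exprn_gt0// h1.
  rewrite mulrC ltr_pdivrMr//.
  apply: (le_lt_trans (hN v)).
  have -> : eta ^+ 2 * (delta * sqn v) * delta = (eta * delta) ^+ 2 * sqn v by ring.
  rewrite ltr_pM2r ?sqn_gt0//.
  by rewrite ltr_sqr ?nnegrE ?mulr_ge0// ltW.
have : (\rank K <= \rank K2 + (\rank A + \rank K2))%N.
  apply: (leq_trans (mxrank_row_mx _ _)); rewrite leq_add2l.
  apply: (leq_trans (mxrank_row_mx _ _)); rewrite leq_add2l.
  exact: mxrankM_maxr.
by lia.
Qed.

Lemma singvals_cluster n (E A N : 'M[C]_n) w eta :
  E = A + N -> bounded_by N w -> 0 < w -> w <= 1 -> 10 * w < eta -> eta < 1 ->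
  (count (fun s : R => (eta < `|s - 1|)%R) (singvals (1%:M + E)) <= 3 * \rank A)%N.
Proof.
move=> EE hN w0 w1 we e1.
have hN' := bounded_by_adj w0 hN.
set Q := 1%:M + E; pose X := Q^t* *m Q.
have e0 : 0 < eta by lra.
have hX : X^t* = X by rewrite /X trmxC_mul trmxCK.
(* No columns: here the form is the identity, positive everywhere. *)
pose K2 : 'M[C]_(n, 0) := 0.
(* On the kernel of [K] every term of Q^* Q - 1 containing [A] or its adjoint drops out. *)
pose K := row_mx A (row_mx (A^t*) (N^t* *m A)).
have XE (v : 'rV_n) : v *m K = 0 -> v *m (X - 1%:M) = v *m (N + N^t* + N^t* *m N).
  rewrite /K !mul_mx_row => /eqP; rewrite !row_mx_eq0.
  move=> /and3P[/eqP k1 /eqP k2 /eqP k3].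
  have -> : X - 1%:M = (N + N^t* + N^t* *m N) +
      (A + A^t* *m (1%:M + A + N) + N^t* *m A).
    rewrite /X /Q EE !trmxC_add trmxC1 !(mulmxDl, mulmxDr) !mul1mx !mulmx1.
    by apply/matrixP => i j; rewrite !mxE; ring.
  have hz : v *m (A + A^t* *m (1%:M + A + N) + N^t* *m A) = 0.
    by rewrite !(mulmxDr v) k3 addr0 k1 add0r mulmxA k2 mul0mx.
  by rewrite (mulmxDr v) hz addr0.
have hNN : bounded_by (N + N^t* + N^t* *m N) (10 * w).
  (* Two uses of [bounded_byD] give 8 w + 2 w^2, at most 10 w since w is at most 1. *)
  apply: (@bounded_byS _ _ _ (2 * (2 * (w + w) + w * w))).
  - by have := mulr_gt0 w0 w0; lra.
  - by have := ler_wpM2l (ltW w0) w1; lra.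
  - apply: bounded_byD; [lra|by rewrite mulr_ge0// ltW| |exact: bounded_byM].
    by apply: bounded_byD => //; exact: ltW.
have key : (count (fun z : C => ~~ ((im z == 0%R) && (`|re z - 1| <= eta)%R))
    (eigvals (invmx 1%:M *m X)) <= 3 * \rank K2 + \rank K)%N.
  apply: pencil_cluster => //; rewrite ?trmxC1 ?unitmx1//.
    by move=> v _ v0; rewrite qform1 sqn_gt0.
  move=> v vK v0; rewrite invmx1 mulmx1.
  have hZ : (X - 1%:M)^t* = X - 1%:M by rewrite trmxC_add trmxC_opp hX trmxC1.
  rewrite -{2}hZ qform_mulC XE// qform1; apply: (le_lt_trans (hNN v)).
  by rewrite ltr_pM2r ?sqn_gt0// ltr_sqr ?nnegrE; lra.
rewrite invmx1 mul1mx mxrank0 muln0 add0n in key.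
apply: (@leq_trans (\rank K)); last first.
  apply: (leq_trans (mxrank_row_mx _ _)).
  rewrite !mulSn mul0n addn0 leq_add2l; apply: (leq_trans (mxrank_row_mx _ _)).
  by rewrite mxrank_trmxC leq_add2l mxrankM_maxr.
apply: leq_trans key; rewrite /singvals count_map -/X; apply: sub_count => z /=.
apply: contraTN => /andP[_ h]; rewrite -leNgt.
(* Since [eta < 1], such a [z] has nonnegative real part, so [Num.sqrt] is a true square root [s];
   then |s - 1| is at most |s^2 - 1| because [s + 1] is at least 1. *)
have z0 : 0 <= re z by move: h; rewrite ler_norml => /andP[h _]; lra.
set s := Num.sqrt _; have s0 : 0 <= s := sqrtr_ge0 _.
have sz : s ^+ 2 = re z by rewrite sqr_sqrtr.
apply: le_trans h; rewrite -sz.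
have -> : s ^+ 2 - 1 = (s - 1) * (s + 1) by ring.
rewrite normrM ler_peMr// ger0_norm; lra.
Qed.

End Small.

(** * Diagonalization of the tau algebra *)

Section SineTransform.
Context {R : realType}.
Local Notation C := (CC R).

Lemma sin_cos_natpi (k : nat) : sin (k%:R * pi) = 0 :> R /\ cos (k%:R * pi) = (-1) ^+ k :> R.
Proof.
elim: k => [|k [hs hc]]; first by rewrite mul0r sin0 cos0.
by rewrite -natr1 mulrDl mul1r sinDpi cosDpi hs hc oppr0 exprS mulN1r.
Qed.

(** The Dirichlet kernel: 2 sin(x/2) cos(ix) is the difference of sin((i + 1/2) x) and sin((i - 1/2)
    x). *)
Lemma sum_cos_telescope (x : R) m :
  2 * sin (x / 2) * \sum_(i < m) cos (i%:R * x) =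
  sin (m%:R * x - x / 2) + sin (x / 2).
Proof.
elim: m => [|m IH]; first by rewrite big_ord0 mulr0 mul0r sub0r sinN addNr.
rewrite big_ord_recr/= mulrDr IH.
have -> : m.+1%:R * x - x / 2 = m%:R * x + x / 2 by rewrite -natr1; field.
by rewrite !sinD !sinN !cosN; ring.
Qed.

Lemma sum_cos_grid n k : (0 < k < 2 * n.+1)%N ->
  \sum_(i < n.+1) cos (i%:R * (k%:R * pi / n.+1%:R)) = (odd k)%:R :> R.
Proof.
move=> /andP[k0 kn]; set x : R := k%:R * pi / n.+1%:R.
have n0 : (n.+1%:R : R) != 0 by rewrite pnatr_eq0.
have s0 : 0 < sin (x / 2).
  apply: sin_gt0_pi; apply/andP; split.
    by rewrite /x !mulr_gt0 ?pi_gt0 ?ltr0n// invr_gt0.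
  rewrite /x -mulrA -invfM ltr_pdivrMr ?mulr_gt0 ?ltr0n// mulrC.
  by rewrite ltr_pM2l ?pi_gt0// -natrM ltr_nat mulnC.
apply: (@mulfI _ (2 * sin (x / 2))); first by rewrite mulf_neq0 ?gt_eqF.
rewrite sum_cos_telescope.
have -> : n.+1%:R * x = k%:R * pi by rewrite /x; field.
have [hs hc] := sin_cos_natpi k; rewrite sinB hs hc -signr_odd.
by case: (odd k) => /=; rewrite ?expr1 ?expr0; ring.
Qed.

Definition grid n (i : nat) : R := i.+1%:R * pi / n.+1%:R.

Lemma sum_cos_grid_shift n k : (0 < k < 2 * n.+1)%N ->
  \sum_(i < n) cos (k%:R * grid n i) = (odd k)%:R - 1 :> R.
Proof.
move=> hk; rewrite -(sum_cos_grid hk) big_ord_recl/= mul0r cos0 addrC addKr.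
by apply: eq_bigr => i _; rewrite /grid /bump/= add1n; congr cos; ring.
Qed.

Definition sinemx n : 'M[C]_n :=
  \matrix_(i, j) (Num.sqrt (2 / n.+1%:R) * sin (i.+1%:R * grid n j))%:C.

Lemma sinemx_sym n : (sinemx n)^T = sinemx n.
Proof.
apply/matrixP => i j; rewrite !mxE /grid; congr (_%:C); congr (_ * sin _).
by ring.
Qed.

Lemma sinemx_adj n : (sinemx n)^t* = sinemx n.
Proof.
rewrite sinemx_sym; apply/matrixP => i j; rewrite !mxE.
by apply: complex_eqP; rewrite ?Re_conj ?Im_conj ?ImC ?oppr0.
Qed.

(** A product of sines is half a difference of cosines with frequencies a - b and a + b + 2. These
    have the same parity, so their grid sums cancel unless a = b, when the difference is n - (-1) =
    n + 1. *)
Lemma sinemxK n : sinemx n *m sinemx n = 1%:M.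
Proof.
apply/matrixP => i j; rewrite -{2}sinemx_sym !mxE.
transitivity ((\sum_(l < n) 2 / n.+1%:R * (sin (i.+1%:R * grid n l) *
    sin (j.+1%:R * grid n l)))%:C : C).
  rewrite RC_sum; apply: eq_bigr => l _; rewrite !mxE -rmorphM/=; congr (_%:C).
  have sq : Num.sqrt (2 / n.+1%:R : R) ^+ 2 = 2 / n.+1%:R.
    by rewrite sqr_sqrtr// divr_ge0.
  by rewrite -[in RHS]sq; ring.
rewrite -mulr_sumr.
have sum2 (a b : nat) : (b <= a < n)%N ->
    2 * \sum_(l < n) (sin (a.+1%:R * grid n l) * sin (b.+1%:R * grid n l)) =
    (a == b)%:R * n.+1%:R :> R.
  move=> /andP[ba an].
  transitivity (\sum_(l < n) cos ((a - b)%:R * grid n l) -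
      \sum_(l < n) cos ((a + b).+2%:R * grid n l) : R).
    rewrite -sumrB mulr_sumr; apply: eq_bigr => l _.
    have -> : (a - b)%:R * grid n l = a.+1%:R * grid n l - b.+1%:R * grid n l.
      by rewrite natrB// -(natr1 a) -(natr1 b); ring.
    have -> : (a + b).+2%:R * grid n l = a.+1%:R * grid n l + b.+1%:R * grid n l.
      by rewrite -mulrDl -natrD addSn addnS.
    by rewrite !cosD !sinN !cosN; ring.
  rewrite (sum_cos_grid_shift (k := (a + b).+2)); last by lia.
  have [->|ab] := eqVneq a b.
    rewrite subnn (eq_bigr (fun=> 1)); last by move=> l _; rewrite mul0r cos0.
    by rewrite sumr_const card_ord mul1r /= negbK oddD addbb -natr1 mulr0n; ring.
  rewrite (sum_cos_grid_shift (k := (a - b)%N)); last by lia.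
  rewrite mul0r (_ : odd (a - b) = odd (a + b).+2) ?subrr//.
  by rewrite /= negbK oddB// oddD.
have n0 : (n.+1%:R : R) != 0 by rewrite pnatr_eq0.
have nE (a : R) : 2 / n.+1%:R * a = (2 * a) / n.+1%:R by field.
rewrite nE; case: (leqP j i) => ij.
  rewrite sum2; last by rewrite ij ltn_ord.
  by rewrite mulfK// rmorph_nat.
rewrite [\sum_(l < n) _](eq_bigr (fun l : 'I_n => sin (j.+1%:R * grid n l) * sin (i.+1%:R * grid n l))); last first.
  by move=> l _; rewrite mulrC.
rewrite sum2; last by rewrite (ltnW ij) ltn_ord.
by rewrite mulfK// rmorph_nat eq_sym.
Qed.

(** The 0/1 patterns of S_k and of its Hankel correction, as natural numbers so that they can be
    counted. The two summands of [hankN] are the upper left and the lower right corner. *)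
Definition toepN (k i j : nat) : nat := (i == j + k)%N || (j == i + k)%N.
Definition hankN (n k i j : nat) : nat := ((i + j + 2 == k) + (i + j + k == 2 * n))%N.

Lemma tau_toepS (K : pzRingType) n k (i j : 'I_n) : (k < n)%N ->
  tau (toepS n k : 'M[K]_n) i j = (toepN k i j)%:R - (hankN n k i j)%:R.
Proof.
case: n i j => [[]//|n] i j kn; rewrite /tau !mxE; congr (_ - _).
have hi := ltn_ord i; have hj := ltn_ord j; rewrite /hankN.
case: ifP => h1.
  rewrite inordK//= add0n.
  have -> : (0 == i + j + 2 + k)%N = false by lia.
  have -> : (i + j + k == 2 * n.+1)%N = false by lia.
  by rewrite orbF addn0.
have -> : (i + j + 2 == k)%N = false by lia.
rewrite add0n; case: ifP => h2; last first.
  by have -> : (i + j + k == 2 * n.+1)%N = false by lia.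
rewrite inordK/=; last by lia.
rewrite add0n (_ : (0 == _)%N = false) ?orbF; last by lia.
by congr (nat_of_bool _)%:R; lia.
Qed.

Definition cosfac (k : nat) (x : R) : R := if k == 0%N then 1 else 2 * cos (k%:R * x).

Lemma sum_ord_delta n m (f : nat -> R) :
  \sum_(l < n) ((l : nat) == m)%:R * f l = if (m < n)%N then f m else 0.
Proof.
case: ifP => mn.
  rewrite (bigD1 (Ordinal mn))//= eqxx mul1r big1 ?addr0// => l.
  by rewrite -val_eqE/= => /negPf ->; rewrite mul0r.
apply: big1 => l _; rewrite (_ : (_ == _) = false) ?mul0r//.
by have := ltn_ord l; lia.
Qed.

Lemma sin_grid_reflect n j (a b : nat) : (a + b = 2 * n.+1)%N ->
  sin (a%:R * grid n j) = - sin (b%:R * grid n j).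
Proof.
move=> ab; have -> : a%:R * grid n j = (2 * j.+1)%:R * pi - b%:R * grid n j.
  have -> : (a%:R : R) = 2 * n.+1%:R - b%:R.
    by rewrite -natrM -ab natrD; ring.
  by rewrite /grid natrM; field; rewrite nat1r pnatr_eq0.
have [hs hc] := sin_cos_natpi (2 * j.+1).
by rewrite sinD sinN hs hc mul0r add0r exprM sqrrN !expr1n mul1r.
Qed.

(** By the product formula the right side is the sum of the sines with indices i + 1 + k and i + 1 -
    k. An index outside 1, ..., n is reflected at 0 or at n + 1, where the sine sequence is odd, and
    these two reflections are the two corners of the Hankel correction. *)
Lemma sum_tau_sin n k (i j : 'I_n) : (k < n)%N ->
  \sum_(l < n) ((toepN k i l)%:R - (hankN n k i l)%:R) * sin (l.+1%:R * grid n j) =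
  cosfac k (grid n j) * sin (i.+1%:R * grid n j).
Proof.
move=> kn; have hi := ltn_ord i; set f := fun l : nat => sin (l.+1%:R * grid n j).
have [->|k0] := eqVneq k 0%N.
  rewrite /cosfac eqxx mul1r -[RHS]/(f i).
  have <- : (if (i < n)%N then f i else 0) = f i by rewrite hi.
  rewrite -sum_ord_delta; apply: eq_bigr => l _; have hl := ltn_ord l.
  rewrite /toepN /hankN !addn0 orbC eq_sym orbb.
  rewrite (_ : (i + l + 2 == 0)%N = false); last by lia.
  rewrite (_ : (i + l == 2 * n)%N = false); last by lia.
  by rewrite subr0 eq_sym.
(* One sum for each of the four diagonals; the guards exclude the values where truncated subtraction
   would create a spurious match. *)
transitivity (\sum_(l < n) ((l : nat) == i + k)%N%:R * f l
  + \sum_(l < n) ((k <= i) && ((l : nat) == i - k))%N%:R * f l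
  - \sum_(l < n) ((i + 2 <= k) && ((l : nat) == k - i - 2))%N%:R * f l
  - \sum_(l < n) ((l : nat) == 2 * n - i - k)%N%:R * f l).
  rewrite -big_split/= -!sumrB; apply: eq_bigr => l _; have hl := ltn_ord l.
  rewrite -mulrDl -!mulrBl -/(f l); congr (_ * _).
  rewrite /toepN /hankN natrD opprD addrA; congr (_ - _ - _).
  - have -> : (i == l + k :> nat)%N = (k <= i)%N && ((l : nat) == i - k)%N by lia.
    have : ~~ (((l : nat) == i + k)%N && ((k <= i)%N && ((l : nat) == i - k)%N)) by lia.
    by case: ((l : nat) == i + k)%N;
      case: ((k <= i)%N && ((l : nat) == i - k)%N); rewrite /= ?add0r ?addr0.
  - have -> // : (i + l + 2 == k)%N = (i + 2 <= k)%N && ((l : nat) == k - i - 2)%N.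
    by lia.
  - have -> // : (i + l + k == 2 * n)%N = ((l : nat) == 2 * n - i - k)%N by lia.
have cond (b : bool) m : \sum_(l < n) (b && ((l : nat) == m))%:R * f l =
    (b && (m < n)%N)%:R * f m.
  case: b => /=; first by rewrite sum_ord_delta; case: ifP; rewrite ?mul1r ?mul0r.
  by rewrite mul0r big1// => l _; rewrite mul0r.
rewrite !cond !sum_ord_delta /cosfac (negPf k0) /f.
set x := grid n j.
have -> : 2 * cos (k%:R * x) * sin (i.+1%:R * x) =
    sin ((i + k).+1%:R * x) + sin (i.+1%:R * x - k%:R * x).
  rewrite -addSn natrD [(_ + k%:R) * x]mulrDl; move: (i.+1%:R * x) (k%:R * x) => u v.
  rewrite !sinD !sinN !cosN; ring.
have r4 (a b c d : R) : a + b - c - d = (a - d) + (b - c) by ring.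
rewrite r4; congr (_ + _).
- case: (ltngtP (i + k) n)%N => h.
  + rewrite (_ : (_ < n)%N = false) ?subr0//; lia.
  + rewrite (_ : (2 * n - i - k < n)%N = true) ?sub0r; last by lia.
    by rewrite (@sin_grid_reflect _ _ (i + k).+1 (2 * n - i - k).+1)//; lia.
  + rewrite (_ : (_ < n)%N = false) ?subr0; last by lia.
    have -> : (i + k).+1%:R * x = j.+1%:R * pi.
      by rewrite h /x /grid; field; rewrite nat1r pnatr_eq0.
    by have [->] := sin_cos_natpi j.+1.
- have [ki|ki] := leqP k i.
    have -> : (i + 2 <= k)%N = false by lia.
    have -> : (i - k < n)%N = true by lia.
    rewrite mul1r mul0r subr0; congr sin.
    by rewrite -subSn ?natrB ?mulrBl//; lia.
  have [ik|ik] := leqP (i + 2) k.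
    have -> : (k - i - 2 < n)%N = true by lia.
    rewrite mul0r mul1r sub0r.
    rewrite -sinN; congr sin.
    have -> : ((k - i - 2).+1 = k - i.+1)%N by lia.
    by rewrite natrB ?mulrBl ?opprB//; lia.
  (* The reflected index falls on 0, where the sine vanishes and no matrix entry corresponds to
     it. *)
  have -> : (k = i.+1)%N by lia.
  by rewrite !mul0r subrr subrr sin0.
Qed.

Lemma tau_toepS_sinemx n k : (k < n)%N ->
  tau (toepS n k : 'M[C]_n) =
  sinemx n *m diag_mx (\row_j (cosfac k (grid n j))%:C) *m sinemx n.
Proof.
move=> kn; rewrite -[LHS]mulmx1 -sinemxK mulmxA; congr (_ *m _).
apply/matrixP => i j; rewrite mul_mx_diag !mxE -rmorphM/=.
rewrite -mulrA [sin _ * _]mulrC -sum_tau_sin// mulr_sumr RC_sum.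
apply: eq_bigr => l _; rewrite tau_toepS// mxE.
rewrite [in RHS]mulrCA [RHS]rmorphM; congr (_ * _).
by rewrite rmorphB/= !rmorph_nat.
Qed.

Lemma tens_diag_mx (K : comPzRingType) m n (d : 'rV[K]_m) (e : 'rV[K]_n) :
  diag_mx d *t diag_mx e =
  diag_mx (\row_i (d 0 (mxtens_unindex i).1 * e 0 (mxtens_unindex i).2)).
Proof.
apply/matrixP => i j; rewrite !mxE.
case: (mxtens_indexP i) => i1 i2; case: (mxtens_indexP j) => j1 j2.
rewrite !mxtens_indexK/= (can_eq (@mxtens_indexK m n)) xpair_eqE.
by case: (i1 == j1); case: (i2 == j2); rewrite ?mulr1n ?mulr0n ?mul0r ?mulr0.
Qed.

Definition sinemx2 n : 'M[C]_(n * n) := sinemx n *t sinemx n.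

Lemma sinemx2K n : sinemx2 n *m sinemx2 n = 1%:M.
Proof.
rewrite /sinemx2 tensmx_mul sinemxK.
rewrite -diag_const_mx tens_diag_mx -diag_const_mx; congr diag_mx.
by apply/rowP => i; rewrite !mxE mulr1.
Qed.

Lemma sinemx2_adj n : (sinemx2 n)^t* = sinemx2 n.
Proof. by rewrite /sinemx2 trmx_tens map_mxT !sinemx_adj. Qed.

Definition tauc (c : nat -> nat -> R) n : 'M[C]_(n * n) :=
  \sum_(k1 < n) \sum_(k2 < n)
    (c k1 k2)%:C *: (tau (toepS n k1) *t tau (toepS n k2)).

(** A partial Fourier sum of an even symbol: [cosfac] takes the frequencies k and -k together. *)
Definition symval (c : nat -> nat -> R) n (x y : R) : R :=
  \sum_(k1 < n) \sum_(k2 < n) c k1 k2 * (cosfac k1 x * cosfac k2 y).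

Definition taueig c n (i : 'I_(n * n)) : R :=
  symval c n (grid n (mxtens_unindex i).1) (grid n (mxtens_unindex i).2).

Lemma taucE c n :
  tauc c n = sinemx2 n *m diag_mx (\row_i (taueig c i)%:C) *m sinemx2 n.
Proof.
pose D (k1 k2 : nat) : 'rV[C]_(n * n) := \row_i
  (cosfac k1 (grid n (mxtens_unindex i).1) * cosfac k2 (grid n (mxtens_unindex i).2))%:C.
have -> : \row_i (taueig c i)%:C =
    \sum_(k1 < n) \sum_(k2 < n) (c k1 k2)%:C *: D k1 k2.
  apply/rowP => i; rewrite mxE summxE /taueig /symval RC_sum; apply: eq_bigr => k1 _.
  rewrite summxE RC_sum; apply: eq_bigr => k2 _.
  by rewrite !mxE rmorphM.
rewrite /tauc linear_sum/= mulmx_sumr mulmx_suml; apply: eq_bigr => k1 _.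
rewrite linear_sum/= mulmx_sumr mulmx_suml; apply: eq_bigr => k2 _.
rewrite linearZ/= -scalemxAr -scalemxAl; congr (_ *: _).
rewrite !tau_toepS_sinemx// /sinemx2 -!tensmx_mul tens_diag_mx; congr (_ *m diag_mx _ *m _).
by apply/rowP => i; rewrite !mxE rmorphM.
Qed.

End SineTransform.

(** * Frobenius norms of Toeplitz and tau matrices *)

Section FrobeniusBounds.
Context {R : realType}.
Local Notation C := (CC R).

Lemma weighted_cauchy_schwarz (K : finType) (x g : K -> R) :
  (forall k, 0 <= g k) ->
  (\sum_k x k * g k) ^+ 2 <= (\sum_k g k) * \sum_k x k ^+ 2 * g k.
Proof.
move=> g0; set S := \sum_k g k; set T := \sum_k x k * g k.
set Q := \sum_k _; have S0 : 0 <= S by apply: sumr_ge0.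
have : 0 <= \sum_k g k * (S * x k - T) ^+ 2.
  by apply: sumr_ge0 => k _; rewrite mulr_ge0// sqr_ge0.
have -> : \sum_k g k * (S * x k - T) ^+ 2 = S * (S * Q - T ^+ 2).
  transitivity (\sum_k (S ^+ 2 * (x k ^+ 2 * g k) - 2 * S * T * (x k * g k)
      + T ^+ 2 * g k)); first by apply: eq_bigr => k _; ring.
  by rewrite big_split/= sumrB -!mulr_sumr -/Q -/T -/S; ring.
have [S00|Sn0] := eqVneq S 0.
  move=> _; suff -> : T = 0 by rewrite S00 mul0r expr0n.
  apply: big1 => k _; suff -> : g k = 0 by rewrite mulr0.
  move/eqP: S00; rewrite psumr_eq0// => /allP/(_ k (mem_index_enum _)).
  by move/eqP.
by rewrite pmulr_rge0 ?subr_ge0// lt_neqAle eq_sym Sn0.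
Qed.

(** A Schur-type test: [a] bounds the overlap of the patterns at one entry and [b k] the total mass
    of pattern [k]. *)
Lemma fro_sum_scale (K : finType) m n (c : K -> R) (F : K -> 'M[C]_(m, n))
    (G : K -> 'I_m -> 'I_n -> R) (a : R) (b : K -> R) : 0 <= a ->
  (forall k i j, cmod (F k i j) <= G k i j) ->
  (forall i j, \sum_k G k i j <= a) ->
  (forall k, \sum_i \sum_j G k i j <= b k) ->
  fro (\sum_k (c k)%:C *: F k) <= a * \sum_k b k * c k ^+ 2.
Proof.
move=> a0 FG Ga Gb; have G0 k i j : 0 <= G k i j := le_trans (cmod_ge0 _) (FG k i j).
rewrite froE; apply: (@le_trans _ _ (\sum_i \sum_j a * \sum_k c k ^+ 2 * G k i j)).
  apply: ler_sum => i _; apply: ler_sum => j _; rewrite summxE.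
  apply: (@le_trans _ _ ((\sum_k `|c k| * G k i j) ^+ 2)).
    rewrite ler_sqr ?nnegrE ?cmod_ge0//; last first.
      by apply: sumr_ge0 => k _; rewrite mulr_ge0.
    apply: (le_trans (cmod_sum _ _ _)); apply: ler_sum => k _.
    by rewrite mxE cmodM cmodC ler_wpM2l.
  apply: (le_trans (weighted_cauchy_schwarz _ (fun k => G0 k i j))).
  under [X in _ * X <= _]eq_bigr do rewrite real_normK ?num_real//.
  by rewrite ler_wpM2r// sumr_ge0// => k _; rewrite mulr_ge0// sqr_ge0.
under eq_bigr do rewrite -mulr_sumr.
rewrite -mulr_sumr ler_wpM2l//.
under eq_bigr do rewrite exchange_big/=.
rewrite exchange_big/=; apply: ler_sum => k' _.
under eq_bigr do rewrite -mulr_sumr.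
by rewrite -mulr_sumr mulrC ler_wpM2r ?sqr_ge0.
Qed.

Lemma sum_ord_eq_le1 n m : (\sum_(l < n) ((l : nat) == m) <= 1)%N.
Proof.
case: (ltnP m n) => mn.
  rewrite (bigD1 (Ordinal mn))//= eqxx big1// => l.
  by rewrite -val_eqE/= => /negPf ->.
by rewrite big1// => l _; have := ltn_ord l; case: eqP => //; lia.
Qed.

Lemma sum_ord_lt_le n k : (\sum_(i < n) ((i : nat) < k) <= k)%N.
Proof.
suff -> : (\sum_(i < n) ((i : nat) < k) = minn n k)%N by exact: geq_minr.
elim: n => [|n IH]; first by rewrite big_ord0 min0n.
by rewrite big_ord_recr/= IH; lia.
Qed.

Lemma sum_toepN_coef n (i j : nat) : (\sum_(k < n) toepN k i j <= 1)%N.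
Proof.
apply: (leq_trans _ (sum_ord_eq_le1 n ((i - j) + (j - i))%N)).
apply: leq_sum => k _; rewrite /toepN.
by have -> : (i == j + k)%N || (j == i + k)%N = ((k : nat) == (i - j) + (j - i))%N by lia.
Qed.

Lemma sum_hankN_coef n N (i j : nat) : (\sum_(k < n) hankN N k i j <= 2)%N.
Proof.
rewrite /hankN big_split/= -[2%N]/(1 + 1)%N leq_add//.
  apply: (leq_trans _ (sum_ord_eq_le1 n (i + j + 2)%N)); apply: leq_sum => k _.
  by rewrite eq_sym.
case: (leqP (i + j) (2 * N)) => h.
  apply: (leq_trans _ (sum_ord_eq_le1 n (2 * N - (i + j))%N)); apply: leq_sum => k _.
  by have -> : (i + j + k == 2 * N)%N = ((k : nat) == 2 * N - (i + j))%N by lia.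
by rewrite big1// => k _; case: eqP => //; lia.
Qed.

Lemma sum_toepN_entries n k : (\sum_(i < n) \sum_(j < n) toepN k i j <= 2 * n)%N.
Proof.
rewrite mulnC -[X in (_ <= X * 2)%N]card_ord -sum_nat_const; apply: leq_sum => i _.
apply: (@leq_trans (\sum_(j < n) (((j : nat) == i - k) + ((j : nat) == i + k)))%N).
  apply: leq_sum => j _; rewrite /toepN.
  case: ((i : nat) =P j + k)%N => h1 /=.
    by have -> : ((j : nat) == i - k)%N = true by lia.
  by case: ((j : nat) =P i + k)%N => h2 //=; rewrite addn1.
by rewrite big_split/= -[2%N]/(1 + 1)%N leq_add// sum_ord_eq_le1.
Qed.

(** The two antidiagonals meet only the first [k] and the last [k] rows. Growth in [k] rather than
    in [n] is what makes the Hankel correction negligible. *)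
Lemma sum_hankN_entries n k : (\sum_(i < n) \sum_(j < n) hankN n k i j <= 2 * k)%N.
Proof.
apply: (@leq_trans (\sum_(i < n) (((i : nat) < k) + ((n.-1 - i)%N < k)))%N).
  apply: leq_sum => i _; rewrite /hankN big_split/=; apply: leq_add.
    case: (ltnP i k) => ik.
      apply: (leq_trans _ (sum_ord_eq_le1 n (k - i - 2)%N)); apply: leq_sum => j _.
      case: (i + j + 2 =P k)%N => // h.
      by have -> : ((j : nat) == k - i - 2)%N = true by lia.
    by rewrite big1// => j _; case: eqP => //; lia.
  have hi := ltn_ord i; case: (ltnP (n.-1 - i) k) => ik.
    apply: (leq_trans _ (sum_ord_eq_le1 n (2 * n - i - k)%N)); apply: leq_sum => j _.
    case: (i + j + k =P 2 * n)%N => // h.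
    by have -> : ((j : nat) == 2 * n - i - k)%N = true by lia.
  by rewrite big1// => j _; have := ltn_ord j; case: eqP => //; lia.
rewrite big_split/= mul2n -addnn leq_add ?sum_ord_lt_le//.
rewrite (reindex_inj rev_ord_inj)/=; apply: (leq_trans _ (sum_ord_lt_le n k)).
apply: leq_sum => i _; have hi := ltn_ord i.
by have -> : (n.-1 - (n - i.+1) = i)%N by lia.
Qed.

Definition toepc (c : nat -> nat -> R) n : 'M[C]_(n * n) :=
  \sum_(k1 < n) \sum_(k2 < n) (c k1 k2)%:C *: (toepS n k1 *t toepS n k2).

Lemma toepSE n k (i j : 'I_n) : (toepS n k : 'M[C]_n) i j = (toepN k i j)%:R.
Proof. by rewrite mxE. Qed.

Lemma cmod_natr (m : nat) : cmod (m%:R : C) = m%:R.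
Proof.
have -> : (m%:R : C) = (m%:R)%:C by rewrite rmorph_nat.
by rewrite cmodC ger0_norm.
Qed.

Lemma sum_tens_prod n (A B : 'I_n -> 'I_n -> R) :
  \sum_(i < n * n) \sum_(j < n * n)
     A (mxtens_unindex i).1 (mxtens_unindex j).1 *
     B (mxtens_unindex i).2 (mxtens_unindex j).2 =
  (\sum_i \sum_j A i j) * (\sum_i \sum_j B i j).
Proof. by rewrite mulr_sum; apply: eq_bigr => i _; rewrite mulr_sum. Qed.

Lemma sum_coef_prod n (A B : nat -> R) :
  \sum_(k : 'I_n * 'I_n) A k.1 * B k.2 = (\sum_(k < n) A k) * (\sum_(k < n) B k).
Proof.
rewrite -(pair_bigA _ (fun i j : 'I_n => A i * B j))/= mulr_suml.
by apply: eq_bigr => i _; rewrite mulr_sumr.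
Qed.

Lemma ler_natsum (I : finType) (F : I -> nat) b : (\sum_i F i <= b)%N ->
  \sum_i (F i)%:R <= b%:R :> R.
Proof. by move=> h; rewrite -natr_sum ler_nat. Qed.

Lemma ler_natsum2 (I J : finType) (F : I -> J -> nat) b :
  (\sum_i \sum_j F i j <= b)%N -> \sum_i \sum_j (F i j)%:R <= b%:R :> R.
Proof.
by move=> h; under eq_bigr do rewrite -natr_sum; rewrite -natr_sum ler_nat.
Qed.

(* Cauchy-Schwarz at each entry, where at most [a] of the 0/1 patterns [G k]
   are nonzero. *)
Lemma fro_tens_le n (c : nat -> nat -> R) (F : nat -> nat -> 'M[C]_(n * n))
    (G : 'I_n * 'I_n -> 'I_(n * n) -> 'I_(n * n) -> R) (a : R)
    (b : nat -> nat -> R) : 0 <= a ->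
  (forall k : 'I_n * 'I_n, forall i j, cmod (F k.1 k.2 i j) <= G k i j) ->
  (forall i j, \sum_k G k i j <= a) ->
  (forall k : 'I_n * 'I_n, \sum_i \sum_j G k i j <= b k.1 k.2) ->
  fro (\sum_(k1 < n) \sum_(k2 < n) (c k1 k2)%:C *: F k1 k2) <=
  a * \sum_(k1 < n) \sum_(k2 < n) b k1 k2 * c k1 k2 ^+ 2.
Proof.
move=> a0 h1 h2 h3; rewrite !pair_bigA/=.
exact: (@fro_sum_scale ('I_n * 'I_n)%type _ _ (fun k => c k.1 k.2)
  (fun k => F k.1 k.2) G a (fun k => b k.1 k.2) a0 h1 h2 h3).
Qed.

Lemma fro_toepc_le n c :
  fro (toepc c n) <= 4 * n%:R ^+ 2 * \sum_(k1 < n) \sum_(k2 < n) c k1 k2 ^+ 2.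
Proof.
rewrite -[4 * _ * _]mul1r mulr_sumr; under eq_bigr do rewrite mulr_sumr.
pose G (k : 'I_n * 'I_n) (i j : 'I_(n * n)) : R :=
  (toepN k.1 (mxtens_unindex i).1 (mxtens_unindex j).1)%:R *
  (toepN k.2 (mxtens_unindex i).2 (mxtens_unindex j).2)%:R.
apply: (@fro_tens_le n c (fun k1 k2 => toepS n k1 *t toepS n k2) G 1
  (fun k1 k2 => 4 * n%:R ^+ 2)) => //.
- move=> k i j; rewrite mxE !toepSE -natrM cmod_natr /G natrM//.
- move=> i j; rewrite /G.
  rewrite (@sum_coef_prod n (fun k => (toepN k (mxtens_unindex i).1 (mxtens_unindex j).1)%:R)
    (fun k => (toepN k (mxtens_unindex i).2 (mxtens_unindex j).2)%:R)).
  rewrite -[leRHS]mulr1; apply: ler_pM; rewrite ?sumr_ge0//;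
    by apply: (@ler_natsum _ _ 1); exact: sum_toepN_coef.
- move=> k; rewrite /G (@sum_tens_prod n (fun i j => (toepN k.1 i j)%:R)
    (fun i j => (toepN k.2 i j)%:R)).
  have -> : 4 * n%:R ^+ 2 = (2 * n)%:R * (2 * n)%:R :> R by rewrite natrM; ring.
  apply: ler_pM; rewrite ?sumr_ge0//; try by move=> i _; rewrite sumr_ge0.
    by apply: ler_natsum2; exact: sum_toepN_entries.
  by apply: ler_natsum2; exact: sum_toepN_entries.
Qed.

(** 144 = 9 * 16: in each tensor factor at most 1 + 2 patterns overlap at an entry, and a pattern
    has at most 2n + 2k, hence 4n, entries. *)
Lemma fro_tauc_le n (c : nat -> nat -> R) :
  fro (tauc c n) <= 144 * n%:R ^+ 2 * \sum_(k1 < n) \sum_(k2 < n) c k1 k2 ^+ 2.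
Proof.
have -> : 144 * n%:R ^+ 2 = 9 * (16 * n%:R ^+ 2) :> R by ring.
rewrite -mulrA mulr_sumr; under [X in 9 * X]eq_bigr do rewrite mulr_sumr.
pose g k i j := (toepN k i j + hankN n k i j)%N.
pose G (k : 'I_n * 'I_n) (i j : 'I_(n * n)) : R :=
  (g k.1 (mxtens_unindex i).1 (mxtens_unindex j).1)%:R *
  (g k.2 (mxtens_unindex i).2 (mxtens_unindex j).2)%:R.
have tg (k : 'I_n) (i j : 'I_n) : cmod (tau (toepS n k : 'M[C]_n) i j) <= (g k i j)%:R.
  rewrite tau_toepS//; apply: (le_trans (le_cmodD _ _)).
  by rewrite cmodN !cmod_natr -natrD.
have g1 (i j : nat) : \sum_(k < n) (g k i j)%:R <= 3%:R :> R.
  apply: ler_natsum; rewrite big_split/= -[3%N]/(1 + 2)%N leq_add//.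
    exact: sum_toepN_coef.
  exact: sum_hankN_coef.
have g2 (k : 'I_n) : \sum_(i < n) \sum_(j < n) (g k i j)%:R <= (4 * n)%:R :> R.
  apply: ler_natsum2; under eq_bigr do rewrite big_split/=.
  rewrite big_split/=; apply: (@leq_trans (2 * n + 2 * k)%N); last first.
    by have := ltn_ord k; lia.
  by rewrite leq_add// ?sum_toepN_entries ?sum_hankN_entries.
apply: (@fro_tens_le n c (fun k1 k2 => tau (toepS n k1) *t tau (toepS n k2)) G 9
  (fun k1 k2 => 16 * n%:R ^+ 2)) => //.
- move=> k i j; rewrite mxE cmodM /G; apply: ler_pM; rewrite ?cmod_ge0//.
- move=> i j; rewrite /G.
  rewrite (@sum_coef_prod n (fun k => (g k (mxtens_unindex i).1 (mxtens_unindex j).1)%:R)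
    (fun k => (g k (mxtens_unindex i).2 (mxtens_unindex j).2)%:R)).
  have -> : 9 = 3%:R * 3%:R :> R by ring.
  by apply: ler_pM; rewrite ?sumr_ge0.
- move=> k; rewrite /G (@sum_tens_prod n (fun i j => (g k.1 i j)%:R)
    (fun i j => (g k.2 i j)%:R)).
  have -> : 16 * n%:R ^+ 2 = (4 * n)%:R * (4 * n)%:R :> R by rewrite natrM; ring.
  by apply: ler_pM; rewrite ?sumr_ge0//; move=> i _; rewrite sumr_ge0.
Qed.

(** The difference of the tensor products is H x T + T x H - H x H. At an entry the overlap is at
    most 2 + 2 + 4 = 8, and the mass is at most 4n(k1 + k2) + 4 k1 k2, hence 8n(k1 + k2). Compared
    with the bounds above, one factor n has become k1 + k2. *)
Lemma fro_toepc_tauc_le n (c : nat -> nat -> R) :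
  fro (toepc c n - tauc c n) <=
  64 * n%:R * \sum_(k1 < n) \sum_(k2 < n) (k1 + k2)%:R * c k1 k2 ^+ 2.
Proof.
have -> : 64 * n%:R = 8 * (8 * n%:R) :> R by ring.
rewrite -mulrA mulr_sumr; under [X in 8 * X]eq_bigr do rewrite mulr_sumr.
under [X in 8 * X]eq_bigr do under eq_bigr do rewrite mulrA.
pose t k i j : R := (toepN k i j)%:R; pose h k i j : R := (hankN n k i j)%:R.
pose G (k : 'I_n * 'I_n) (i j : 'I_(n * n)) : R :=
  h k.1 (mxtens_unindex i).1 (mxtens_unindex j).1 *
  t k.2 (mxtens_unindex i).2 (mxtens_unindex j).2 +
  t k.1 (mxtens_unindex i).1 (mxtens_unindex j).1 *
  h k.2 (mxtens_unindex i).2 (mxtens_unindex j).2 +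
  h k.1 (mxtens_unindex i).1 (mxtens_unindex j).1 *
  h k.2 (mxtens_unindex i).2 (mxtens_unindex j).2.
have -> : toepc c n - tauc c n = \sum_(k1 < n) \sum_(k2 < n) (c k1 k2)%:C *:
    (toepS n k1 *t toepS n k2 - tau (toepS n k1) *t tau (toepS n k2)).
  rewrite /toepc /tauc -sumrB; apply: eq_bigr => k1 _.
  by rewrite -sumrB; apply: eq_bigr => k2 _; rewrite scalerBr.
have t0 k i j : 0 <= t k i j by [].
have h0 k i j : 0 <= h k i j by [].
have t1 (i j : nat) : \sum_(k < n) t k i j <= 1.
  by apply: (@ler_natsum _ _ 1); exact: sum_toepN_coef.
have h1 (i j : nat) : \sum_(k < n) h k i j <= 2.
  by apply: (@ler_natsum _ _ 2); exact: sum_hankN_coef.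
have t2 k : \sum_(i < n) \sum_(j < n) t k i j <= 2 * n%:R.
  by rewrite -natrM; apply: ler_natsum2; exact: sum_toepN_entries.
have h2 k : \sum_(i < n) \sum_(j < n) h k i j <= 2 * k%:R.
  by rewrite -natrM; apply: ler_natsum2; exact: sum_hankN_entries.
apply: (@fro_tens_le n c (fun k1 k2 => toepS n k1 *t toepS n k2 -
    tau (toepS n k1) *t tau (toepS n k2)) G 8
  (fun k1 k2 => 8 * n%:R * (k1 + k2)%:R)) => //.
- move=> k i j; rewrite 2!mxE [X in _ + X]mxE [X in _ - X]mxE.
  rewrite !toepSE !tau_toepS// /G /t /h -!natrM -!natrD.
  set a := toepN _ _ _; set b := toepN _ _ _; set x := hankN _ _ _ _; set y := hankN _ _ _ _.
  have -> : ((a * b)%:R - (a%:R - x%:R) * (b%:R - y%:R) : C) =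
      (x * b + a * y)%:R - (x * y)%:R by rewrite natrD !natrM; ring.
  by apply: (le_trans (le_cmodD _ _)); rewrite cmodN !cmod_natr -natrD.
- move=> i j; rewrite /G !big_split/=.
  set i1 := (mxtens_unindex i).1; set i2 := (mxtens_unindex i).2.
  set j1 := (mxtens_unindex j).1; set j2 := (mxtens_unindex j).2.
  rewrite (@sum_coef_prod n (fun k => h k i1 j1) (fun k => t k i2 j2)).
  rewrite (@sum_coef_prod n (fun k => t k i1 j1) (fun k => h k i2 j2)).
  rewrite (@sum_coef_prod n (fun k => h k i1 j1) (fun k => h k i2 j2)).
  have s0 (f : nat -> nat -> nat -> R) a b : (forall k i j, 0 <= f k i j) ->
      0 <= \sum_(k < n) f k a b by move=> f0; apply: sumr_ge0.
  have -> : 8 = 2 * 1 + 1 * 2 + 2 * 2 :> R by ring.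
  by apply: lerD; [apply: lerD|]; apply: ler_pM; rewrite ?s0.
- move=> k; rewrite /G.
  under eq_bigr do rewrite !big_split/=.
  rewrite !big_split/=.
  rewrite (@sum_tens_prod n (fun i j => h k.1 i j) (fun i j => t k.2 i j)).
  rewrite (@sum_tens_prod n (fun i j => t k.1 i j) (fun i j => h k.2 i j)).
  rewrite (@sum_tens_prod n (fun i j => h k.1 i j) (fun i j => h k.2 i j)).
  have s0 (f : nat -> nat -> nat -> R) a : (forall k i j, 0 <= f k i j) ->
      0 <= \sum_(i < n) \sum_(j < n) f a i j.
    by move=> f0; apply: sumr_ge0 => i _; apply: sumr_ge0.
  apply: (@le_trans _ _ ((2 * k.1%:R) * (2 * n%:R) + (2 * n%:R) * (2 * k.2%:R) +
      (2 * k.1%:R) * (2 * k.2%:R))).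
    by apply: lerD; [apply: lerD|]; apply: ler_pM; rewrite ?s0.
  have kn : k.2%:R <= n%:R :> R by rewrite ler_nat ltnW.
  have := ler_wpM2l (ler0n R k.1) kn; rewrite natrD.
  have := mulr_ge0 (ler0n R n) (ler0n R k.2).
  have := mulr_ge0 (ler0n R n) (ler0n R k.1).
  by move: (k.1%:R : R) (k.2%:R : R) (n%:R : R) => u v w; nra.
Qed.

End FrobeniusBounds.

(** * Weierstrass approximation *)

Section Weierstrass.
Context {R : realType}.

(* [(bern n f).[x]] is the expectation of [f S] for a sum [S] of [n]
   independent Bernoulli variables of parameter [x]. *)
Fixpoint bern (n : nat) (f : nat -> R) : {poly R} :=
  if n is m.+1 then (1 - 'X) * bern m f + 'X * bern m (f \o S) else (f 0%N)%:P.

Lemma bernS n f x : (bern n.+1 f).[x] =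
  (1 - x) * (bern n f).[x] + x * (bern n (f \o S)).[x].
Proof. by rewrite /= !hornerE. Qed.

Lemma bern_ge0 n f x : 0 <= x <= 1 -> (forall k, (k <= n)%N -> 0 <= f k) ->
  0 <= (bern n f).[x].
Proof.
move=> /andP[x0 x1]; elim: n f => [|n IH] f hf; first by rewrite hornerC hf.
by rewrite bernS addr_ge0// mulr_ge0 ?subr_ge0//; apply: IH => k kn; apply: hf => //; exact: ltnW.
Qed.

Lemma bern_lin n f g a b x :
  (bern n (fun k => a * f k + b * g k)).[x] = a * (bern n f).[x] + b * (bern n g).[x].
Proof.
elim: n f g => [|n IH] f g; first by rewrite /= !hornerE.
by rewrite !bernS IH (IH (f \o S)); ring.
Qed.

Lemma bern_cst n a x : (bern n (fun=> a)).[x] = a.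
Proof.
elim: n => [|n IH]; first by rewrite hornerC.
by rewrite bernS !IH; ring.
Qed.

(** Variance plus squared bias of the binomial law. *)
Lemma bern_sqr n a x :
  (bern n (fun k => (k%:R - a) ^+ 2)).[x] = n%:R * x * (1 - x) + (n%:R * x - a) ^+ 2.
Proof.
elim: n a => [|n IH] a; first by rewrite hornerC; ring.
rewrite bernS IH (_ : _ \o _ = (fun k => (k%:R - (a - 1)) ^+ 2)) ?IH.
  by rewrite -natr1; ring.
by apply/funext => k /=; rewrite -natr1; congr (_ ^+ 2); ring.
Qed.

Lemma uniform_continuity (f : R -> R) (a b : R) : continuous f ->
  forall e, 0 < e -> exists2 d, 0 < d &
    forall x y, a <= x <= b -> `|x - y| < d -> `|f x - f y| < e.
Proof.
move=> cf e e0.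
have /compact_near_coveringP cov := @segment_compact R a b.
have := cov _ (0 : R)^'+ (fun d x => forall y, `|x - y| < d -> `|f x - f y| < e) _.
have h : forall x, `[a, b]%classic x -> \forall x' \near x & d \near (0 : R)^'+,
    forall y, `|x' - y| < d -> `|f x' - f y| < e.
  move=> x _; have e2 : 0 < e / 2 by rewrite divr_gt0.
  have /cvgrPdist_lt/(_ _ e2)/nbhs_ballP[r /= r0 hr] := cf x.
  have r2 : 0 < r / 2 by rewrite divr_gt0.
  exists (ball x (r / 2), [set d | d < r / 2]) => /=.
    split; first exact: nbhsx_ballx.
    exact: nbhs_right_lt.
  move=> [x' d] /= [xx' dr] y x'y.
  have h1 : ball x r x'.
    by move: xx'; rewrite /ball/=; lra.
  have h2 : ball x r y.
    move: xx' x'y; rewrite /ball/= => xx' x'y.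
    have := ler_distD x' x y; lra.
  have := ler_distD (f x) (f x') (f y).
  by have /= := hr _ h1; have /= := hr _ h2; rewrite (distrC (f x') (f x)); lra.
move=> /(_ _ h) hd; have hp : \forall d \near (0 : R)^'+, 0 < d by exact: nbhs_right_gt.
near ((0 : R)^'+) => d.
exists d; first by near: d.
move=> x y xab xy; have : forall x, `[a, b]%classic x ->
  forall y, `|x - y| < d -> `|f x - f y| < e by near: d.
by apply; rewrite //= in_itv.
Unshelve. all: by end_near. Qed.

Lemma weierstrass01 (f : R -> R) : continuous f ->
  forall e, 0 < e -> exists p : {poly R},
    forall x, 0 <= x <= 1 -> `|f x - p.[x]| <= e.
Proof.
move=> cf e e0; have e2 : 0 < e / 2 by rewrite divr_gt0.
have [d d0 hd] := uniform_continuity 0 1 cf e2.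
have [C C0 hC] : exists2 C, 0 < C & forall x, 0 <= x <= 1 -> `|f x| <= C.
  have cf' : {within `[0, 1], continuous f} by apply: continuous_subspaceT.
  have [c _ hc] := @EVT_max R (fun x => `|f x|) 0 1 ler01 (continuous_subspaceT
    (fun x => continuous_comp (cf x) (@norm_continuous _ _ _))).
  exists (`|f c| + 1) => [|x x01]; first by rewrite ltr_wpDl.
  by apply: (le_trans (hc x _)); rewrite ?in_itv// lerDl.
have d2 : 0 < d ^+ 2 by rewrite exprn_gt0.
(* The relative variance x(1 - x)/n is at most 1/n, and n makes 2C/(d^2 n) at most e/2. *)
pose n := (Num.truncn (4 * C / (d ^+ 2 * e))).+1.
have n0 : 0 < n%:R :> R by rewrite ltr0n.
have nE : 4 * C / (d ^+ 2 * e) <= n%:R by apply/ltW; exact: truncnS_gt.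
exists (bern n (fun k => f (k%:R / n%:R))) => x x01.
(* Positivity of [bern] applied to [g 1] and to [g (-1)] yields the two sides of the estimate. The
   quadratic term dominates 2C as soon as k/n is at distance at least [d] from [x], where uniform
   continuity says nothing. *)
pose g s (k : nat) : R := e / 2 + 2 * C / (d ^+ 2 * n%:R ^+ 2) * (k%:R - n%:R * x) ^+ 2
  + s * (f x - f (k%:R / n%:R)).
have hg s k : `|s| = 1 -> (k <= n)%N -> 0 <= g s k.
  move=> s1 kn; pose y : R := k%:R / n%:R.
  have yE : (k%:R - n%:R * x) ^+ 2 = n%:R ^+ 2 * (x - y) ^+ 2.
    by rewrite /y; field; rewrite gt_eqF.
  have y01 : 0 <= y <= 1.
    by rewrite divr_ge0//= ler_pdivrMr// mul1r ler_nat.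
  suff : `|f x - f y| <= e / 2 + 2 * C / d ^+ 2 * (x - y) ^+ 2.
    move=> h; rewrite /g yE -/y.
    have -> : 2 * C / (d ^+ 2 * n%:R ^+ 2) * (n%:R ^+ 2 * (x - y) ^+ 2) =
      2 * C / d ^+ 2 * (x - y) ^+ 2 by field; rewrite !gt_eqF.
    have : `|s * (f x - f y)| <= e / 2 + 2 * C / d ^+ 2 * (x - y) ^+ 2.
      by rewrite normrM s1 mul1r.
    by rewrite ler_norml => /andP[]; lra.
  have [xy|xy] := ltP `|x - y| d.
    apply: (le_trans (ltW (hd _ _ x01 xy))); rewrite lerDl mulr_ge0 ?sqr_ge0//.
    by rewrite divr_ge0 ?mulr_ge0// ltW.
  have h1 : d ^+ 2 <= (x - y) ^+ 2.
    by rewrite -[leRHS]real_normK ?num_real// ler_sqr ?nnegrE// ltW.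
  have : 2 * C <= 2 * C / d ^+ 2 * (x - y) ^+ 2.
    have -> : 2 * C / d ^+ 2 * (x - y) ^+ 2 = 2 * C * ((x - y) ^+ 2 / d ^+ 2) by ring.
    rewrite ler_peMr//; first by rewrite mulr_ge0// ltW.
    by rewrite ler_pdivlMr// mul1r.
  have := ler_normB (f x) (f y); have := hC _ x01; have := hC _ y01; lra.
have Eg s : (bern n (g s)).[x] = e / 2 + 2 * C / (d ^+ 2 * n%:R) * (x * (1 - x))
    + s * (f x - (bern n (fun k => f (k%:R / n%:R))).[x]).
  have -> : g s = (fun k => 1 * (1 * (e / 2) +
    2 * C / (d ^+ 2 * n%:R ^+ 2) * (k%:R - n%:R * x) ^+ 2)
    + s * (1 * f x + (-1) * f (k%:R / n%:R))).
    by apply/funext => k; rewrite /g; ring.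
  rewrite bern_lin (bern_lin n (fun=> e / 2) (fun k => (k%:R - n%:R * x) ^+ 2)).
  rewrite (bern_lin n (fun=> f x) (fun k => f (k%:R / n%:R))) !bern_cst bern_sqr.
  by field; rewrite !gt_eqF.
have hv : 2 * C / (d ^+ 2 * n%:R) * (x * (1 - x)) <= e / 2.
  have x1 : x * (1 - x) <= 1.
    move/andP: x01 => [x0 x1]; rewrite mulr_ile1//; lra.
  have c0 : 0 <= 2 * C / (d ^+ 2 * n%:R).
    by rewrite divr_ge0 ?mulr_ge0// ltW.
  apply: (le_trans (ler_wpM2l c0 x1)); rewrite mulr1.
  have -> : 2 * C / (d ^+ 2 * n%:R) = (4 * C / (d ^+ 2 * e)) * (e / 2 / n%:R).
    by field; rewrite !gt_eqF.
  apply: (le_trans (ler_wpM2r _ nE)); first by rewrite divr_ge0// ltW.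
  by rewrite mulrC divfK// gt_eqF.
have := bern_ge0 x01 (fun k => @hg 1 k (normr1 _)).
have := bern_ge0 x01 (fun k => @hg (-1) k (normrN1 _)).
by rewrite !Eg ler_norml => ? ?; apply/andP; split; lra.
Qed.

Lemma weierstrass (f : R -> R) (b : R) : 0 < b -> continuous f ->
  forall e, 0 < e -> exists p : {poly R},
    forall x, 0 <= x <= b -> `|f x - p.[x]| <= e.
Proof.
move=> b0 cf e e0.
have cg : continuous (fun x => f (b * x)).
  move=> x; apply: continuous_comp; last exact: cf.
  exact: mulrl_continuous.
have [p hp] := weierstrass01 cg e0.
exists (p \Po (b^-1 *: 'X)) => x /andP[x0 xb].
rewrite horner_comp hornerZ hornerX mulrC.
have := hp (x / b); rewrite mulrCA divff ?gt_eqF// mulr1; apply.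
by rewrite divr_ge0 ?(ltW b0)//= ler_pdivrMr// mul1r.
Qed.

(** The absolute value extends the power to a continuous function on the whole line, as
    [weierstrass] asks; the origin is treated by hand because derivability of the power is available
    only at positive arguments. *)
Lemma continuous_norm_powR (b : R) : 0 < b -> continuous (fun x : R => `|x| `^ b).
Proof.
move=> b0 x; have [->|x0] := eqVneq x 0.
  apply/cvgrPdist_lt => e e0; rewrite normr0 powR0 ?gt_eqF//.
  exists (e `^ b^-1) => /=; first exact: powR_gt0.
  move=> y /=; rewrite sub0r normrN => ye; rewrite sub0r normrN ger0_norm ?powR_ge0//.
  have -> : e = (e `^ b^-1) `^ b by rewrite -powRrM mulVf ?gt_eqF// powRr1// ltW.
  by apply: gt0_ltr_powR => //; rewrite nnegrE ?powR_ge0.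
apply: (@continuous_comp _ _ _ (fun x : R => `|x|) (fun y => y `^ b)).
  exact: norm_continuous.
apply: differentiable_continuous; apply/derivable1_diffP.
by apply: derivable_powR; rewrite in_itv/= andbT normr_gt0.
Qed.

End Weierstrass.

(** * Means and Fourier coefficients on the torus *)

Section Mean.
Context {R : realType}.
Local Notation C := (CC R).
Local Notation leb := (@lebesgue_measure R).
Implicit Types (f g : plane R -> R).

Lemma measurable_torus : measurable (torus R).
Proof. by apply: measurableX; exact: measurable_itv. Qed.

Lemma lebesgue_Npi_pi : leb `[- pi, pi]%classic = (2 * pi)%:E.
Proof.
rewrite lebesgue_measure_itv/= lte_fin; have := @pi_gt0 R => p0.
by rewrite ifT; [rewrite -EFinB; congr _%:E; ring|lra].
Qed.

Lemma leb2_torus : leb2 R (torus R) = ((2 * pi) ^+ 2)%:E.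
Proof.
pose I : set (measurableTypeR R) := `[- pi, pi]%classic.
have mI : measurable I by exact: measurable_itv.
transitivity (leb I * leb I)%E.
  exact: product_measure1E.
by rewrite lebesgue_Npi_pi -EFinM expr2.
Qed.

Lemma leb2_torus_fin : (leb2 R (torus R) < +oo)%E.
Proof. by rewrite leb2_torus ltry. Qed.

(** Boundedness and measurability on the whole space make the class an algebra and discharge every
    integrability condition on the torus. *)
Definition bmeas d (T : measurableType d) (f : T -> R) :=
  measurable_fun setT f /\ exists K, forall x, `|f x| <= K.

Lemma bmeas_integrable f : bmeas f ->
  (leb2 R).-integrable (torus R) (EFin \o f).
Proof.
move=> [mf [K hK]]; apply: measurable_bounded_integrable.
- exact: measurable_torus.
- exact: leb2_torus_fin.
- exact: measurable_funTS.
- exists K; split; first exact: num_real.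
  by move=> M KM x _; exact: le_trans (hK x) (ltW KM).
Qed.

Lemma bmeas_cst d (T : measurableType d) (k : R) : bmeas (fun _ : T => k).
Proof. by split; [exact: measurable_cst|exists `|k|]. Qed.

Lemma bmeasD d (T : measurableType d) (f g : T -> R) : bmeas f -> bmeas g ->
  bmeas (fun x => f x + g x).
Proof.
move=> [mf [K hK]] [mg [L hL]]; split; first exact: measurable_funD.
by exists (K + L) => x; apply: (le_trans (ler_normD _ _)); exact: lerD.
Qed.

Lemma bmeasM d (T : measurableType d) (f g : T -> R) : bmeas f -> bmeas g ->
  bmeas (fun x => f x * g x).
Proof.
move=> [mf [K hK]] [mg [L hL]]; split; first exact: measurable_funM.
by exists (K * L) => x; rewrite normrM; exact: ler_pM.
Qed.

Lemma bmeasZ d (T : measurableType d) (f : T -> R) k : bmeas f -> bmeas (fun x => k * f x).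
Proof. by move=> hf; apply: bmeasM hf; exact: bmeas_cst. Qed.

Lemma bmeasB d (T : measurableType d) (f g : T -> R) : bmeas f -> bmeas g ->
  bmeas (fun x => f x - g x).
Proof.
move=> hf hg; have := bmeasD hf (bmeasZ (-1) hg).
by congr bmeas; apply/funext => x; rewrite mulN1r.
Qed.

Lemma bmeas_sum d (T : measurableType d) I (r : seq I) (F : I -> T -> R) :
  (forall i, bmeas (F i)) -> bmeas (fun x => \sum_(i <- r) F i x).
Proof.
move=> h; elim: r => [|i r IH].
  by have := bmeas_cst T 0; congr bmeas; apply/funext => x; rewrite big_nil.
by have := bmeasD (h i) IH; congr bmeas; apply/funext => x; rewrite big_cons.
Qed.

Definition mean f : R := (2 * pi) ^- 2 * \int[leb2 R]_(x in torus R) f x.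

Lemma pi2_gt0 : 0 < (2 * pi : R) ^+ 2.
Proof. by rewrite exprn_gt0// mulr_gt0// pi_gt0. Qed.

Lemma mean_cst k : mean (fun=> k) = k.
Proof.
rewrite /mean Rintegral_cst; last exact: measurable_torus.
rewrite (_ : fine _ = (2 * pi) ^+ 2); last first.
  by have -> := congr1 fine leb2_torus.
by rewrite mulrCA mulVf ?mulr1// gt_eqF// pi2_gt0.
Qed.

Lemma meanD f g : bmeas f -> bmeas g -> mean (fun x => f x + g x) = mean f + mean g.
Proof.
move=> hf hg; rewrite /mean RintegralD ?mulrDr//; first exact: measurable_torus.
  exact: bmeas_integrable.
exact: bmeas_integrable.
Qed.

Lemma meanZ f k : bmeas f -> mean (fun x => k * f x) = k * mean f.
Proof.
move=> hf; rewrite /mean RintegralZl; last exact: bmeas_integrable.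
  by rewrite mulrCA.
exact: measurable_torus.
Qed.

Lemma meanB f g : bmeas f -> bmeas g -> mean (fun x => f x - g x) = mean f - mean g.
Proof.
move=> hf hg; rewrite /mean RintegralB ?mulrBr//; first exact: measurable_torus.
  exact: bmeas_integrable.
exact: bmeas_integrable.
Qed.

Lemma mean_sum I (r : seq I) (F : I -> plane R -> R) : (forall i, bmeas (F i)) ->
  mean (fun x => \sum_(i <- r) F i x) = \sum_(i <- r) mean (F i).
Proof.
move=> h; elim: r => [|i r IH].
  rewrite big_nil -[RHS](mean_cst 0); congr mean; apply/funext => x.
  by rewrite big_nil.
rewrite big_cons -IH -meanD//; last exact: bmeas_sum.
by congr mean; apply/funext => x; rewrite big_cons.
Qed.

Lemma le_mean f g : bmeas f -> bmeas g -> (forall x, torus R x -> f x <= g x) ->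
  mean f <= mean g.
Proof.
move=> hf hg fg; rewrite /mean ler_wpM2l//.
  by rewrite invr_ge0 ltW// pi2_gt0.
apply: le_Rintegral => //; first exact: measurable_torus.
  exact: bmeas_integrable.
exact: bmeas_integrable.
Qed.

Lemma mean_bound f K : bmeas f -> (forall x, torus R x -> `|f x| <= K) ->
  `|mean f| <= K.
Proof.
move=> hf hK; rewrite ler_norml; apply/andP; split.
  rewrite -(mean_cst (- K)); apply: le_mean => //; first exact: bmeas_cst.
  by move=> x /hK; rewrite ler_norml => /andP[].
rewrite -(mean_cst K); apply: le_mean => //; first exact: bmeas_cst.
by move=> x /hK; rewrite ler_norml => /andP[].
Qed.

Definition mean1 (f : R -> R) : R := (2 * pi)^-1 * \int[leb]_(x in `[- pi, pi]%classic) f x.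

Lemma bmeas_integrable1 (f : measurableTypeR R -> R) : bmeas f ->
  leb.-integrable `[- pi, pi]%classic (EFin \o f).
Proof.
move=> [mf [K hK]]; apply: measurable_bounded_integrable.
- exact: measurable_itv.
- exact: (eq_ind_r (fun z => (z < +oo)%E) (ltry _) lebesgue_Npi_pi).
- exact: measurable_funTS.
- exists K; split; first exact: num_real.
  by move=> M KM x _; exact: le_trans (hK x) (ltW KM).
Qed.

Lemma bmeas_fst (f : measurableTypeR R -> R) : bmeas f -> bmeas (fun x : plane R => f x.1).
Proof.
move=> [mf [K hK]]; split; last by exists K => x.
by apply: measurableT_comp.
Qed.

Lemma bmeas_snd (f : measurableTypeR R -> R) : bmeas f -> bmeas (fun x : plane R => f x.2).
Proof.
move=> [mf [K hK]]; split; last by exists K => x.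
by apply: measurableT_comp.
Qed.

(** Fubini, after extending the integrands by zero outside the square. *)
Lemma mean_prod (f g : measurableTypeR R -> R) : bmeas f -> bmeas g ->
  mean (fun x => f x.1 * g x.2) = mean1 f * mean1 g.
Proof.
move=> hf hg; set I := `[- pi, pi]%classic : set (measurableTypeR R).
have mI : measurable I by exact: measurable_itv.
have hfg : bmeas (fun x : plane R => f x.1 * g x.2).
  by apply: bmeasM; [exact: bmeas_fst|exact: bmeas_snd].
have ifg := bmeas_integrable hfg.
have iF := bmeas_integrable1 hf; have iG := bmeas_integrable1 hg.
rewrite /mean /mean1 mulrACA -invfM -expr2; congr (_ * _).
have fF := integrable_fin_num mI iF; have fG := integrable_fin_num mI iG.
rewrite /Rintegral -[RHS]fineM//; congr fine.
have ifg' : (leb2 R).-integrable setT ((EFin \o (fun x : plane R => f x.1 * g x.2)) \_ (torus R)).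
  by apply/(integrable_mkcond _ measurable_torus).
rewrite integral_mkcond -(integral12_prod_meas1 ifg').
rewrite [X in (X * _)%E]integral_mkcond.
rewrite -[X in (_ * X)%E](fineK fG).
rewrite -integralZr//; last by apply/(integrable_mkcond _ mI).
apply: eq_integral => x _; rewrite /fubini_F/= fineK//.
have [xI|xI] := boolP (x \in I).
  rewrite patchE xI -integralZl//= [RHS]integral_mkcond.
  apply: (congr1 (integral leb setT)); apply/funext => y.
  rewrite !patchE; have -> : ((x, y) \in torus R) = (y \in I).
    apply/idP/idP; rewrite !inE; first by case.
    by move=> yI; split => //=; move: xI; rewrite inE.
  by case: ifP => //; rewrite EFinM.
rewrite patchE (negPf xI) mul0e; apply: integral0_eq => y _.
rewrite patchE; case: ifP => //; rewrite inE => -[/= h _].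
by move: xI; rewrite notin_setE.
Qed.

End Mean.

(** * Orthogonality of cosines, cosine polynomials, Bessel's inequality and evenness *)

Section CosineSums.
Context {R : realType}.
Local Notation C := (CC R).
Local Notation leb := (@lebesgue_measure R).

Lemma continuous_bmeas (f : measurableTypeR R -> R) K :
  continuous (f : R -> R) -> (forall x, `|f x| <= K) -> bmeas f.
Proof. by move=> cf hK; split; [exact: continuous_measurable_fun|exists K]. Qed.

Lemma continuous_scale_comp (h : R -> R) (k : R) : continuous h ->
  continuous (fun x => h (k * x)).
Proof.
move=> ch x; apply: continuous_comp; last exact: ch.
exact: mulrl_continuous.
Qed.

Lemma bmeas_cos (k : R) : bmeas (fun x : measurableTypeR R => cos (k * x)).
Proof.
apply: (@continuous_bmeas _ 1) => [|x]; last exact: cos_max.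
by apply: continuous_scale_comp; exact: continuous_cos.
Qed.

Lemma bmeas_sin (k : R) : bmeas (fun x : measurableTypeR R => sin (k * x)).
Proof.
apply: (@continuous_bmeas _ 1) => [|x]; last exact: sin_max.
by apply: continuous_scale_comp; exact: continuous_sin.
Qed.

Lemma mean1_eq0 (f F : R -> R) : continuous f ->
  (forall x : R, is_derive x (1 : R) F (f x)) -> F pi = F (- pi) -> mean1 f = 0.
Proof.
move=> cf dF Fpi; rewrite /mean1 /Rintegral.
have h : (- pi < pi :> R) by have := @pi_gt0 R; lra.
have cF : continuous F.
  by move=> x; apply: differentiable_continuous; apply/derivable1_diffP; exact: ex_derive.
rewrite (continuous_FTC2 (F := F) h).
- by rewrite Fpi -EFinB subrr mulr0.
- exact: continuous_subspaceT.
- split; first by move=> x _; exact: ex_derive.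
    by apply: cvg_at_right_filter; exact: cF.
  by apply: cvg_at_left_filter; exact: cF.
- by move=> x _; rewrite derive1E; exact: derive_val.
Qed.

Lemma mean1_cst (k : R) : mean1 (fun=> k) = k.
Proof.
rewrite /mean1 Rintegral_cst; last exact: measurable_itv.
rewrite (_ : fine _ = 2 * pi); last by have -> := congr1 fine (@lebesgue_Npi_pi R).
by rewrite mulrCA mulVf ?mulr1// gt_eqF// mulr_gt0// pi_gt0.
Qed.

Lemma mean1D (f g : measurableTypeR R -> R) : bmeas f -> bmeas g ->
  mean1 (fun x => f x + g x) = mean1 f + mean1 g.
Proof.
move=> hf hg; have iF := bmeas_integrable1 hf; have iG := bmeas_integrable1 hg.
have mI : measurable (`[- pi, pi]%classic : set (measurableTypeR R)) by exact: measurable_itv.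
by rewrite /mean1 (RintegralD mI iF iG) mulrDr.
Qed.

Lemma mean1Z (f : measurableTypeR R -> R) k : bmeas f ->
  mean1 (fun x => k * f x) = k * mean1 f.
Proof.
move=> hf; have iF := bmeas_integrable1 hf.
have mI : measurable (`[- pi, pi]%classic : set (measurableTypeR R)) by exact: measurable_itv.
by rewrite /mean1 (RintegralZl k mI iF) mulrCA.
Qed.

Lemma mean1_cos (k : nat) : mean1 (fun x => cos (k%:R * x)) = (k == 0%N)%:R :> R.
Proof.
have [->|k0] := eqVneq k 0%N.
  by rewrite -[RHS](mean1_cst 1); congr mean1; apply/funext => x; rewrite mul0r cos0.
have k0' : (k%:R : R) != 0 by rewrite pnatr_eq0.
apply: (@mean1_eq0 _ (fun x => k%:R^-1 * sin (k%:R * x))).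
- by apply: continuous_scale_comp; exact: continuous_cos.
- move=> x; apply: is_derive_eq; rewrite /GRing.scale/= ?scaler0; field.
  exact: k0'.
- by rewrite mulrN sinN; have [-> _] := @sin_cos_natpi R k; rewrite oppr0.
Qed.

Lemma mean1_sin (k : nat) : mean1 (fun x => sin (k%:R * x)) = 0 :> R.
Proof.
have [->|k0] := eqVneq k 0%N.
  by rewrite -[RHS](mean1_cst 0); congr mean1; apply/funext => x; rewrite mul0r sin0.
have k0' : (k%:R : R) != 0 by rewrite pnatr_eq0.
apply: (@mean1_eq0 _ (fun x => - k%:R^-1 * cos (k%:R * x))).
- by apply: continuous_scale_comp; exact: continuous_sin.
- move=> x; apply: is_derive_eq; rewrite /GRing.scale/= ?scaler0; field.
  exact: k0'.
- by rewrite mulrN cosN.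
Qed.

(** The mean of cos^2(kx); it is also the inverse of the factor in [cosfac]. *)
Definition wt (k : nat) : R := if k == 0%N then 1 else 2^-1.

Lemma mean1_coscos (k l : nat) :
  mean1 (fun x => cos (k%:R * x) * cos (l%:R * x)) = (k == l)%:R * wt k :> R.
Proof.
wlog kl : k l / (l <= k)%N.
  move=> H; case: (leqP l k) => kl; first exact: H.
  rewrite (_ : (fun _ => _) = (fun x => cos (l%:R * x) * cos (k%:R * x))); last first.
    by apply/funext => x; rewrite mulrC.
  by rewrite H ?(ltnW kl)// eq_sym; case: eqP => [->//|_]; rewrite !mul0r.
rewrite (_ : (fun _ => _) = (fun x => 2^-1 * (cos ((k + l)%:R * x) + cos ((k - l)%:R * x)))).
  rewrite mean1Z; last by apply: bmeasD; exact: bmeas_cos.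
  rewrite mean1D; [|exact: bmeas_cos|exact: bmeas_cos].
  rewrite !mean1_cos addn_eq0 /wt.
  have -> : (k - l == 0)%N = (k == l) by lia.
  case: (k =P l) => [<-|kl'].
    by rewrite andbb; case: eqP => _ /=; field.
  have -> : (k == 0%N) && (l == 0%N) = false by lia.
  by rewrite addr0 mulr0 mul0r.
apply/funext => x; rewrite natrD natrB// mulrDl mulrBl.
by move: (k%:R * x) (l%:R * x) => u v; rewrite !cosD !sinN !cosN; field.
Qed.

Lemma mean1_cossin (k l : nat) :
  mean1 (fun x => cos (k%:R * x) * sin (l%:R * x)) = 0 :> R.
Proof.
have h (a b : R) (n m : nat) : mean1 (fun x => a * sin (n%:R * x) + b * sin (m%:R * x)) = 0.
  rewrite mean1D; [|exact/bmeasZ/bmeas_sin|exact/bmeasZ/bmeas_sin].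
  by rewrite !mean1Z ?mean1_sin ?mulr0 ?addr0//; exact: bmeas_sin.
case: (leqP k l) => kl.
  rewrite -[RHS](h 2^-1 2^-1 (k + l)%N (l - k)%N); congr mean1; apply/funext => x.
  rewrite natrD natrB// mulrDl mulrBl.
  by move: (k%:R * x) (l%:R * x) => u v; rewrite !sinD !sinN !cosN; field.
rewrite -[RHS](h 2^-1 (- 2^-1) (k + l)%N (k - l)%N); congr mean1; apply/funext => x.
rewrite natrD natrB ?(ltnW kl)// mulrDl mulrBl.
by move: (k%:R * x) (l%:R * x) => u v; rewrite !sinD !sinN !cosN; field.
Qed.

(** A frequency may occur several times in [s], so [cosum_coef] adds up all its occurrences. *)
Definition cosum (s : seq (R * (nat * nat))) (x y : R) : R :=
  \sum_(p <- s) p.1 * (cos (p.2.1%:R * x) * cos (p.2.2%:R * y)).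

Definition cosum_coef (s : seq (R * (nat * nat))) (k l : nat) : R :=
  \sum_(p <- s) p.1 * (((p.2.1 == k)%:R * wt p.2.1) * ((p.2.2 == l)%:R * wt p.2.2)).

Lemma cosum_cat s t x y : cosum (s ++ t) x y = cosum s x y + cosum t x y.
Proof. by rewrite /cosum big_cat. Qed.

Lemma cosum_scale s a x y :
  cosum [seq (a * p.1, p.2) | p <- s] x y = a * cosum s x y.
Proof. by rewrite /cosum big_map mulr_sumr; apply: eq_bigr => p _ /=; rewrite -mulrA. Qed.

(** At k = 0 the frequency k - 1 = -1 is replaced by 1, the cosine being even. *)
Lemma cos_mul_cos (k : nat) (x : R) : cos x * cos (k%:R * x) =
  2^-1 * (cos (k.+1%:R * x) + cos ((if k is m.+1 then m else 1%N)%:R * x)).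
Proof.
case: k => [|k]; first by rewrite mul0r cos0 mul1r; field.
have -> : k.+2%:R * x = k.+1%:R * x + x by rewrite -(natr1 k.+1); ring.
have -> : k%:R * x = k.+1%:R * x - x by rewrite -(natr1 k); ring.
by move: (k.+1%:R * x) => u; rewrite !cosD !sinN !cosN; field.
Qed.

Lemma cosum_mul_cos1 s : exists t, forall x y, cosum t x y = cos x * cosum s x y.
Proof.
exists ([seq (2^-1 * p.1, (p.2.1.+1, p.2.2)) | p <- s] ++
        [seq (2^-1 * p.1, (if p.2.1 is m.+1 then m else 1%N, p.2.2)) | p <- s]).
move=> x y; rewrite cosum_cat /cosum !big_map -big_split mulr_sumr/=.
apply: eq_bigr => p _; transitivity (p.1 * ((cos x * cos (p.2.1%:R * x)) * cos (p.2.2%:R * y))).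
  by rewrite cos_mul_cos; ring.
by ring.
Qed.

Lemma cosum_mul_cos2 s : exists t, forall x y, cosum t x y = cos y * cosum s x y.
Proof.
exists ([seq (2^-1 * p.1, (p.2.1, p.2.2.+1)) | p <- s] ++
        [seq (2^-1 * p.1, (p.2.1, if p.2.2 is m.+1 then m else 1%N)) | p <- s]).
move=> x y; rewrite cosum_cat /cosum !big_map -big_split mulr_sumr/=.
apply: eq_bigr => p _; transitivity (p.1 * (cos (p.2.1%:R * x) * (cos y * cos (p.2.2%:R * y)))).
  by rewrite cos_mul_cos; ring.
by ring.
Qed.

(** Cosine sums are stable under multiplication by either cosine. Approximating a function of the
    discrete Laplacian symbol in two variables thus reduces to Weierstrass in one variable. *)
Lemma cosum_poly (p : {poly R}) : exists s, forall x y,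
  cosum s x y = p.[4 - 2 * cos x - 2 * cos y].
Proof.
elim/poly_ind: p => [|p c [s hs]].
  by exists [::] => x y; rewrite /cosum big_nil horner0.
have [t1 h1] := cosum_mul_cos1 s; have [t2 h2] := cosum_mul_cos2 s.
exists ([seq (4 * p.1, p.2) | p <- s] ++ [seq (-2 * p.1, p.2) | p <- t1] ++
  [seq (-2 * p.1, p.2) | p <- t2] ++ [:: (c, (0%N, 0%N))]) => x y.
rewrite !cosum_cat !cosum_scale h1 h2 hs hornerMXaddC.
by rewrite /cosum big_seq1 /= !mul0r cos0; ring.
Qed.

Lemma bmeas_prod (f g : measurableTypeR R -> R) : bmeas f -> bmeas g ->
  bmeas (fun x : plane R => f x.1 * g x.2).
Proof. by move=> hf hg; apply: bmeasM; [exact: bmeas_fst|exact: bmeas_snd]. Qed.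

Lemma bmeas_cosum s : bmeas (fun x : plane R => cosum s x.1 x.2).
Proof.
apply: bmeas_sum => p; apply: bmeasZ.
by apply: (@bmeas_prod (fun x => cos (p.2.1%:R * x)) (fun x => cos (p.2.2%:R * x)));
  exact: bmeas_cos.
Qed.

Definition fcoef (f : plane R -> R) (k l : nat) : R :=
  mean (fun x => f x * (cos (k%:R * x.1) * cos (l%:R * x.2))).

Lemma bmeas_coscos (k l : nat) :
  bmeas (fun x : plane R => cos (k%:R * x.1) * cos (l%:R * x.2)).
Proof.
by apply: (@bmeas_prod (fun x => cos (k%:R * x)) (fun x => cos (l%:R * x)));
  exact: bmeas_cos.
Qed.

Lemma mean_cosum_mul s (f g : measurableTypeR R -> R) : bmeas f -> bmeas g ->
  mean (fun x => cosum s x.1 x.2 * (f x.1 * g x.2)) =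
  \sum_(p <- s) p.1 * (mean1 (fun x => cos (p.2.1%:R * x) * f x) *
                       mean1 (fun x => cos (p.2.2%:R * x) * g x)).
Proof.
move=> hf hg.
have hF k : bmeas (fun x : measurableTypeR R => cos (k * x) * f x).
  by apply: bmeasM => //; exact: bmeas_cos.
have hG k : bmeas (fun x : measurableTypeR R => cos (k * x) * g x).
  by apply: bmeasM => //; exact: bmeas_cos.
transitivity (mean (fun x : plane R => \sum_(p <- s) p.1 *
    ((cos (p.2.1%:R * x.1) * f x.1) * (cos (p.2.2%:R * x.2) * g x.2)))).
  congr mean; apply/funext => x; rewrite /cosum mulr_suml.
  by apply: eq_bigr => p _; ring.
rewrite mean_sum; last by move=> p; apply: bmeasZ; exact: (bmeas_prod (hF _) (hG _)).
apply: eq_bigr => p _; rewrite meanZ; last exact: (bmeas_prod (hF _) (hG _)).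
by congr (_ * _); exact: (mean_prod (hF _) (hG _)).
Qed.

Lemma fcoef_cosum s k l : fcoef (fun x => cosum s x.1 x.2) k l = cosum_coef s k l.
Proof.
rewrite /fcoef (mean_cosum_mul s (bmeas_cos k%:R) (bmeas_cos l%:R)).
by apply: eq_bigr => p _; rewrite !mean1_coscos.
Qed.

Lemma fcoefB f g k l : bmeas f -> bmeas g ->
  fcoef (fun x => f x - g x) k l = fcoef f k l - fcoef g k l.
Proof.
move=> hf hg; have hc := bmeas_coscos k l.
rewrite /fcoef -meanB; [|exact: bmeasM|exact: bmeasM].
by congr mean; apply/funext => x; rewrite mulrBl.
Qed.

(** Expand the mean of (g - S)^2, where S = sum of c_k E_k. The E_k are orthogonal but not
    normalized; squared norms at most 1 keep the inequality in the right direction. *)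
Lemma bessel (K : finType) (g : plane R -> R) (E : K -> plane R -> R) (w : K -> R) :
  bmeas g -> (forall k, bmeas (E k)) -> (forall k, w k <= 1) ->
  (forall k l, mean (fun x => E k x * E l x) = (k == l)%:R * w k) ->
  \sum_k mean (fun x => g x * E k x) ^+ 2 <= mean (fun x => g x ^+ 2).
Proof.
move=> hg hE w1 hO; set c := fun k => mean (fun x => g x * E k x).
pose S x := \sum_k c k * E k x.
have hcE k : bmeas (fun x => c k * E k x) by exact: bmeasZ.
have hS : bmeas S by exact: bmeas_sum.
have hg2 : bmeas (fun x => g x ^+ 2).
  by have := bmeasM hg hg; congr bmeas; apply/funext => x; rewrite expr2.
have e1 : mean (fun x => g x * S x) = \sum_k c k ^+ 2.
  transitivity (mean (fun x => \sum_k c k * (g x * E k x))).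
    by congr mean; apply/funext => x; rewrite mulr_sumr; apply: eq_bigr => k _; ring.
  rewrite mean_sum; last by move=> k; apply/bmeasZ/bmeasM.
  by apply: eq_bigr => k _; rewrite meanZ ?expr2//; exact: bmeasM.
have e2 : mean (fun x => S x * S x) = \sum_k c k ^+ 2 * w k.
  transitivity (mean (fun x => \sum_k \sum_l c k * c l * (E k x * E l x))).
    congr mean; apply/funext => x; rewrite mulr_suml; apply: eq_bigr => k _.
    by rewrite mulr_sumr; apply: eq_bigr => l _; ring.
  rewrite mean_sum; last by move=> k; apply: bmeas_sum => l; apply/bmeasZ/bmeasM.
  apply: eq_bigr => k _; rewrite mean_sum; last by move=> l; apply/bmeasZ/bmeasM.
  rewrite (bigD1 k)//= big1 ?addr0.
    by rewrite meanZ ?hO ?eqxx ?mul1r//; exact: bmeasM.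
  move=> l lk; rewrite meanZ ?hO; last exact: bmeasM.
  by rewrite eq_sym (negPf lk) mul0r mulr0.
have : 0 <= mean (fun x => g x ^+ 2 - 2 * (g x * S x) + S x * S x).
  rewrite -(mean_cst 0); apply: le_mean; first exact: bmeas_cst.
    apply: bmeasD; last exact: bmeasM.
    by apply: bmeasB => //; apply/bmeasZ/bmeasM.
  by move=> x _; have := sqr_ge0 (g x - S x); lra.
rewrite meanD; last exact: bmeasM; last first.
  by apply: bmeasB => //; apply/bmeasZ/bmeasM.
rewrite meanB//; last by apply/bmeasZ/bmeasM.
rewrite meanZ; last exact: bmeasM.
rewrite e1 e2.
have : \sum_k c k ^+ 2 * w k <= \sum_k c k ^+ 2.
  by apply: ler_sum => k _; rewrite ler_piMr ?sqr_ge0.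
lra.
Qed.

Lemma wt_le1 k : wt k <= 1. Proof. by rewrite /wt; case: ifP => // _; lra. Qed.
Lemma wt_gt0 k : 0 < wt k. Proof. by rewrite /wt; case: ifP => // _; lra. Qed.

Lemma bessel_fcoef n g K : bmeas g -> (forall x, torus R x -> `|g x| <= K) ->
  \sum_(k < n) \sum_(l < n) fcoef g k l ^+ 2 <= K ^+ 2.
Proof.
move=> hg hK; rewrite pair_bigA/=.
apply: (@le_trans _ _ (mean (fun x => g x ^+ 2))).
  apply: (@bessel ('I_n * 'I_n)%type g (fun k (x : plane R) =>
    cos (k.1%:R * x.1) * cos (k.2%:R * x.2)) (fun k => wt k.1 * wt k.2)) => //.
  - by move=> k; exact: bmeas_coscos.
  - by move=> k; rewrite mulr_ile1 ?wt_le1// ltW// wt_gt0.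
  - move=> k l; transitivity (mean (fun x : plane R =>
      (cos (k.1%:R * x.1) * cos (l.1%:R * x.1)) * (cos (k.2%:R * x.2) * cos (l.2%:R * x.2)))).
      by congr mean; apply/funext => x; ring.
    have hb (a b : nat) : bmeas (fun x : measurableTypeR R => cos (a%:R * x) * cos (b%:R * x)).
      by apply: bmeasM; exact: bmeas_cos.
    rewrite (mean_prod (hb _ _) (hb _ _)) !mean1_coscos mulrACA -natrM.
    by congr (_%:R * _); rewrite mulnb -[RHS]/(nat_of_bool ((_, _) == (_, _))) -xpair_eqE; case: k l => ? ? [].
apply: (le_trans (ler_norm _)); apply: mean_bound.
  by have := bmeasM hg hg; congr bmeas; apply/funext => x; rewrite expr2.
move=> x /hK h; rewrite ger0_norm ?sqr_ge0// -[leLHS]real_normK ?num_real//.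
by rewrite ler_sqr ?nnegrE// (le_trans _ h).
Qed.

(** The form in which continuity and evenness of the symbol are used: it is a uniform limit of
    cosine sums on the torus. *)
Definition even_approx (f : plane R -> R) := bmeas f /\
  forall e, 0 < e -> exists s, forall x, torus R x -> `|f x - cosum s x.1 x.2| <= e.

(** Orthogonality to all cosine sums passes to their uniform limits. With products containing a sine
    as [h], this removes the odd part of the Fourier coefficients. *)
Lemma mean_even_approx_eq0 f (h : plane R -> R) : even_approx f -> bmeas h ->
  (forall x, `|h x| <= 1) -> (forall s, mean (fun x => cosum s x.1 x.2 * h x) = 0) ->
  mean (fun x => f x * h x) = 0.
Proof.
move=> [mf hf] mh h1 hs; apply/eqP; rewrite -normr_le0; apply/ler_addgt0Pr => e e0.
rewrite add0r; have [s fs] := hf _ e0.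
have -> : mean (fun x => f x * h x) =
    mean (fun x => (f x - cosum s x.1 x.2) * h x).
  rewrite -[LHS]subr0 -(hs s) -meanB; [|exact: bmeasM|apply: bmeasM => //; exact: bmeas_cosum].
  by congr mean; apply/funext => x; rewrite mulrBl.
apply: mean_bound.
  by apply: bmeasM => //; apply: bmeasB => //; exact: bmeas_cosum.
move=> x /fs h2; rewrite normrM -[leRHS]mulr1; exact: ler_pM.
Qed.

Lemma cos_absz (k : int) (x : R) : cos (k%:~R * x) = cos (`|k|%N%:R * x).
Proof. by case: k => n //; rewrite NegzE mulrNz mulNr cosN abszN. Qed.

Lemma sin_absz (k : int) (x : R) :
  sin (k%:~R * x) = (if (0 <= k)%R then 1 else -1) * sin (`|k|%N%:R * x).
Proof.
case: k => n; first by rewrite mul1r.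
by rewrite NegzE mulrNz mulNr sinN abszN mulN1r.
Qed.

Lemma fourier_real (f : plane R -> R) k1 k2 :
  fourier (fun x => (f x)%:C : C) k1 k2 =
  (mean (fun x => f x * cos (- (k1%:~R * x.1 + k2%:~R * x.2)))) +i*
  (mean (fun x => f x * sin (- (k1%:~R * x.1 + k2%:~R * x.2)))).
Proof.
rewrite /fourier /cintegral /mean.
set I1 := Rintegral _ _ _; set I2 := Rintegral _ _ _.
have -> : ((2 * pi) ^- 2)%:C * (I1 +i* I2) =
   ((2 * pi) ^- 2 * I1) +i* ((2 * pi) ^- 2 * I2) :> C.
  by apply: complex_eqP; rewrite ?ReM ?ImM ReC ImC mul0r ?subr0 ?addr0.
congr ((_ * _) +i* (_ * _)); apply: eq_Rintegral => x _.
  by rewrite ReM ReC ImC mul0r subr0.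
by rewrite ImM ReC ImC mul0r addr0.
Qed.

Lemma mean_even_approx_odd f (a b : nat) : even_approx f ->
  [/\ mean (fun x => f x * (sin (a%:R * x.1) * sin (b%:R * x.2))) = 0,
      mean (fun x => f x * (cos (a%:R * x.1) * sin (b%:R * x.2))) = 0 &
      mean (fun x => f x * (sin (a%:R * x.1) * cos (b%:R * x.2))) = 0].
Proof.
have prod_le1 (u v : R) : `|u| <= 1 -> `|v| <= 1 -> `|u * v| <= 1.
  by move=> u1 v1; rewrite normrM mulr_ile1.
move=> hf; split; apply: mean_even_approx_eq0 => //.
- exact: (bmeas_prod (bmeas_sin _) (bmeas_sin _)).
- by move=> x; rewrite prod_le1 ?sin_max ?cos_max.
- move=> s; rewrite (mean_cosum_mul s (bmeas_sin a%:R) (bmeas_sin b%:R)).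
  by apply: big1 => p _; rewrite !mean1_cossin mul0r mulr0.
- exact: (bmeas_prod (bmeas_cos _) (bmeas_sin _)).
- by move=> x; rewrite prod_le1 ?sin_max ?cos_max.
- move=> s; rewrite (mean_cosum_mul s (bmeas_cos a%:R) (bmeas_sin b%:R)).
  by apply: big1 => p _; rewrite (mean1_cossin _ b) !mulr0.
- exact: (bmeas_prod (bmeas_sin _) (bmeas_cos _)).
- by move=> x; rewrite prod_le1 ?sin_max ?cos_max.
- move=> s; rewrite (mean_cosum_mul s (bmeas_sin a%:R) (bmeas_cos b%:R)).
  by apply: big1 => p _; rewrite (mean1_cossin _ a) mul0r !mulr0.
Qed.

Lemma fourier_even f k1 k2 : even_approx f ->
  fourier (fun x => (f x)%:C : C) k1 k2 = (fcoef f `|k1|%N `|k2|%N)%:C.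
Proof.
move=> hf; have [z1 z2 z3] := mean_even_approx_odd `|k1|%N `|k2|%N hf.
have [mf _] := hf.
pose s (k : int) : R := if (0 <= k)%R then 1 else -1.
have b1 : bmeas (fun x : plane R => f x * (sin (`|k1|%N%:R * x.1) * sin (`|k2|%N%:R * x.2))).
  by apply: bmeasM => //; exact: (bmeas_prod (bmeas_sin _) (bmeas_sin _)).
have b2 : bmeas (fun x : plane R => f x * (cos (`|k1|%N%:R * x.1) * sin (`|k2|%N%:R * x.2))).
  by apply: bmeasM => //; exact: (bmeas_prod (bmeas_cos _) (bmeas_sin _)).
have b3 : bmeas (fun x : plane R => f x * (sin (`|k1|%N%:R * x.1) * cos (`|k2|%N%:R * x.2))).
  by apply: bmeasM => //; exact: (bmeas_prod (bmeas_sin _) (bmeas_cos _)).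
have b4 : bmeas (fun x : plane R => f x * (cos (`|k1|%N%:R * x.1) * cos (`|k2|%N%:R * x.2))).
  by apply: bmeasM => //; exact: (bmeas_prod (bmeas_cos _) (bmeas_cos _)).
rewrite fourier_real; congr (_ +i* _).
  transitivity (mean (fun x => f x * (cos (`|k1|%N%:R * x.1) * cos (`|k2|%N%:R * x.2))
      - (s k1 * s k2) * (f x * (sin (`|k1|%N%:R * x.1) * sin (`|k2|%N%:R * x.2))))).
    congr mean; apply/funext => x.
    by rewrite cosN cosD !cos_absz !sin_absz -/(s k1) -/(s k2); ring.
  by rewrite meanB ?meanZ ?z1 ?mulr0 ?subr0//; exact: bmeasZ.
transitivity (mean (fun x => (- s k1) * (f x * (sin (`|k1|%N%:R * x.1) * cos (`|k2|%N%:R * x.2)))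
    - s k2 * (f x * (cos (`|k1|%N%:R * x.1) * sin (`|k2|%N%:R * x.2))))).
  congr mean; apply/funext => x.
  by rewrite sinN sinD !cos_absz !sin_absz -/(s k1) -/(s k2); ring.
by rewrite meanB ?meanZ ?z2 ?z3 ?mulr0 ?subr0//; exact: bmeasZ.
Qed.

Lemma even_approx_cosum s : even_approx (fun x => cosum s x.1 x.2).
Proof.
split; first exact: bmeas_cosum.
by move=> e e0; exists s => x _; rewrite subrr normr0 ltW.
Qed.

End CosineSums.

(** * Toeplitz and tau matrices of a symbol *)

Section SymbolMatrices.
Context {R : realType}.
Local Notation C := (CC R).
Implicit Types f g : plane R -> R.

Lemma toepcE c n (i j : 'I_(n * n)) : toepc c n i j =
  (c `|(mxtens_unindex i).1 - (mxtens_unindex j).1|%N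
     `|(mxtens_unindex i).2 - (mxtens_unindex j).2|%N)%:C :> C.
Proof.
set a := `|_ - _|%N; set b := `|_ - _|%N.
have ab (x y : 'I_n) : (`|x - y| < n)%N by have := ltn_ord x; have := ltn_ord y; lia.
have tE (k x y : nat) : (toepN k x y = (k == `|x - y|))%N by rewrite /toepN; lia.
rewrite /toepc summxE (bigD1 (Ordinal (ab _ _ : (a < n)%N)))//= [X in _ + X]big1.
  rewrite addr0 summxE (bigD1 (Ordinal (ab _ _ : (b < n)%N)))//= [X in _ + X]big1.
    by rewrite addr0 mxE mxE !toepSE !tE !eqxx !mulr1.
  move=> k; rewrite -val_eqE/= => /negPf kb.
  by rewrite mxE mxE !toepSE !tE -/b kb !mulr0.
move=> k; rewrite -val_eqE/= => /negPf ka; rewrite summxE; apply: big1 => l _.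
by rewrite mxE mxE !toepSE !tE -/a ka mul0r mulr0.
Qed.

Lemma toeplitz_even f n : even_approx f ->
  toeplitz (fun x => (f x)%:C : C) n = toepc (fcoef f) n.
Proof.
move=> hf; apply/matrixP => i j; rewrite toepcE mxE/=.
by rewrite fourier_even.
Qed.

Lemma tau2_even f n : even_approx f ->
  tau2 (fun x => (f x)%:C : C) n = tauc (fcoef f) n.
Proof.
move=> hf; apply: eq_bigr => k1 _; apply: eq_bigr => k2 _.
by rewrite fourier_even.
Qed.

Lemma toepcB c d n : toepc c n - toepc d n = toepc (fun k l => c k l - d k l) n :> 'M[C]_(n * n).
Proof.
rewrite /toepc -sumrB; apply: eq_bigr => k _; rewrite -sumrB; apply: eq_bigr => l _.
by rewrite -scalerBl -rmorphB.
Qed.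

Lemma symvalB c d n (x y : R) :
  symval c n x y - symval d n x y = symval (fun k l => c k l - d k l) n x y.
Proof.
rewrite /symval -sumrB; apply: eq_bigr => k _; rewrite -sumrB; apply: eq_bigr => l _.
by rewrite mulrBl.
Qed.

Lemma fcoef_subE f g : bmeas f -> bmeas g ->
  (fun k l => fcoef f k l - fcoef g k l) = fcoef (fun x => f x - g x).
Proof. by move=> hf hg; apply/funext => k; apply/funext => l; rewrite fcoefB. Qed.

Lemma fro_toeplitz_sub_le f g K n : even_approx f -> even_approx g ->
  (forall x, torus R x -> `|f x - g x| <= K) ->
  fro (toepc (fcoef f) n - toepc (fcoef g) n) <= 4 * n%:R ^+ 2 * K ^+ 2.
Proof.
move=> [mf _] [mg _] hK; rewrite toepcB fcoef_subE//.
apply: (le_trans (fro_toepc_le _ _)); rewrite ler_wpM2l ?mulr_ge0 ?sqr_ge0//.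
by apply: bessel_fcoef => //; exact: bmeasB.
Qed.

Lemma fro_diag m (d : 'rV[C]_m) : fro (diag_mx d) = \sum_i cmod (d 0 i) ^+ 2.
Proof.
rewrite froE; apply: eq_bigr => i _; rewrite (bigD1 i)//= mxE eqxx mulr1n.
rewrite big1 ?addr0// => j ji; rewrite mxE eq_sym (negPf ji) mulr0n.
by rewrite -[0]/(0%:C) cmodC normr0 expr0n.
Qed.

(** The sine transform is orthogonal, so a Frobenius bound is a mean-square bound on the
    eigenvalues. *)
Lemma sum_taueig_sqr (c : nat -> nat -> R) n :
  \sum_(i < n * n) taueig c i ^+ 2 = fro (tauc c n).
Proof.
have VV : sinemx2 n *m (sinemx2 n)^t* = 1%:M :> 'M[C]_(n * n).
  by rewrite sinemx2_adj sinemx2K.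
rewrite taucE fro_mulr_unitary// fro_mull_unitary; last by rewrite sinemx2_adj sinemx2K.
by rewrite fro_diag; apply: eq_bigr => i _; rewrite mxE cmodC real_normK ?num_real.
Qed.

(** A crude strict bound for all frequencies in [s]; the sum spares a maximum. *)
Definition cosum_bound (s : seq (R * (nat * nat))) : nat :=
  (\sum_(p <- s) (p.2.1 + p.2.2)%N).+1.

Lemma cosum_boundP s p : p \in s ->
  (p.2.1 < cosum_bound s)%N /\ (p.2.2 < cosum_bound s)%N.
Proof.
move=> ps; suff : (p.2.1 + p.2.2 < cosum_bound s)%N by lia.
by rewrite ltnS (big_rem p)//= leq_addr.
Qed.

Lemma cosum_coef_eq0 s k l :
  (cosum_bound s <= k)%N || (cosum_bound s <= l)%N -> cosum_coef s k l = 0.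
Proof.
move=> h; rewrite /cosum_coef big_seq; apply: big1 => p /cosum_boundP[h1 h2].
case: eqP => [e1|]; last by rewrite !mul0r mulr0.
case: eqP => [e2|]; last by rewrite !mul0r !mulr0.
by case/orP: h => h; [move: h1|move: h2]; rewrite ?e1 ?e2 ltnNge h.
Qed.

Lemma wt_cosfac k (x : R) : wt k * cosfac k x = cos (k%:R * x).
Proof.
rewrite /wt /cosfac; case: eqP => [->|_]; first by rewrite mul1r mul0r cos0.
by rewrite mulrA mulVf ?mul1r.
Qed.

(** Once [n] exceeds the degree, no frequency is cut off, so the tau eigenvalues of a cosine sum are
    its exact values on the grid. *)
Lemma symval_cosum s n (x y : R) : (cosum_bound s <= n)%N ->
  symval (cosum_coef s) n x y = cosum s x y.
Proof.
move=> hn; rewrite /symval /cosum_coef /cosum.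
under eq_bigr do under eq_bigr do rewrite mulr_suml.
under eq_bigr do rewrite exchange_big/=.
rewrite exchange_big/= !big_seq; apply: eq_bigr => p /cosum_boundP[h1 h2].
transitivity (p.1 * ((\sum_(k < n) (p.2.1 == k)%:R * (wt k * cosfac k x)) *
    (\sum_(l < n) (p.2.2 == l)%:R * (wt l * cosfac l y)))).
  rewrite mulr_suml mulr_sumr; apply: eq_bigr => k _.
  rewrite !mulr_sumr; apply: eq_bigr => l _.
  by case: (p.2.1 =P k) => [->|_]; case: (p.2.2 =P l) => [->|_]; rewrite ?mul0r ?mulr0 ?mul1r; ring.
under eq_bigr do rewrite eq_sym.
rewrite (sum_ord_delta n p.2.1 (fun k => wt k * cosfac k x)) (leq_trans h1 hn).
under eq_bigr do rewrite eq_sym.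
rewrite (sum_ord_delta n p.2.2 (fun k => wt k * cosfac k y)) (leq_trans h2 hn).
by rewrite !wt_cosfac.
Qed.

Lemma grid_torus n (i : 'I_(n * n)) :
  torus R (grid n (mxtens_unindex i).1, grid n (mxtens_unindex i).2).
Proof.
have h (j : 'I_n) : - pi <= (grid n j : R) <= pi.
  have p0 := @pi_ge0 R.
  have g0 : 0 <= (grid n j : R) by rewrite /grid divr_ge0 ?mulr_ge0.
  apply/andP; split; first by apply: le_trans g0; lra.
  by rewrite /grid ler_pdivrMr ?ltr0n// mulrC ler_wpM2l// ler_nat ltnS ltnW.
by split; rewrite /mkset /=; [exact: (h (mxtens_unindex i).1)|exact: (h (mxtens_unindex i).2)].
Qed.

Definition gridpt n (i : 'I_(n * n)) : plane R :=
  (grid n (mxtens_unindex i).1, grid n (mxtens_unindex i).2).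

Definition ev_small (E : forall n, 'M[C]_(n * n)) := forall e, 0 < e ->
  exists n0, forall n, (n0 <= n)%N -> small e (E n).

Lemma ev_natP (K e : R) : 0 < e -> exists n0, forall n, (n0 <= n)%N -> K <= e * n%:R.
Proof.
move=> e0; exists (Num.truncn (K / e)).+1 => n hn.
rewrite mulrC -ler_pdivrMr//; apply: (le_trans (ltW (truncnS_gt _))).
by rewrite ler_nat.
Qed.

(** Split the frequencies at the degree [d] of a good cosine sum. Below, the weight k1 + k2 is at
    most 2d; beyond, it is at most 2n, but the coefficients are those of the uniformly small
    remainder. *)
Lemma fro_toeplitz_tau_small f : even_approx f ->
  ev_small (fun n => toepc (fcoef f) n - tauc (fcoef f) n).
Proof.
move=> hf e e0; have [mf hf'] := hf; have [_ [K hK]] := mf.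
have e3 : 0 < e ^+ 3 by rewrite exprn_gt0.
(* Each of the two contributions carries 64 * 2 = 128 and may use half of e^3: hence 256. *)
have [c c0 cE] : exists2 c : R, 0 < c & c = 256 by exists 256; rewrite ?ltr0n.
pose k : R := Num.min 1 (e ^+ 3 / c).
have k0 : 0 < k by rewrite lt_min ltr01 divr_gt0.
have k1 : k <= 1 by rewrite ge_min lexx.
have k2 : c * k <= e ^+ 3.
  by rewrite mulrC -ler_pdivlMr// ge_min lexx orbT.
have [s hs] := hf' _ k0; set d := cosum_bound s.
have [n0 hn0] := ev_natP (c * d%:R * K ^+ 2) e3.
exists n0 => n nn0; apply: small_fro => //.
apply: (le_trans (fro_toepc_tauc_le _ _)).
set g := fun x : plane R => f x - cosum s x.1 x.2.
have mg : bmeas g by apply: bmeasB => //; exact: bmeas_cosum.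
have cg a b : fcoef f a b = fcoef g a b + cosum_coef s a b.
  by rewrite fcoefB//; [rewrite fcoef_cosum subrK|exact: bmeas_cosum].
have h1 : \sum_(a < n) \sum_(b < n) (a + b)%:R * fcoef f a b ^+ 2 <=
   (2 * n%:R) * (\sum_(a < n) \sum_(b < n) fcoef g a b ^+ 2) +
   (2 * d%:R) * (\sum_(a < n) \sum_(b < n) fcoef f a b ^+ 2).
  rewrite !mulr_sumr -big_split; apply: ler_sum => a _.
  rewrite !mulr_sumr -big_split; apply: ler_sum => b _ /=.
  have [hd|hd] := boolP ((d <= a) || (d <= b))%N.
    have -> : fcoef f a b = fcoef g a b by rewrite cg cosum_coef_eq0 ?addr0.
    rewrite -[leLHS]addr0; apply: lerD; last by apply: mulr_ge0; rewrite ?sqr_ge0 ?mulr_ge0.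
    rewrite ler_wpM2r ?sqr_ge0// -natrM ler_nat.
    by have := ltn_ord a; have := ltn_ord b; lia.
  rewrite -[leLHS]add0r; apply: lerD; first by apply: mulr_ge0; rewrite ?sqr_ge0 ?mulr_ge0.
  rewrite ler_wpM2r ?sqr_ge0// -natrM ler_nat; lia.
have h2 : \sum_(a < n) \sum_(b < n) fcoef g a b ^+ 2 <= k ^+ 2 by exact: bessel_fcoef.
have h3 : \sum_(a < n) \sum_(b < n) fcoef f a b ^+ 2 <= K ^+ 2 by exact: bessel_fcoef.
have h4 : k ^+ 2 <= k by rewrite expr2 ler_piMr// ltW.
have nn : 0 <= n%:R :> R by [].
have dd : 0 <= d%:R :> R by [].
apply: (@le_trans _ _ (64 * n%:R * (2 * n%:R * k + 2 * d%:R * K ^+ 2))).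
  rewrite ler_wpM2l ?mulr_ge0//; apply: (le_trans h1); apply: lerD.
    by rewrite ler_wpM2l ?mulr_ge0// (le_trans h2).
  by rewrite ler_wpM2l ?mulr_ge0.
have := hn0 _ nn0; rewrite natrM => h5; rewrite cE in k2 h5.
have := ler_wpM2r nn h5; have := ler_wpM2r (mulr_ge0 nn nn) k2.
by move: (K ^+ 2) (e ^+ 3) => x y; nra.
Qed.

Lemma count_chebyshev (I : finType) (a : I -> R) (e B : R) : 0 < e ->
  \sum_i a i ^+ 2 <= e ^+ 2 * B -> #|[pred i | (e < `|a i|)%R]|%:R <= B.
Proof.
move=> e0 hB; have e2 : 0 < e ^+ 2 by rewrite exprn_gt0.
rewrite -(ler_pM2l e2); apply: le_trans hB.
rewrite [leRHS](bigID (fun i => i \in [pred i | (e < `|a i|)%R]))/=.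
rewrite -[leLHS]addr0; apply: lerD; last by apply: sumr_ge0 => i _; exact: sqr_ge0.
rewrite mulr_natr -sumr_const; apply: ler_sum => i; rewrite inE => ei.
by rewrite -[leRHS]real_normK ?num_real// ler_sqr ?nnegrE// ltW.
Qed.

(** The cosine sum approximating [f] is reproduced exactly on the grid; the remainder is uniformly
    small there, and its tau eigenvalues are small in mean square, hence small up to few exceptions
    by Chebyshev. *)
Lemma taueig_approx f : even_approx f -> forall e, 0 < e ->
  exists n0, forall n, (n0 <= n)%N ->
  #|[pred i : 'I_(n * n) | (e < `|taueig (fcoef f) i - f (gridpt i)|)%R]|%:R
    <= e * (n * n)%:R.
Proof.
move=> hf e e0; have [mf hf'] := hf.
have e3 : 0 < e ^+ 3 by rewrite exprn_gt0.
(* 144 comes from [fro_tauc_le], and 4 from the threshold e/2 squared. *)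
have [c c0 cE] : exists2 c : R, 0 < c & c = 4 * 144 by exists (4 * 144); rewrite // -natrM ltr0n.
pose k : R := Num.min (e / 2) (Num.min 1 (e ^+ 3 / c)).
have k0 : 0 < k by rewrite !lt_min ltr01 !divr_gt0.
have k1 : k <= 1 by rewrite !ge_min lexx orbT.
have ke : k <= e / 2 by rewrite !ge_min lexx.
have k2 : c * k <= e ^+ 3.
  by rewrite mulrC -ler_pdivlMr// !ge_min lexx !orbT.
have [s hs] := hf' _ k0; exists (cosum_bound s) => n hn.
set g := fun x : plane R => f x - cosum s x.1 x.2.
have mg : bmeas g by apply: bmeasB => //; exact: bmeas_cosum.
have gE (i : 'I_(n * n)) : taueig (fcoef g) i =
    taueig (fcoef f) i - cosum s (gridpt i).1 (gridpt i).2.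
  rewrite /taueig -(fcoef_subE mf (bmeas_cosum s)) -symvalB; congr (_ - _).
  rewrite -(symval_cosum _ _ hn); congr symval.
  by apply/funext => a; apply/funext => b; rewrite fcoef_cosum.
have hc : #|[pred i : 'I_(n * n) | (e / 2 < `|taueig (fcoef g) i|)%R]|%:R
    <= e * (n * n)%:R.
  apply: count_chebyshev; first by rewrite divr_gt0.
  rewrite sum_taueig_sqr; apply: (le_trans (fro_tauc_le _ _)).
  have h2 : \sum_(a < n) \sum_(b < n) fcoef g a b ^+ 2 <= k ^+ 2 by exact: bessel_fcoef.
  have h4 : k ^+ 2 <= k by rewrite expr2 ler_piMr// ltW.
  apply: (@le_trans _ _ (144 * n%:R ^+ 2 * k)).
    by rewrite ler_wpM2l ?mulr_ge0 ?sqr_ge0// (le_trans h2).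
  have -> : (e / 2) ^+ 2 * (e * (n * n)%:R) = (e ^+ 3 / 4) * (n%:R * n%:R).
    by rewrite natrM; field.
  have := ler_wpM2r (mulr_ge0 (ler0n R n) (ler0n R n)) k2; rewrite cE; lra.
apply: le_trans hc; rewrite ler_nat; apply/subset_leq_card/fintype.subsetP => i.
rewrite !inE; apply: contraTT; rewrite -!leNgt gE => h.
have := hs _ (grid_torus i); rewrite -/(gridpt i) => h'.
have := ler_normB (taueig (fcoef f) i - cosum s (gridpt i).1 (gridpt i).2)
  (f (gridpt i) - cosum s (gridpt i).1 (gridpt i).2).
by rewrite opprB addrA subrK; lra.
Qed.

End SymbolMatrices.

(** * Averages over the grid *)

Section Averages.
Context {R : realType}.
Local Notation C := (CC R).
Implicit Types f g : plane R -> R.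

Definition grid_cos_avg (k n : nat) : R := n%:R^-1 * \sum_(i < n) cos (k%:R * grid n i).

Lemma cvg_grid_cos_avg k : grid_cos_avg k n @[n --> \oo] --> ((k == 0%N)%:R : R).
Proof.
apply/cvgrPdist_le => e e0; have [n0 hn0] := ev_natP 1 e0.
exists (maxn n0 k.+1) => // n /=; rewrite geq_max => /andP[h1 h2].
have n1 : 0 < n%:R :> R by rewrite ltr0n; lia.
rewrite /grid_cos_avg; have [->|k0] := eqVneq k 0%N.
  rewrite (eq_bigr (fun=> 1)); last by move=> i _; rewrite mul0r cos0.
  by rewrite sumr_const card_ord mulVf ?gt_eqF// subrr normr0 ltW.
rewrite sum_cos_grid_shift; last by lia.
rewrite sub0r normrN normrM ger0_norm ?invr_ge0// mulrC ler_pdivrMr//.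
apply: le_trans (hn0 _ h1); case: (odd k); rewrite ?subrr ?normr0//.
by rewrite sub0r normrN normr1.
Qed.

Lemma sum_gridpt_prod n (F G : R -> R) :
  \sum_(i < n * n) F (gridpt i).1 * G (gridpt i).2 =
  (\sum_(i < n) F (grid n i)) * (\sum_(i < n) G (grid n i)).
Proof. by rewrite mulr_sum. Qed.

(** The grid covers only the quarter (0, pi)^2. Since cosine sums are even, its averages still tend
    to the mean over the full torus; nonconstant cosines have grid sums 0 or -1. *)
Lemma cvg_cosum_avg s :
  (n * n)%:R^-1 * \sum_(i < n * n) cosum s (gridpt i).1 (gridpt i).2 @[n --> \oo]
  --> mean (fun x : plane R => cosum s x.1 x.2).
Proof.
have -> : mean (fun x : plane R => cosum s x.1 x.2) =
    \sum_(p <- s) p.1 * ((p.2.1 == 0%N)%:R * (p.2.2 == 0%N)%:R).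
  transitivity (fcoef (fun x : plane R => cosum s x.1 x.2) 0 0).
    by congr mean; apply/funext => x; rewrite !mul0r cos0 !mulr1.
  rewrite fcoef_cosum; apply: eq_bigr => p _; congr (_ * (_ * _)); rewrite /wt;
    by case: eqP => _; rewrite ?mulr1 ?mul0r.
rewrite (_ : (fun n => _) = (fun n => \sum_(p <- s)
    p.1 * (grid_cos_avg p.2.1 n * grid_cos_avg p.2.2 n))); last first.
  apply/funext => n; rewrite /cosum exchange_big mulr_sumr; apply: eq_bigr => p _ /=.
  rewrite -mulr_sumr (sum_gridpt_prod _ (fun x => cos (p.2.1%:R * x)) (fun x => cos (p.2.2%:R * x))).
  by rewrite /grid_cos_avg natrM invfM; ring.
elim: s => [|p s IH].
  rewrite big_nil (_ : (fun n => _) = (fun=> 0)); first exact: cvg_cst.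
  by apply/funext => n; rewrite big_nil.
rewrite big_cons (_ : (fun n => _) = (fun n =>
  p.1 * (grid_cos_avg p.2.1 n * grid_cos_avg p.2.2 n) +
  \sum_(p <- s) p.1 * (grid_cos_avg p.2.1 n * grid_cos_avg p.2.2 n))); last first.
  by apply/funext => n; rewrite big_cons.
apply: cvgD; last exact: IH.
apply: cvgM; first exact: cvg_cst.
by apply: cvgM; exact: cvg_grid_cos_avg.
Qed.

Lemma avg_le (N : nat) (F : 'I_N -> R) K : 0 <= K -> (forall i, `|F i| <= K) ->
  `|N%:R^-1 * \sum_i F i| <= K.
Proof.
move=> K0 h; have [N0|N0] := posnP N.
  by rewrite {1}N0 invr0 mul0r normr0.
rewrite normrM ger0_norm ?invr_ge0// mulrC ler_pdivrMr ?ltr0n//.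
apply: (le_trans (ler_norm_sum _ _ _)).
apply: (@le_trans _ _ (\sum_(i < N) K)); first by apply: ler_sum.
by rewrite sumr_const card_ord mulr_natr.
Qed.

Lemma even_approx_avg f : even_approx f -> forall e, 0 < e ->
  exists n0, forall n, (n0 <= n)%N ->
    `|(n * n)%:R^-1 * \sum_(i < n * n) f (gridpt i) - mean f| <= e.
Proof.
move=> [mf hf] e e0; have e3 : 0 < e / 3 by rewrite divr_gt0.
have [s hs] := hf _ e3.
have /cvgrPdist_le/(_ _ e3)[n0 _ hn0] := @cvg_cosum_avg s.
exists n0 => n /hn0 /= h1.
have h2 : `|(n * n)%:R^-1 * \sum_(i < n * n) f (gridpt i) -
    (n * n)%:R^-1 * \sum_(i < n * n) cosum s (gridpt i).1 (gridpt i).2| <= e / 3.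
  rewrite -mulrBr -sumrB; apply: avg_le => [|i]; first exact: ltW.
  exact: hs (grid_torus i).
have h3 : `|mean f - mean (fun x : plane R => cosum s x.1 x.2)| <= e / 3.
  rewrite -meanB//; last exact: bmeas_cosum.
  by apply: mean_bound => //; apply: bmeasB => //; exact: bmeas_cosum.
move: h1 h2 h3; rewrite !ler_norml => /andP[? ?] /andP[? ?] /andP[? ?].
by apply/andP; split; lra.
Qed.

(** In the order on complex numbers a positive [e] is a positive real, so real radii suffice. *)
Lemma cvgCP (u : nat -> C) (l : C) :
  (forall e : R, 0 < e -> exists n0, forall n, (n0 <= n)%N -> cmod (u n - l) <= e) ->
  u n @[n --> \oo] --> l.
Proof.
move=> h; apply/cvgrPdist_le => e e0.
have eE : e = (complex.Re e)%:C.
  by apply: complex_eqP => //; move: e0; rewrite ltcE/= => /andP[/eqP ->].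
have [n0 hn0] : exists n0, forall n, (n0 <= n)%N -> cmod (u n - l) <= complex.Re e.
  by apply: h; move: e0; rewrite eE ltcR.
exists n0 => // n /= /hn0 hn; rewrite distrC normCmod eE lecR//.
Qed.

(** The exceptional indices have proportion at most [e] and contribute at most 2K each; all others
    contribute at most [e]. *)
Lemma avg_cmod_le (N : nat) (a b : 'I_N -> C) K e : 0 <= e -> 0 <= K ->
  (forall i, cmod (a i) <= K) -> (forall i, cmod (b i) <= K) ->
  #|[pred i | (e < cmod (a i - b i))%R]|%:R <= e * N%:R ->
  cmod (N%:R^-1 * \sum_i a i - N%:R^-1 * \sum_i b i) <= e * (1 + 2 * K).
Proof.
move=> e0 K0 ha hb hc.
rewrite -mulrBr -sumrB cmodM.
have -> : cmod (N%:R^-1 : C) = N%:R^-1.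
  have -> : (N%:R^-1 : C) = (N%:R^-1)%:C by rewrite fmorphV rmorph_nat.
  by rewrite cmodC ger0_norm// invr_ge0.
have [N0|N0] := posnP N.
  by rewrite {1}N0 invr0 mul0r mulr_ge0// addr_ge0// mulr_ge0.
rewrite mulrC ler_pdivrMr ?ltr0n//; apply: (le_trans (cmod_sum _ _ _)).
rewrite (bigID (fun i => i \in [pred i | (e < cmod (a i - b i))%R]))/=.
have -> : e * (1 + 2 * K) * N%:R = 2 * K * (e * N%:R) + e * N%:R by ring.
apply: lerD.
  apply: (@le_trans _ _ (2 * K * #|[pred i | (e < cmod (a i - b i))%R]|%:R)).
    rewrite mulr_natr -sumr_const; apply: ler_sum => i _.
    apply: (le_trans (le_cmodD _ _)); rewrite cmodN.
    by have := ha i; have := hb i; lra.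
  by rewrite ler_wpM2l// mulr_ge0.
apply: (@le_trans _ _ (\sum_(i < N) e)); last by rewrite sumr_const card_ord mulr_natr.
rewrite [leRHS](bigID (fun i => i \in [pred i | (e < cmod (a i - b i))%R]))/=.
rewrite -[leLHS]add0r; apply: lerD; first by apply: sumr_ge0.
by apply: ler_sum => i; rewrite inE -leNgt.
Qed.

(* Here [z] is not confined to [[0, b]], nor even to the real line: the case
   [Z := CC R] is needed, as eigenvalues may be complex. *)
Lemma uniform_continuity_near (Z : Type) (dist : Z -> R -> R) (em : R -> Z)
    (F : Z -> C) (b : R) :
  (forall z x y, dist z x <= dist z y + `|x - y|) ->
  (forall x y, dist (em x) y = `|x - y|) ->
  (forall x, 0 <= x <= b -> forall e, 0 < e -> exists2 d, 0 < d &
     forall z, dist z x < d -> cmod (F z - F (em x)) < e) ->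
  forall e, 0 < e -> exists2 d, 0 < d &
     forall x z, 0 <= x <= b -> dist z x < d -> cmod (F z - F (em x)) < e.
Proof.
move=> dtri dem cF e e0.
have /compact_near_coveringP cov := @segment_compact R 0 b.
have h : forall x, `[0, b]%classic x -> \forall x' \near x & d \near (0 : R)^'+,
    forall z, dist z x' < d -> cmod (F z - F (em x')) < e.
  move=> x; rewrite /= in_itv/= => xb; have e2 : 0 < e / 2 by rewrite divr_gt0.
  have [r r0 hr] := cF x xb _ e2.
  have r2 : 0 < r / 2 by rewrite divr_gt0.
  exists (ball x (r / 2), [set d | d < r / 2]) => /=.
    by split; [exact: nbhsx_ballx|exact: nbhs_right_lt].
  move=> [x' d] /=; rewrite /ball/= => -[xx' dr] z zx'.
  have h1 : dist (em x') x < r by rewrite dem distrC; lra.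
  have h2 : dist z x < r by have := dtri z x x'; lra.
  have -> : F z - F (em x') = (F z - F (em x)) - (F (em x') - F (em x)).
    by rewrite opprB addrA subrK.
  apply: (le_lt_trans (le_cmodD _ _)); rewrite cmodN.
  by have := hr _ h1; have := hr _ h2; lra.
have hd := cov _ (0 : R)^'+ _ _ h.
near ((0 : R)^'+) => d.
exists d; first by near: d; exact: nbhs_right_gt.
move=> x z xb zx; have : forall x, `[0, b]%classic x ->
  forall z, dist z x < d -> cmod (F z - F (em x)) < e by near: d; exact: hd.
by apply; rewrite //= in_itv.
Unshelve. all: by end_near. Qed.

Lemma uniform_continuityC (F : C -> C) b : continuous F -> forall e, 0 < e ->
  exists2 d, 0 < d & forall (x : R) (z : C), 0 <= x <= b ->
    cmod (z - x%:C) < d -> cmod (F z - F x%:C) < e.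
Proof.
move=> cF; apply: (@uniform_continuity_near C (fun z x => cmod (z - x%:C)) (fun x => x%:C)).
- move=> z x y; have -> : z - x%:C = (z - y%:C) + (y - x)%:C by rewrite rmorphB/= addrA subrK.
  by apply: (le_trans (le_cmodD _ _)); rewrite cmodC distrC.
- by move=> x y; rewrite -rmorphB cmodC.
- move=> x _ e e0.
  have eC : (0 : C) < e%:C by rewrite ltcR.
  have /cvgrPdist_lt/(_ _ eC)/nbhs_ballP[d /= d0 hd] := cF x%:C.
  have dE : d = (complex.Re d)%:C.
    by apply: complex_eqP => //; move: d0; rewrite ltcE/= => /andP[/eqP ->].
  exists (complex.Re d); first by move: d0; rewrite dE ltcR.
  move=> z zd; have : ball (x%:C : C) d z.
    by rewrite /ball/= distrC normCmod dE ltcR.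
  by move=> /hd /=; rewrite distrC normCmod ltcR.
Qed.

Lemma uniform_continuityR (F : R -> C) b : continuous F -> forall e, 0 < e ->
  exists2 d, 0 < d & forall x z : R, 0 <= x <= b ->
    `|z - x| < d -> cmod (F z - F x) < e.
Proof.
move=> cF; apply: (@uniform_continuity_near R (fun z x => `|z - x|) id) => //.
- by move=> z x y; have := ler_distD y z x; rewrite (distrC y x).
- move=> x _ e e0.
  have eC : (0 : C) < e%:C by rewrite ltcR.
  have /cvgrPdist_lt/(_ _ eC)/nbhs_ballP[d /= d0 hd] := cF x.
  exists d => // z zd; have : ball x d z by rewrite /ball/= distrC.
  by move=> /hd /=; rewrite distrC normCmod ltcR.
Qed.

(** The symbol of the five-point discrete Laplacian; [t_symb alpha] is its power alpha/2. *)
Definition lapl (x : plane R) : R := 4 - 2 * cos x.1 - 2 * cos x.2.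

Lemma lapl_itv x : 0 <= lapl x <= 8.
Proof.
have := cos_le1 x.1; have := cos_le1 x.2; have := cos_geN1 x.1; have := cos_geN1 x.2.
by rewrite /lapl => ? ? ? ?; apply/andP; split; lra.
Qed.

Lemma bmeas_lapl_comp (h : R -> R) : continuous h -> bmeas (fun x => h (lapl x)).
Proof.
move=> ch; split.
  apply: (@measurableT_comp _ _ _ _ _ _ (h : measurableTypeR R -> measurableTypeR R)).
    exact: continuous_measurable_fun.
  apply: measurable_funB; [apply: measurable_funB => //|].
    by have [] := @bmeasZ R _ _ _ 2 (bmeas_fst (bmeas_cos 1)); under eq_fun do rewrite mul1r.
  by have [] := @bmeasZ R _ _ _ 2 (bmeas_snd (bmeas_cos 1)); under eq_fun do rewrite mul1r.
have e8 : (0 : R) <= 8 by [].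
have [c _ hc] := @EVT_max R (fun x => `|h x|) 0 8 e8 (continuous_subspaceT
    (fun x => continuous_comp (ch x) (@norm_continuous _ _ _))).
by exists `|h c| => x; apply: hc; rewrite in_itv/= lapl_itv.
Qed.

Lemma even_approx_lapl (h : R -> R) : continuous h -> even_approx (fun x => h (lapl x)).
Proof.
move=> ch; split; first exact: bmeas_lapl_comp.
move=> e e0; have e8 : (0 : R) < 8 by [].
have [p hp] := weierstrass e8 ch e0; have [s hs] := cosum_poly p.
by exists s => x _; rewrite hs; apply: hp; exact: lapl_itv.
Qed.

End Averages.

(** * Truncations that are Riemann integrable *)

Section LargeValues.
Context {R : realType}.
Local Notation C := (CC R).
Local Notation re z := (complex.Re (z : C)).

Definition cellpt N (i : nat) : R := i%:R / N%:R.

Lemma cellpt_subdivision N delta : (0 < N)%N -> N%:R^-1 < delta ->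
  subdivision N (cellpt N) delta.
Proof.
move=> N0 Nd; split; first by rewrite /cellpt mul0r.
  by rewrite /cellpt divff// pnatr_eq0 -lt0n.
move=> i _; rewrite /cellpt -mulrBl -natrB ?leqnSn// subSnn mul1r; split => //.
by rewrite ler_wpM2r ?invr_ge0// ler_nat.
Qed.

(** Half-open, hence disjoint, which makes measures add up; the tags of Riemann sums range over
    [closed_cell]. *)
Definition cell N (k : 'I_(N * N)) : set (plane R) :=
  `]cellpt N (mxtens_unindex k).1, cellpt N (mxtens_unindex k).1.+1]%classic `*`
  `]cellpt N (mxtens_unindex k).2, cellpt N (mxtens_unindex k).2.+1]%classic.

Lemma cell_measurable N (k : 'I_(N * N)) : measurable (cell k).
Proof. by apply: measurableX; exact: measurable_itv. Qed.

Lemma cell_trivIset N : (0 < N)%N -> trivIset setT (@cell N).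
Proof.
move=> N0 a b _ _ [[x y] [[ax ay] [bx by']]].
have N0' : 0 < N%:R^-1 :> R by rewrite invr_gt0 ltr0n.
have le (i j : nat) z : `]cellpt N i, cellpt N i.+1]%classic z ->
    `]cellpt N j, cellpt N j.+1]%classic z -> (i <= j)%N.
  rewrite /= !in_itv/= => /andP[h1 _] /andP[_ h2].
  by have := lt_le_trans h1 h2; rewrite /cellpt ltr_pM2r// ltr_nat.
rewrite -(mxtens_unindexK a) -(mxtens_unindexK b); congr mxtens_index.
rewrite [LHS]surjective_pairing [RHS]surjective_pairing.
congr (_, _); apply: val_inj; apply/eqP; rewrite eqn_leq.
  by rewrite (le _ _ _ ax bx) (le _ _ _ bx ax).
by rewrite (le _ _ _ ay by') (le _ _ _ by' ay).
Qed.

Lemma cell_leb2 N (k : 'I_(N * N)) : (0 < N)%N ->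
  leb2 R (cell k) = (N%:R^-1 * N%:R^-1)%:E.
Proof.
move=> N0; have N0' : 0 < N%:R^-1 :> R by rewrite invr_gt0 ltr0n.
have h (i : nat) : (@lebesgue_measure R) `]cellpt N i, cellpt N i.+1]%classic = (N%:R^-1)%:E.
  rewrite lebesgue_measure_itv/= lte_fin /cellpt ltr_pM2r// ltr_nat ltnSn.
  by rewrite -EFinB -mulrBl -natrB// subSnn mul1r.
pose I : set (measurableTypeR R) :=
  `]cellpt N (mxtens_unindex k).1, cellpt N (mxtens_unindex k).1.+1]%classic.
pose J : set (measurableTypeR R) :=
  `]cellpt N (mxtens_unindex k).2, cellpt N (mxtens_unindex k).2.+1]%classic.
transitivity (lebesgue_measure I * lebesgue_measure J)%E.
  by apply: product_measure1E; exact: measurable_itv.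
by rewrite h (h (mxtens_unindex k).2) -EFinM.
Qed.

Lemma cells_leb2 N (P : {pred 'I_(N * N)}) : (0 < N)%N ->
  leb2 R (\big[setU/set0]_(k < N * N | P k) cell k) = (#|P|%:R * (N%:R^-1 * N%:R^-1))%:E.
Proof.
move=> N0; have h := @measure_bigsetU_ord _ R _ (leb2 R : {measure set (plane R) -> \bar R}) (N * N) P (@cell N)
  (@cell_measurable N) (cell_trivIset N0).
rewrite [LHS]h (eq_bigr (fun=> (N%:R^-1 * N%:R^-1)%:E)); last first.
  by move=> k _; exact: cell_leb2.
by rewrite sumEFin sumr_const mulr_natl.
Qed.

Definition closed_cell N (i j : nat) : set (plane R) :=
  [set x | cellpt N i <= x.1 <= cellpt N i.+1 /\ cellpt N j <= x.2 <= cellpt N j.+1].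

Lemma cell_sub N (k : 'I_(N * N)) :
  cell k `<=` closed_cell N (mxtens_unindex k).1 (mxtens_unindex k).2.
Proof.
by move=> x [] /=; rewrite !in_itv/= => /andP[a b] /andP[c d]; split; apply/andP; split => //; exact: ltW.
Qed.

(** For N = n + 1 the sample points are upper right corners of cells of the N by N grid; this
    attaches one cell to each of them. *)
Definition samplept n (i : 'I_(n * n)) : plane R :=
  ((mxtens_unindex i).1.+1%:R * step n, (mxtens_unindex i).2.+1%:R * step n).

Lemma big_setU_ex (I : finType) (T : Type) (P : pred I) (F : I -> set T) x :
  (\big[setU/set0]_(k | P k) F k) x -> exists2 k, P k & F k x.
Proof.
elim/big_rec: _ => // k A Pk IH [kx|/IH//]; by exists k.
Qed.

(* A cell on which both [|mu| > 2 M] and [|mu| <= M] occur contributes at least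
   [M] times its area to a difference of two Riemann sums of the truncation of
   [mu] at level [2 M], so such cells are rare. *)
Lemma large_cells (mu : plane R -> C) (M e : R) : 0 < M -> 0 < e ->
  riemann_integrable (trunc mu (2 * M)) ->
  (forall n0, exists2 n, (n0 <= n)%N & e * (n * n)%:R <
     #|[pred i : 'I_(n * n) | (2 * M < cmod (mu (samplept i)))%R]|%:R) ->
  exists K : set (plane R), [/\ measurable K,
    (forall x, K x -> M < cmod (mu x)), K `<=` `[0, 1] `*` `[0, 1] &
    ((e / 8)%:E <= leb2 R K)%E].
Proof.
move=> M0 e0 [I hI] hn.
(* Two Riemann sums then differ by less than M e/32, so the bad cells have total area at most
   e/32. *)
have e' : 0 < M * (e / 64) by rewrite mulr_gt0// divr_gt0// ltr0n.
have [delta d0 hd] := hI _ e'.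
have [n n0 hcount] := hn (Num.truncn delta^-1).+1.
pose N := n.+1.
have N0 : 0 < N%:R :> R by rewrite ltr0n.
have Nd : N%:R^-1 < delta.
  rewrite invf_plt ?posrE//; apply: (lt_le_trans (truncnS_gt _)); rewrite ler_nat.
  by apply: leq_trans n0 _; exact: leqnSn.
pose hi (k : 'I_(N * N)) x := closed_cell N (mxtens_unindex k).1 (mxtens_unindex k).2 x /\
  2 * M < cmod (mu x).
pose lo (k : 'I_(N * N)) x := closed_cell N (mxtens_unindex k).1 (mxtens_unindex k).2 x /\
  cmod (mu x) <= M.
pose bad k := (exists x, hi k x) /\ (exists x, lo k x).
have [xy hxy] : {xy : 'I_N -> 'I_N -> plane R * plane R & forall i j : 'I_N,
    [/\ closed_cell N i j (xy i j).1, closed_cell N i j (xy i j).2 &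
     if `[< bad (mxtens_index (i, j)) >] then
       2 * M < cmod (mu (xy i j).1) /\ cmod (mu (xy i j).2) <= M
     else (xy i j).1 = (xy i j).2]}.
  have key (ij : 'I_N * 'I_N) : exists p : plane R * plane R,
      [/\ closed_cell N ij.1 ij.2 p.1, closed_cell N ij.1 ij.2 p.2 &
     if `[< bad (mxtens_index ij) >] then
       2 * M < cmod (mu p.1) /\ cmod (mu p.2) <= M else p.1 = p.2].
    have [[[x [cx hx]] [y [cy hy]]]|nb] := asboolP (bad (mxtens_index ij)).
      by exists (x, y); move: cx cy; rewrite mxtens_indexK.
    (* On a cell that is not bad both sums use the same tag, so it cancels in the difference. *)
    exists ((cellpt N ij.1, cellpt N ij.2), (cellpt N ij.1, cellpt N ij.2)).
    have c : closed_cell N ij.1 ij.2 (cellpt N ij.1, cellpt N ij.2).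
      by split; rewrite /= lexx/= /cellpt ler_wpM2r ?invr_ge0// ler_nat.
    by [].
  have [F hF] := choice key; exists (fun i j => F (i, j)) => i j.
  exact: hF (i, j).
have sd := cellpt_subdivision (ltn0Sn n : (0 < N)%N) Nd.
pose ext (p : plane R * plane R -> plane R) (i j : nat) : plane R := p (xy (inord i) (inord j)).
have sum_near (p : plane R * plane R -> plane R) :
    (forall i j : 'I_N, closed_cell N i j (p (xy i j))) ->
    cmod (\sum_(i < N) \sum_(j < N) ((N%:R^-1 * N%:R^-1 : R))%:C *
      trunc mu (2 * M) (p (xy i j)) - I) < M * (e / 64).
  move=> hp; have := hd N N (cellpt N) (cellpt N) (ext p) sd sd.
  set S := \sum_(i < N) _; set S' := \sum_(i < N) _.
  have -> : S = S'.
    apply: eq_bigr => i _; apply: eq_bigr => j _; rewrite /ext !inord_val.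
    by rewrite /cellpt -!mulrBl -!natrB// !subSnn !mul1r.
  apply => i j iN jN; have [] := hp (inord i) (inord j).
  by rewrite !inordK.
have h1 := sum_near fst (fun i j => let: And3 a _ _ := hxy i j in a).
have h2 := sum_near snd (fun i j => let: And3 _ a _ := hxy i j in a).
pose B : {pred 'I_(N * N)} := fun k => `[< bad k >].
have hB : #|B|%:R * (N%:R^-1 * N%:R^-1) <= e / 32.
  rewrite -(ler_pM2l M0).
  have : re (\sum_(i < N) \sum_(j < N) ((N%:R^-1 * N%:R^-1 : R))%:C *
      trunc mu (2 * M) (xy i j).1 - \sum_(i < N) \sum_(j < N) ((N%:R^-1 * N%:R^-1 : R))%:C *
      trunc mu (2 * M) (xy i j).2) <= M * (e / 32).
    apply: (le_trans (ler_norm _)); apply: (le_trans (Re_le_cmod _)).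
    move: h1 h2; set S := \sum_(i < N) _; set S' := \sum_(i < N) _ => h1 h2.
    have -> : S - S' = (S - I) - (S' - I) by rewrite opprB addrA subrK.
    by apply: (le_trans (le_cmodD _ _)); rewrite cmodN; lra.
  apply: le_trans; rewrite -sumrB Re_sum.
  have -> : M * (#|B|%:R * (N%:R^-1 * N%:R^-1)) = \sum_(k < N * N)
      N%:R^-1 * N%:R^-1 * M * (if k \in B then 1 else 0).
    by rewrite -mulr_sumr -big_mkcond/= sumr_const; ring.
  have -> : \sum_(i < N * N) N%:R^-1 * N%:R^-1 * M * (if i \in B then 1 else 0) =
      \sum_(i < N) \sum_(j < N) (N%:R^-1 * N%:R^-1 * M * (if mxtens_index (i, j) \in B then 1 else 0)).
    rewrite pair_bigA/= (reindex (@mxtens_index N N)); last first.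
      exists (@mxtens_unindex N N) => ? _; [exact: mxtens_indexK|exact: mxtens_unindexK].
    by apply: eq_bigr => -[i j] _.
  apply: ler_sum => i _; rewrite -sumrB Re_sum; apply: ler_sum => j _.
  rewrite -mulrBr ReM ReC ImC mul0r subr0 -mulrA.
  apply: ler_wpM2l; first by rewrite divr_ge0// invr_ge0.
  have [_ _] := hxy i j; rewrite /B unfold_in; case: ifP => _; last first.
    by move=> ->; rewrite subrr mulr0.
  move=> [hx hy]; rewrite mulr1.
  (* The truncation is the real number 2M at the first tag and has modulus at most M at the second,
     so the real parts differ by at least M. *)
  have -> : trunc mu (2 * M) (xy i j).1 = (2 * M)%:C by rewrite /trunc leNgt hx.
  have -> : trunc mu (2 * M) (xy i j).2 = mu (xy i j).2.
    by rewrite /trunc ifT//; apply: (le_trans hy); lra.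
  by rewrite ReD ReN ReC; have := le_trans (le_trans (ler_norm _) (Re_le_cmod _)) hy; lra.
(* Cells containing a value larger than 2M that are not bad: on each of them the modulus of [mu]
   exceeds M throughout. *)
pose G : {pred 'I_(N * N)} := fun k => `[< exists x, hi k x >] && ~~ B k.
have wN (j : 'I_n) : (j < N)%N by apply: leq_trans (ltn_ord j) (leqnSn n).
have hcG : e * (n * n)%:R < #|G|%:R + #|B|%:R.
  apply: (lt_le_trans hcount); rewrite -natrD ler_nat.
  pose w (i : 'I_(n * n)) : 'I_(N * N) :=
    mxtens_index (Ordinal (wN (mxtens_unindex i).1), Ordinal (wN (mxtens_unindex i).2)).
  have wI : injective w.
    move=> a b /(congr1 (@mxtens_unindex N N)); rewrite !mxtens_indexK => -[h3 h4].
    rewrite -(mxtens_unindexK a) -(mxtens_unindexK b); congr mxtens_index.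
    by rewrite [LHS]surjective_pairing [RHS]surjective_pairing; congr (_, _); exact: val_inj.
  apply: (@leq_trans #|[predU G & B]|); last first.
    by rewrite -cardUI leq_addr.
  rewrite -(card_imset _ wI); apply/subset_leq_card/fintype.subsetP => k hk.
  have [i hi1 ->] := imsetP hk.
  have hi2 : 2 * M < cmod (mu (samplept i)) by move: hi1; rewrite inE.
  rewrite inE /G /B !unfold_in.
  have hw : exists x, hi (w i) x.
    exists (samplept i); split => //; rewrite /w mxtens_indexK /closed_cell /samplept /step /cellpt /=.
    by split; apply/andP; split => //; rewrite ler_wpM2r ?invr_ge0// ler_nat.
  by rewrite (asboolT hw)/=; case: asboolP.
exists (\big[setU/set0]_(k < N * N | G k) cell k); split.
- by apply: bigsetU_measurable => k _; exact: cell_measurable.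
- move=> x Ux; have [k Gk kx] := big_setU_ex Ux; move: Gk => /andP[/asboolP hk /asboolP nb].
   rewrite ltNge; apply/negP => hx; apply: nb.
  by split => //; exists x; split => //; exact: cell_sub.
- move=> x Ux; have [k _ /cell_sub[/andP[a b] /andP[c d]]] := big_setU_ex Ux.
  have k1 (j : 'I_N) : 0 <= (cellpt N j : R) /\ (cellpt N j.+1 : R) <= 1.
    split; first by rewrite /cellpt divr_ge0.
    by rewrite /cellpt ler_pdivrMr// mul1r ler_nat.
  have [p1 p2] := k1 (mxtens_unindex k).1; have [p3 p4] := k1 (mxtens_unindex k).2.
  by split; rewrite /= in_itv/=; apply/andP; split; [exact: le_trans p1 a|exact: le_trans b p2|
    exact: le_trans p3 c|exact: le_trans d p4].
- rewrite cells_leb2// lee_fin.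
  have NN0 : 0 <= N%:R^-1 * N%:R^-1 :> R by rewrite mulr_ge0// invr_ge0.
  have h3 : e * (n * n)%:R * (N%:R^-1 * N%:R^-1) <= #|G|%:R * (N%:R^-1 * N%:R^-1) + e / 32.
    apply: le_trans (lerD (lexx _) hB); rewrite -mulrDl; apply: ler_wpM2r => //; exact: ltW.
  have n1 : (1 <= n)%N by apply: leq_trans n0.
  (* The cells have area 1/(n + 1)^2, not 1/n^2, which costs at most a factor 4; then e/4 - e/32 is
     still at least e/8. *)
  have h4 : 4^-1 <= (n * n)%:R * (N%:R^-1 * N%:R^-1) :> R.
    rewrite -invfM -natrM ler_pdivlMr; last by rewrite ltr0n muln_gt0.
    rewrite mulrC ler_pdivrMr// -natrM ler_nat.
    have h5 : (N <= 2 * n)%N by rewrite mul2n -addnn /N -addn1 leq_add2l.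
    have -> : (n * n * 4 = (2 * n) * (2 * n))%N by rewrite mulnACA mulnC.
    exact: leq_mul.
  have := ler_wpM2l (ltW e0) h4; rewrite mulrA => h5; lra.
Qed.

(** Otherwise [large_cells] applies at every integer level and gives sets of area at least e/8 in
    the unit square. Their upper limit has measure at least e/8, so it has a point, at which the
    modulus of [mu] would exceed every integer. The sets are unions of cells, hence measurable
    whatever [mu] is. *)
Lemma count_large_values (mu : plane R -> C) :
  (forall M : R, 0 < M -> riemann_integrable (trunc mu M)) ->
  forall e : R, 0 < e -> exists2 M : R, 0 < M & exists n0, forall n, (n0 <= n)%N ->
    #|[pred i : 'I_(n * n) | (M < cmod (mu (samplept i)))%R]|%:R <= e * (n * n)%:R.
Proof.
move=> hR e e0; apply: contrapT => hneg.
have hK (k : nat) : exists K : set (plane R), [/\ measurable K,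
    (forall x, K x -> k.+1%:R < cmod (mu x)), K `<=` `[0, 1] `*` `[0, 1] &
    ((e / 8)%:E <= leb2 R K)%E].
  have k0 : 0 < k.+1%:R :> R by rewrite ltr0n.
  have k2 : 0 < 2 * k.+1%:R :> R by rewrite mulr_gt0.
  apply: large_cells => //; first exact: hR.
  move=> n0; apply: contrapT => hn; apply: hneg; exists (2 * k.+1%:R) => //.
  exists n0 => n nn0; rewrite leNgt; apply/negP => h; apply: hn; by exists n.
have [K hK'] := choice hK.
have mK k : measurable (K k) by have [] := hK' k.
have Ksub : \bigcup_(k >= 0) K k `<=` `[0, 1] `*` `[0, 1].
  by move=> x [k _ kx]; have [_ _ h _] := hK' k; exact: h.
pose J : set (measurableTypeR R) := `[0, 1]%classic.
have mJ : measurable J by exact: measurable_itv.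
have hJ : (@lebesgue_measure R) J = 1%:E.
  by rewrite lebesgue_measure_itv/= lte_fin ltr01 oppr0 adde0.
have hJJ : leb2 R (J `*` J) = 1%:E.
  transitivity ((@lebesgue_measure R) J * (@lebesgue_measure R) J)%E.
    exact: product_measure1E.
  by rewrite hJ mule1.
have fin : (leb2 R (\bigcup_(k >= 0) K k) < +oo)%E.
  apply: (@le_lt_trans _ _ (leb2 R (J `*` J))); last by rewrite hJJ ltry.
  apply: le_measure => //; rewrite inE; first exact: bigcup_measurable.
  exact: measurableX.
(* Continuity from above along the unions of tails, which have finite measure inside the unit
   square. *)
have cvg := lim_sup_set_cvg (leb2 R) K mK fin.
have lim_ge : ((e / 8)%:E <= leb2 R (lim_sup_set K))%E.
  rewrite -(cvg_lim _ cvg)//; apply: lime_ge; first by apply/cvg_ex; eexists; exact: cvg.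
  apply: nearW => n; have [_ _ _ h] := hK' n; apply: (le_trans h).
  apply: le_measure; rewrite ?inE//; first exact: bigcup_measurable.
  by move=> x Kx; exists n => //; exact: leqnn.
have [x hx] : lim_sup_set K !=set0.
  apply/set0P; apply/negP => /eqP h; move: lim_ge; rewrite h measure0 lee_fin.
  have e8 : 0 < e / 8 by rewrite divr_gt0.
  by rewrite leNgt e8.
have [k /= hk Kx] := hx (Num.truncn (cmod (mu x))).+1 I.
have [_ h _ _] := hK' k; have := h _ Kx.
have := truncnS_gt (cmod (mu x)).
have : (Num.truncn (cmod (mu x))).+1%:R <= k.+1%:R :> R by rewrite ler_nat; lia.
lra.
Qed.

End LargeValues.

(** * Distributions *)

Section Spectra2.
Context {R : realType}.
Local Notation C := (CC R).
Local Notation re z := (complex.Re (z : C)).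

Lemma char_poly_diag (F : fieldType) n (d : 'rV[F]_n) :
  char_poly (diag_mx d) = \prod_i ('X - (d 0 i)%:P).
Proof.
rewrite char_poly_trig ?diag_mx_is_trig//; apply: eq_bigr => i _.
by rewrite mxE eqxx mulr1n.
Qed.

Lemma eigvals_diag n (V : 'M[C]_n) (d : 'rV[C]_n) : V *m V = 1%:M ->
  perm_eq (eigvals (V *m diag_mx d *m V)) [seq d 0 i | i <- enum 'I_n].
Proof.
move=> VV; apply: prod_XsubC_eq; rewrite -eigvalsE big_map big_enum/= -char_poly_diag.
have [uV _] := mulmx1_unit VV.
have VE : invmx V = V by rewrite -[LHS]mulmx1 -VV mulmxA mulVmx// mul1mx.
by rewrite -{2}VE char_poly_conj.
Qed.

Lemma sum_eigvals_diag n (V : 'M[C]_n) (d : 'rV[C]_n) (F : C -> C) : V *m V = 1%:M ->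
  \sum_(z <- eigvals (V *m diag_mx d *m V)) F z = \sum_i F (d 0 i).
Proof. by move=> VV; rewrite (perm_big _ (eigvals_diag d VV)) big_map big_enum. Qed.

Lemma sum_singvals_diag n (V : 'M[C]_n) (d : 'rV[C]_n) (F : R -> C) :
  V *m V = 1%:M -> V^t* = V ->
  \sum_(s <- singvals (V *m diag_mx d *m V)) F s = \sum_i F (cmod (d 0 i)).
Proof.
move=> VV VA; rewrite /singvals big_map.
have -> : (V *m diag_mx d *m V)^t* *m (V *m diag_mx d *m V) =
    V *m diag_mx (\row_i ((cmod (d 0 i)) ^+ 2)%:C) *m V.
  rewrite !trmxC_mul VA tr_diag_mx map_diag_mx !mulmxA -(mulmxA _ V V) VV mulmx1.
  rewrite -(mulmxA V); congr (_ *m _ *m _); apply/matrixP => i j.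
  rewrite mul_mx_diag !mxE; case: (i =P j) => [->|_]; last by rewrite !mulr0n mul0r.
  rewrite !mulr1n sqr_cmod; apply: complex_eqP.
    by rewrite ReM Re_conj Im_conj ReC; ring.
  by rewrite ImM Re_conj Im_conj ImC; ring.
rewrite (sum_eigvals_diag _ (fun z => F (Num.sqrt (re z))))//.
by apply: eq_bigr => i _; rewrite mxE ReC sqrtr_sqr ger0_norm ?cmod_ge0.
Qed.

Lemma size_eigvals n (A : 'M[C]_n) : size (eigvals A) = n.
Proof.
by apply: succn_inj; rewrite -(size_char_poly A) eigvalsE size_prod_XsubC.
Qed.

Lemma size_singvals n (A : 'M[C]_n) : size (singvals A) = n.
Proof. by rewrite size_map size_eigvals. Qed.

Lemma sum_near_le (T : Type) (s : seq T) (G : T -> C) (g : C) K e (a : pred T) :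
  0 <= e -> (forall z, cmod (G z) <= K) -> cmod g <= K ->
  (forall z, ~~ a z -> cmod (G z - g) <= e) ->
  cmod (\sum_(z <- s) (G z - g)) <= e * (size s)%:R + 2 * K * (count a s)%:R.
Proof.
move=> e0 hG hg ha; elim: s => [|z s IH].
  by rewrite big_nil !mulr0 addr0 -[0]/(0%:C) cmodC normr0.
rewrite big_cons; apply: (le_trans (le_cmodD _ _)).
have K0 : 0 <= K := le_trans (cmod_ge0 _) hg.
suff h : cmod (G z - g) <= e + 2 * K * (a z)%:R.
  apply: (le_trans (lerD h IH)); rewrite /= natrD -natr1; lra.
case: (boolP (a z)) => [az|/ha h]; last by rewrite mulr0 addr0.
rewrite mulr1; apply: (le_trans (le_cmodD _ _)); rewrite cmodN.
by have := hG z; lra.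
Qed.

Lemma avg_near_le (T : Type) (s : seq T) (G : T -> C) (g : C) K e (a : pred T) N :
  (0 < N)%N -> size s = N ->
  0 <= e -> (forall z, cmod (G z) <= K) -> cmod g <= K ->
  (forall z, ~~ a z -> cmod (G z - g) <= e) ->
  (count a s)%:R <= e * N%:R ->
  cmod (N%:R^-1 * \sum_(z <- s) G z - g) <= e * (1 + 2 * K).
Proof.
move=> N0 sN e0 hG hg ha hc.
have Nn : (N%:R : C) != 0 by rewrite pnatr_eq0 -lt0n.
have K0 : 0 <= K := le_trans (cmod_ge0 _) hg.
have -> : N%:R^-1 * \sum_(z <- s) G z - g = N%:R^-1 * \sum_(z <- s) (G z - g).
  rewrite sumrB mulrBr; congr (_ - _).
  rewrite big_const_seq count_predT sN iter_addr_0 -[g *+ N]mulr_natl mulrA.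
  by rewrite mulVf// mul1r.
rewrite cmodM; have -> : cmod (N%:R^-1 : C) = N%:R^-1.
  have -> : (N%:R^-1 : C) = (N%:R^-1)%:C by rewrite fmorphV rmorph_nat.
  by rewrite cmodC ger0_norm// invr_ge0.
rewrite mulrC ler_pdivrMr ?ltr0n//.
apply: (le_trans (sum_near_le s e0 hG hg ha)); rewrite sN.
have := ler_wpM2l (mulr_ge0 (ler0n R 2) K0) hc; lra.
Qed.

Lemma compact_support_bounded (V : topologicalType) (F : V -> C) :
  continuous F -> compact_support F -> exists2 K, 0 <= K & forall x, cmod (F x) <= K.
Proof.
move=> cF cs.
have cG : continuous (fun x => cmod (F x)).
  move=> x; apply/cvgrPdist_lt => e e0.
  have eC : (0 : C) < e%:C by rewrite ltcR.
  have /cvgrPdist_lt/(_ _ eC) := cF x; apply: filterS => y.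
  rewrite normCmod ltcR; exact: le_lt_trans (cmod_dist _ _).
have cK : compact ((fun x => cmod (F x)) @` closure [set x | F x != 0]).
  by apply: continuous_compact => //; exact: continuous_subspaceT.
have [M [Mr hM]] := compact_bounded cK.
exists (`|M| + 1) => [|x]; first by rewrite addr_ge0.
have [F0|F0] := eqVneq (F x) 0.
  by rewrite F0 -[0]/(0%:C) cmodC normr0 addr_ge0.
have M1 : M < `|M| + 1 by have := ler_norm M; lra.
have := hM _ M1 (cmod (F x)); rewrite /= ger0_norm ?cmod_ge0//; apply.
by exists x => //; exact: subset_closure.
Qed.

Lemma is_acs_small (B : nat -> mxseq R) (A : mxseq R) (w : nat -> R) :
  (forall m, 0 < w m) -> w m @[m --> \oo] --> 0 ->
  (forall m, exists n0, forall n, (n0 <= n)%N -> small (w m) (A n - B m n)) ->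
  is_acs B A.
Proof.
move=> w0 wcvg h; have [n_ hn] := choice h; exists n_, w, w; split => // m n /hn.
move=> [Rk [Nm [E h1 h2]]]; exists Rk, Nm; split => //.
  by rewrite -addrA -E addrC subrK.
exact: specnorm_le.
Qed.

Lemma Ck_cst k (c : R) : Ck k (fun _ : R * R => c).
Proof.
elim: k c => [|k IH] c; first by split => // ; exact: cst_continuous.
split; first exact: cst_continuous.
have D v : 'D_v (fun _ : R * R => c) = (fun=> 0).
  by apply/funext => x; rewrite derive_cst.
by split => [x|x||]; [exact: derivable_cst|exact: derivable_cst|rewrite D; exact: IH|rewrite D; exact: IH].
Qed.

Lemma csmooth_cst (c : C) : csmooth (fun _ => c).
Proof. by move=> k; split; exact: Ck_cst. Qed.

(** A product of two cosines is a quarter of the sum of four exponentials, one for each choice of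
    signs. *)
Lemma trig_poly_cosum s : trig_poly (fun th : R * R => (cosum s th.1 th.2)%:C : C).
Proof.
pose F (sx sy : int) : seq (C * (int * int)) :=
  [seq ((p.1 / 4)%:C : C, (sx * p.2.1%:Z, sy * p.2.2%:Z)) | p <- s].
exists (F 1 1 ++ F 1 (-1) ++ F (-1) 1 ++ F (-1) (-1)) => th.
rewrite !big_cat/= /F !big_map -!big_split/= /cosum RC_sum; apply: eq_bigr => p _.
rewrite !mul1r !mulN1r !mulrNz !mulNr -!pmulrn.
apply: complex_eqP.
  rewrite !(ReD, ReM, ReC, ImC, mul0r, subr0) /cis/=.
  by rewrite !cosD !(cosN, sinN); field.
rewrite !(ImD, ImM, ReC, ImC, mul0r, addr0) /cis/=.
by rewrite !sinD !(cosN, sinN); ring.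
Qed.

Lemma sampling_one (g : nat -> R) n : sampling g (fun _ => 1 : C) n = 1%:M.
Proof.
rewrite /sampling -diag_const_mx; congr diag_mx; apply/rowP => i; rewrite !mxE.
by case: mxtens_unindex.
Qed.

End Spectra2.

(** * The fractional symbol *)

Section FractionalSymbol.
Context {R : realType}.
Local Notation C := (CC R).
Local Notation re z := (complex.Re (z : C)).
Local Notation im z := (complex.Im (z : C)).
Variable alpha : R.
Hypothesis alpha1 : 1 < alpha.

Let a2_gt0 : 0 < alpha / 2.
Proof. by rewrite divr_gt0// (lt_trans _ alpha1). Qed.

Definition fracpow (u : R) : R := `|u| `^ (alpha / 2).
Definition fracsym (x : plane R) : R := fracpow (lapl x).

Lemma t_symbE : t_symb alpha = (fun x => (fracsym x)%:C).
Proof.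
apply/funext => x; rewrite /t_symb /fracsym /fracpow ger0_norm; last first.
  by have /andP[] := lapl_itv x.
congr ((_ `^ _)%:C); rewrite /lapl.
have h (y : R) : 4 * sin (y / 2) ^+ 2 = 2 - 2 * cos y.
  have e : y = (y / 2) *+ 2 by rewrite mulr2n; field.
  by rewrite [in RHS]e cos_mulr2n sin2cos2 mulr2n; ring.
by rewrite !h; ring.
Qed.

Lemma continuous_fracpow : continuous fracpow.
Proof. exact: continuous_norm_powR. Qed.

Lemma even_approx_fracsym : even_approx fracsym.
Proof. exact: even_approx_lapl continuous_fracpow. Qed.

Lemma fracsym_itv x : 0 <= fracsym x <= 8 `^ (alpha / 2).
Proof.
rewrite powR_ge0/=; have /andP[l0 l8] := lapl_itv x.
by apply: ge0_ler_powR; rewrite ?nnegrE ?ger0_norm// ltW.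
Qed.

Lemma lapl_ge0 (x : plane R) : 0 <= lapl x.
Proof. by have /andP[] := lapl_itv x. Qed.

(** If the first coordinate is at least eta pi, then it alone keeps the Laplacian symbol above 2 - 2
    cos(eta pi). Small values are thus confined to a strip of about eta (n + 1) n grid points, at
    most e n^2 because n + 1 is at most 2n. *)
Lemma count_small_fracsym (e : R) : 0 < e -> exists2 d : R, 0 < d &
  exists n0, forall n, (n0 <= n)%N ->
  #|[pred i : 'I_(n * n) | (fracsym (gridpt i) < d)%R]|%:R <= e * (n * n)%:R.
Proof.
move=> e0; pose eta : R := Num.min 1 (e / 2).
have eta0 : 0 < eta by rewrite lt_min ltr01 divr_gt0.
have eta1 : eta <= 1 by rewrite ge_min lexx.
have eta2 : 2 * eta <= e by rewrite mulrC -ler_pdivlMr// ge_min lexx orbT.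
have p0 := @pi_gt0 R; have p00 := @pi_ge0 R.
have v0 : 0 < 2 - 2 * cos (eta * pi).
  have : cos (eta * pi) < cos 0.
    rewrite ltr_cos ?mulr_gt0// in_itv/= ?lexx//=.
    by rewrite mulr_ge0 ?(ltW eta0)//= ler_piMl.
  by rewrite cos0; lra.
exists ((2 - 2 * cos (eta * pi)) `^ (alpha / 2)); first exact: powR_gt0.
exists 1%N => n n1.
apply: (@le_trans _ _ (eta * n.+1%:R * n%:R)); last first.
  have h : n.+1%:R <= 2 * n%:R :> R by rewrite -natrM ler_nat; lia.
  have nn := ler0n R n.
  have := ler_wpM2l (ltW eta0) h => h1; have := ler_wpM2r nn h1.
  have := ler_wpM2r (mulr_ge0 nn nn) eta2; rewrite natrM; lra.
have sub : forall i : 'I_(n * n), (fracsym (gridpt i) < (2 - 2 * cos (eta * pi)) `^ (alpha / 2)) ->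
    ((mxtens_unindex i).1 < Num.truncn (eta * n.+1%:R))%N.
  move=> i; apply: contraTT; rewrite -leqNgt -leNgt => h.
  have h1 : eta * n.+1%:R <= (mxtens_unindex i).1.+1%:R.
    by apply: ltW; apply: (lt_le_trans (truncnS_gt _)); rewrite ler_nat ltnS.
  have l0 := lapl_ge0 (gridpt i : plane R).
  apply: ge0_ler_powR; rewrite ?nnegrE ?ger0_norm ?(ltW v0) ?(ltW a2_gt0)//.
  have hg : eta * pi <= grid n (mxtens_unindex i).1.
    rewrite /grid ler_pdivlMr ?ltr0n// mulrAC; exact: ler_wpM2r.
  have hpi : grid n (mxtens_unindex i).1 <= pi :> R.
    rewrite /grid ler_pdivrMr ?ltr0n// mulrC; apply: ler_wpM2l => //.
    by rewrite ler_nat ltnS ltnW.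
  have : cos (gridpt i).1 <= cos (eta * pi) :> R.
    rewrite -[(gridpt i).1]/(grid n (mxtens_unindex i).1).
    rewrite leNgt ltr_cos ?in_itv/=; last first.
    - by rewrite mulr_ge0 ?(ltW eta0)//= ler_piMl.
    - by rewrite hpi andbT; apply: le_trans hg; rewrite mulr_ge0// ltW.
    by rewrite -leNgt.
  by have := cos_le1 (gridpt i : plane R).2; rewrite /lapl; lra.
apply: (@le_trans _ _ (\sum_(i < n * n)
    (((mxtens_unindex i).1 < Num.truncn (eta * n.+1%:R))%N : nat)%:R * 1)).
  rewrite -sum1_card natr_sum big_mkcond/=; apply: ler_sum => i _.
  by rewrite mulr1; case: ifP => //; rewrite inE => /sub ->.
rewrite -(mulr_sum (fun i : 'I_n => ((i < Num.truncn (eta * n.+1%:R))%N : nat)%:R) (fun=> 1)).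
rewrite sumr_const card_ord ler_wpM2r// -natr_sum.
have t0 : 0 <= eta * n.+1%:R by rewrite mulr_ge0// ltW.
have /andP[h _] := truncn_itv t0; apply: le_trans h.
by rewrite ler_nat sum_ord_lt_le.
Qed.

Lemma admissible_real (f : plane R -> R) : measurable_fun setT f ->
  admissible (leb2 R) (torus R) (fun x => (f x)%:C : C).
Proof.
move=> mf; split.
- exact: measurable_torus.
- by rewrite [X in (_ < X)%E]leb2_torus lte_fin pi2_gt0.
- exact: leb2_torus_fin.
- by split; [exact: measurable_funTS|exact: measurable_cst].
Qed.

Lemma mean_cintegral (f : plane R -> C) :
  (fine (leb2 R (torus R)))^-1%:C * cintegral (leb2 R) (torus R) f =
  (mean (fun x => re (f x))) +i* (mean (fun x => im (f x))).
Proof.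
have -> : fine (leb2 R (torus R)) = (2 * pi) ^+ 2 by have -> := congr1 fine (@leb2_torus R).
rewrite /cintegral /mean; set I1 := Rintegral _ _ _; set I2 := Rintegral _ _ _.
by apply: complex_eqP; rewrite ?ReM ?ImM ReC ImC mul0r ?subr0 ?addr0.
Qed.

Lemma continuous_ReIm (F : R -> C) : continuous F ->
  continuous (fun x => re (F x)) /\ continuous (fun x => im (F x)).
Proof.
move=> cF; split => x; apply/cvgrPdist_lt => e e0;
  have eC : (0 : C) < e%:C by rewrite ltcR.
- have /cvgrPdist_lt/(_ _ eC) := cF x; apply: filterS => y.
  rewrite normCmod ltcR; apply: le_lt_trans.
  by rewrite -ReN -ReD; exact: Re_le_cmod.
- have /cvgrPdist_lt/(_ _ eC) := cF x; apply: filterS => y.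
  rewrite normCmod ltcR; apply: le_lt_trans.
  by rewrite -ImN -ImD; exact: Im_le_cmod.
Qed.

(** [F] composed with the power is still a continuous function of [lapl], so its real and imaginary
    parts are themselves limits of cosine sums. *)
Lemma avg_fracsym (F : R -> C) : continuous F -> forall e, 0 < e ->
  exists n0, forall n, (n0 <= n)%N ->
  cmod ((n * n)%:R^-1 * \sum_(i < n * n) F (fracsym (gridpt i)) -
    ((mean (fun x => re (F (fracsym x)))) +i* (mean (fun x => im (F (fracsym x)))))) <= e.
Proof.
move=> cF e e0; have [cR cI] := continuous_ReIm cF.
have e2 : 0 < e / 2 by rewrite divr_gt0.
have cfR : continuous (fun u => re (F (fracpow u))).
  move=> x; apply: (@continuous_comp _ _ _ fracpow (fun y => re (F y))).
    exact: continuous_fracpow.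
  exact: cR.
have cfI : continuous (fun u => im (F (fracpow u))).
  move=> x; apply: (@continuous_comp _ _ _ fracpow (fun y => im (F y))).
    exact: continuous_fracpow.
  exact: cI.
have [n1 h1] := even_approx_avg (even_approx_lapl cfR) e2.
have [n2 h2] := even_approx_avg (even_approx_lapl cfI) e2.
exists (maxn n1 n2) => n; rewrite geq_max => /andP[/h1 h3 /h2 h4].
apply: (le_trans (cmod_le_ReIm _)).
have -> : ((n * n)%:R^-1 : C) = ((n * n)%:R^-1)%:C by rewrite fmorphV rmorph_nat.
rewrite ReD ReN ImD ImN ReM ImM ReC ImC !mul0r subr0 addr0 Re_sum Im_sum/=.
by rewrite [e]splitr; exact: lerD.
Qed.

Lemma distr_of_near (A : forall n, 'I_(n * n) -> C) (F : R -> C) K :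
  continuous F -> 0 <= K -> (forall x, cmod (F x) <= K) -> (forall n i, cmod (A n i) <= K) ->
  (forall e, 0 < e -> exists n0, forall n, (n0 <= n)%N ->
    #|[pred i | (e < cmod (A n i - F (fracsym (gridpt i))))%R]|%:R <= e * (n * n)%:R) ->
  (n * n)%:R^-1 * \sum_i A n i @[n --> \oo] -->
   ((mean (fun x => re (F (fracsym x)))) +i* (mean (fun x => im (F (fracsym x)))) : C).
Proof.
move=> cF K0 hF hA hc; apply: cvgCP => e e0.
have e2 : 0 < e / 2 by rewrite divr_gt0.
have k0 : 0 < e / 2 / (1 + 2 * K) by rewrite divr_gt0// ltr_pwDl// mulr_ge0.
have [n1 h1] := avg_fracsym cF e2; have [n2 h2] := hc _ k0.
exists (maxn n1 n2) => n; rewrite geq_max => /andP[/h1 h3 /h2 h4].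
have := avg_cmod_le (ltW k0) K0 (hA n) (fun i => hF _) h4.
rewrite divfK; last by rewrite gt_eqF// ltr_pwDl// mulr_ge0.
move=> h5; set L := (_ +i* _) in h3 *.
set X := _^-1 * _; set Y := _^-1 * _ in h3 h5.
have -> : X - L = (X - Y) + (Y - L) by rewrite addrA subrK.
by apply: (le_trans (le_cmodD _ _)); rewrite [e]splitr; exact: lerD.
Qed.

Lemma cvg_cst_distr (T : eqType) (S : forall n, seq T) (G : T -> C) (g : C) K :
  0 <= K -> (forall z, cmod (G z) <= K) -> cmod g <= K ->
  (forall n, size (S n) = (n * n)%N) ->
  (forall e, 0 < e -> exists (a : pred T) n0,
     (forall z, ~~ a z -> cmod (G z - g) <= e) /\
     forall n, (n0 <= n)%N -> (count a (S n))%:R <= e * (n * n)%:R) ->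
  (n * n)%:R^-1 * \sum_(z <- S n) G z @[n --> \oo] --> g.
Proof.
move=> K0 hG hg hS hc; apply: cvgCP => e e0.
have k0 : 0 < e / (1 + 2 * K) by rewrite divr_gt0// ltr_pwDl// mulr_ge0.
have [a [n0 [h1 h2]]] := hc _ k0.
exists (maxn n0 1) => n; rewrite geq_max => /andP[/h2 h3 n1].
have := avg_near_le _ (hS n) (ltW k0) hG hg h1 h3.
rewrite divfK; last by rewrite gt_eqF// ltr_pwDl// mulr_ge0.
by apply; rewrite muln_gt0 n1.
Qed.

End FractionalSymbol.

(** * The preconditioner and the preconditioned matrices *)

Section PreconditionerSpectrum.
Context {R : realType}.
Local Notation C := (CC R).
Local Notation re z := (complex.Re (z : C)).
Local Notation im z := (complex.Im (z : C)).
Variables (alpha : R) (P : mxseq R) (s : nat -> C).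
Hypothesis alpha1 : 1 < alpha.
Let c := fcoef (fracsym alpha).
Hypothesis PE : forall n, P n = tauc c n + (s n)%:M.
Hypothesis s_cvg0 : forall e : R, 0 < e ->
  exists n0, forall n, (n0 <= n)%N -> cmod (s n) <= e.

(** The shift [s n] covers both choices of the preconditioner. It may be complex; [P n] is then
    normal but not Hermitian. *)
Definition prec_eig n : 'rV[C]_(n * n) := \row_i ((taueig c i)%:C + s n).

Lemma precE n : P n = sinemx2 n *m diag_mx (prec_eig n) *m sinemx2 n.
Proof.
rewrite PE taucE.
have -> : prec_eig n = \row_i (taueig c i)%:C + const_mx (s n) by apply/rowP => i; rewrite !mxE.
rewrite raddfD/= mulmxDr mulmxDl diag_const_mx; congr (_ + _).
by rewrite -scalemx1 -scalemxAr mulmx1 -scalemxAl sinemx2K scalemx1.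
Qed.

Lemma prec_eig_near (e : R) : 0 < e -> exists n0, forall n, (n0 <= n)%N ->
  #|[pred i | (e < cmod (prec_eig n 0 i - (fracsym alpha (gridpt i))%:C))%R]|%:R
    <= e * (n * n)%:R.
Proof.
move=> e0; have e2 : 0 < e / 2 by rewrite divr_gt0.
have [n1 h1] := taueig_approx (even_approx_fracsym alpha1) e2.
have [n2 h2] := s_cvg0 e2.
exists (maxn n1 n2) => n; rewrite geq_max => /andP[/h1 h3 /h2 h4].
apply: (le_trans (y := e / 2 * (n * n)%:R)); last by apply: ler_wpM2r => //; lra.
apply: le_trans h3; rewrite ler_nat; apply/subset_leq_card/fintype.subsetP => i.
rewrite !inE mxE; apply: contraTT; rewrite -!leNgt => h.
have -> : (taueig c i)%:C + s n - (fracsym alpha (gridpt i))%:C =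
    (taueig c i - fracsym alpha (gridpt i))%:C + s n :> C.
  by rewrite rmorphB/= addrAC.
apply: (le_trans (le_cmodD _ _)); rewrite cmodC; rewrite -/c in h; lra.
Qed.

Lemma sigma_distr_prec : sigma_distr (leb2 R) P (torus R) (t_symb alpha).
Proof.
have [[mf _] _] := even_approx_fracsym alpha1.
rewrite t_symbE; split; first exact: admissible_real.
move=> F cF csF; have [K K0 hK] := compact_support_bounded cF csF.
have -> : (fun x => F (cmod (fracsym alpha x)%:C)) = (fun x => F (fracsym alpha x)).
  by apply/funext => x; rewrite cmodC ger0_norm//; have /andP[] := fracsym_itv alpha1 x.
rewrite mean_cintegral.
under eq_cvg => n do rewrite precE (sum_singvals_diag _ _ (sinemx2K n) (sinemx2_adj n)).
apply: (distr_of_near alpha1 (K := K)) => // e e0.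
have [d d0 hd] := uniform_continuityR (8 `^ (alpha / 2)) cF e0.
have k0 : 0 < Num.min (d / 2) e by rewrite lt_min e0 divr_gt0.
have [n0 h] := prec_eig_near k0; exists n0 => n /h {}h.
apply: (@le_trans _ _ (Num.min (d / 2) e * (n * n)%:R)); last first.
  by apply: ler_wpM2r => //; rewrite ge_min lexx orbT.
apply: le_trans h; rewrite ler_nat; apply/subset_leq_card/fintype.subsetP => i.
rewrite !inE; apply: contraTT; rewrite -!leNgt => h; apply/ltW/hd; first exact: fracsym_itv.
have := cmod_dist (prec_eig n 0 i) (fracsym alpha (gridpt i))%:C.
have /andP[f0 _] := fracsym_itv alpha1 (gridpt i : plane R).
rewrite cmodC (ger0_norm f0) => h1; apply: (le_lt_trans h1); apply: (le_lt_trans h).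
by rewrite gt_min; apply/orP; left; lra.
Qed.

Lemma lambda_distr_prec : lambda_distr (leb2 R) P (torus R) (t_symb alpha).
Proof.
have [[mf _] _] := even_approx_fracsym alpha1.
rewrite t_symbE; split; first exact: admissible_real.
move=> F cF csF; have [K K0 hK] := compact_support_bounded cF csF.
rewrite mean_cintegral.
under eq_cvg => n do rewrite precE (sum_eigvals_diag _ _ (sinemx2K n)).
have cF' : continuous (fun x : R => F x%:C).
  move=> x; apply/cvgrPdist_lt => e e0.
  have /cvgrPdist_lt/(_ _ e0)/nbhs_ballP[d /= d0 hd] := cF x%:C.
  have dE : d = (re d)%:C.
    by apply: complex_eqP => //; move: d0; rewrite ltcE/= => /andP[/eqP ->].
  apply/nbhs_ballP; exists (re d); first by move: d0; rewrite dE ltcR.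
  move=> y; rewrite /ball/= => hy; apply: hd.
  by rewrite /ball/= -rmorphB/= normCmod cmodC dE ltcR.
apply: (distr_of_near alpha1 (F := fun x => F x%:C) (K := K)) => // e e0.
have [d d0 hd] := uniform_continuityC (8 `^ (alpha / 2)) cF e0.
have k0 : 0 < Num.min (d / 2) e by rewrite lt_min e0 divr_gt0.
have [n0 h] := prec_eig_near k0; exists n0 => n /h {}h.
apply: (@le_trans _ _ (Num.min (d / 2) e * (n * n)%:R)); last first.
  by apply: ler_wpM2r => //; rewrite ge_min lexx orbT.
apply: le_trans h; rewrite ler_nat; apply/subset_leq_card/fintype.subsetP => i.
rewrite !inE; apply: contraTT; rewrite -!leNgt => h; apply/ltW/hd; first exact: fracsym_itv.
apply: (le_lt_trans h).
by rewrite gt_min; apply/orP; left; lra.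
Qed.

End PreconditionerSpectrum.

(** * GLT sequences whose symbol depends on theta only *)

Section ToeplitzApprox.
Context {R : realType}.
Local Notation C := (CC R).

Lemma is_GLT_even (A : mxseq R) (f : plane R -> R) : even_approx f ->
  ev_small (fun n => A n - toepc (fcoef f) n) ->
  is_GLT A (fun p => (f p.2)%:C).
Proof.
move=> hf hA; have [[mf _] hs] := hf; split.
  split => /=; last exact: measurable_cst.
  exact/measurable_funTS/(measurableT_comp mf).
pose w m : R := m.+1%:R^-1.
have w0 m : 0 < w m by rewrite invr_gt0.
have w1 m : w m <= 1 by rewrite invf_le1 ?ler1n.
(* With K = w^3/4, at most 1, the Frobenius bound 4 n^2 K^2 is at most w^3 n^2, as [small_fro]
   requires. *)
have k0 m : 0 < w m ^+ 3 / 4 by rewrite divr_gt0 ?exprn_gt0.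
have [s hs'] := choice (fun m => hs _ (k0 m)).
have kw m : w m ^+ 3 / 4 <= w m.
  rewrite ler_pdivrMr// exprS; apply: ler_wpM2l; first exact: ltW.
  have : w m ^+ 2 <= 1 by apply: exprn_ile1 => //; exact: ltW.
  lra.
have wc : w m @[m --> \oo] --> 0 := @cvg_harmonic R.
exists (fun=> 1%N), (fun _ _ _ => 1), (fun m _ x => (cosum (s m) x.1 x.2)%:C); split.
- by move=> m i _; split; [exact: csmooth_cst|exact: trig_poly_cosum].
(* The convergence is uniform on the domain, so the exceptional set is eventually empty. *)
- move=> e e0; apply: cvg_near_cst.
  have /cvgrPdist_lt/(_ _ e0) := wc; apply: filterS => m hm.
  set S := _ `&` _; have -> : S = set0 by rewrite -subset0 => -[x th] [[_ ht]] /=;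
    rewrite big_ord1 mul1r -rmorphB/= cmodC distrC => h;
    have := hs' m th ht; have := kw m; move: hm; rewrite sub0r normrN (gtr0_norm (w0 m)); lra.
  by rewrite measure0.
- apply: (is_acs_small (w := fun m => 4 * w m)) => [m||m]; first by rewrite mulr_gt0.
    by rewrite -[X in _ --> X](mulr0 4); apply: cvgM => //; exact: cvg_cst.
  have [n1 h1] := hA _ (w0 m).
  exists n1 => n /h1 h3.
  rewrite big_ord1 sampling_one mul1mx (toeplitz_even _ (even_approx_cosum _)).
  have -> : 4 * w m = 2 * (w m + w m) by ring.
  set g := fun x : plane R => cosum _ _ _.
  rewrite -(subrK (toepc (fcoef f) n) (A n)) -addrA.
  apply: smallD; rewrite ?(ltW (w0 m))//; apply: small_fro => //.
  apply: (le_trans (fro_toeplitz_sub_le n hf (even_approx_cosum _) (hs' m))).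
  have h : w m ^+ 3 / 4 <= 1 by apply: le_trans (kw m) (w1 m).
  have := ler_wpM2l (ltW (k0 m)) h; rewrite natrM.
  have nn := mulr_ge0 (ler0n R n) (ler0n R n).
  move=> /(ler_wpM2r nn); lra.
Qed.

Lemma even_approx_one : even_approx (fun _ : plane R => 1 : R).
Proof.
split; first exact: bmeas_cst.
move=> e e0; exists [:: (1, (0%N, 0%N))] => x _.
by rewrite /cosum big_seq1/= !mul0r cos0 !mulr1 subrr normr0 ltW.
Qed.

Lemma toepc_one n : toepc (fcoef (fun _ : plane R => 1 : R)) n = 1%:M.
Proof.
apply/matrixP => i j; rewrite toepcE mxE.
set k := `|_|%N; set l := `|_|%N.
have -> : (fun _ : plane R => 1 : R) = (fun x => cosum [:: (1, (0%N, 0%N))] x.1 x.2).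
  by apply/funext => x; rewrite /cosum big_seq1/= !mul0r cos0 !mulr1.
rewrite fcoef_cosum /cosum_coef big_seq1/= mul1r.
have h (u v : 'I_n) : ((0%N == `|(u : int) - (v : int)|%N)%:R * wt 0 : R) = (u == v)%:R.
  by rewrite /wt eqxx mulr1 [_ == `|_|%N]eq_sym absz_eq0 subr_eq0.
rewrite !h -natrM mulnb -[in RHS](mxtens_unindexK i) -[in RHS](mxtens_unindexK j).
rewrite (inj_eq (can_inj (@mxtens_indexK _ _))) rmorph_nat.
by case: (mxtens_unindex i) (mxtens_unindex j) => [? ?] [? ?].
Qed.
End ToeplitzApprox.

Lemma card_leq_or (T : finType) (a b c : pred T) :
  (forall i, c i -> a i || b i) -> (#|c| <= #|a| + #|b|)%N.
Proof.
move=> h; rewrite -cardUI; apply: leq_trans (leq_addr _ _).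
by apply/subset_leq_card/fintype.subsetP => i; rewrite !inE; exact: h.
Qed.

Lemma conj_diagD (F : pzRingType) n (W : 'M[F]_n) (d e : 'rV[F]_n) :
  W *m diag_mx d *m W + W *m diag_mx e *m W = W *m diag_mx (d + e) *m W.
Proof. by rewrite raddfD/= mulmxDr mulmxDl. Qed.

Lemma conj_diagM (F : pzRingType) n (W : 'M[F]_n) (d e : 'rV[F]_n) : W *m W = 1%:M ->
  W *m diag_mx d *m W *m (W *m diag_mx e *m W) =
  W *m diag_mx (\row_i (d 0 i * e 0 i)) *m W.
Proof.
by move=> WW; rewrite !mulmxA -(mulmxA _ W W) WW mulmx1 -(mulmxA W) mulmx_diag.
Qed.

(** * Clustering of the preconditioned matrices at 1 *)

Section PreconditionedSpectrum.
Context {R : realType}.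
Local Notation C := (CC R).
Local Notation re z := (complex.Re (z : C)).
Local Notation im z := (complex.Im (z : C)).
Variables (alpha : R) (P X : mxseq R) (s : nat -> C).
Hypothesis alpha1 : 1 < alpha.
Let c := fcoef (fracsym alpha).
Hypothesis PE : forall n, P n = tauc c n + (s n)%:M.
Hypothesis s_cvg0 : forall e : R, 0 < e ->
  exists n0, forall n, (n0 <= n)%N -> cmod (s n) <= e.
Hypothesis Punit : forall n, P n \in unitmx.
Hypothesis XP : ev_small (fun n => X n - P n).
Local Notation V n := (@sinemx2 R n).
Let p n := prec_eig alpha s n.

(** Outside few grid points the symbol is at least [d] and the eigenvalue is within d/2 of it. *)
Lemma prec_eig_small (e : R) : 0 < e -> exists2 d : R, 0 < d & exists n0, forall n, (n0 <= n)%N ->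
  #|[pred i | (re (prec_eig alpha s n 0 i) < d)%R]|%:R <= e * (n * n)%:R.
Proof.
move=> e0; have e2 : 0 < e / 2 by rewrite divr_gt0.
have [d d0 [n1 h1]] := count_small_fracsym alpha1 e2.
have k0 : 0 < Num.min (d / 2) (e / 2) by rewrite lt_min e2 divr_gt0.
have [n2 h2] := prec_eig_near alpha1 s_cvg0 k0.
exists (d / 2); first by rewrite divr_gt0.
exists (maxn n1 n2) => n; rewrite geq_max => /andP[/h1 h3 /h2 h4].
have h5 : Num.min (d / 2) (e / 2) * (n * n)%:R <= e / 2 * (n * n)%:R.
  by apply: ler_wpM2r => //; rewrite ge_min lexx orbT.
have h6 := lerD h3 (le_trans h4 h5); rewrite -mulrDl -splitr in h6.
apply: le_trans h6; rewrite -natrD ler_nat.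
apply: card_leq_or => i; rewrite /=; apply: contraTT; rewrite negb_or -!leNgt => /andP[h7 h8].
have := le_trans (Re_le_cmod _) h8; rewrite ReD ReN ReC.
have : Num.min (d / 2) (e / 2) <= d / 2 by rewrite ge_min lexx.
have := ler_norm (- (re (prec_eig alpha s n 0 i) - fracsym alpha (gridpt i))).
rewrite normrN; lra.
Qed.

Lemma prec_eig_neq0 n i : p n 0 i != 0.
Proof.
have := Punit n; rewrite (precE PE) unitmxE !det_mulmx !unitrM => /andP[/andP[_]].
by rewrite det_diag unitfE => /prodf_neq0/(_ i isT).
Qed.

Lemma invmx_prec n : invmx (P n) = V n *m diag_mx (\row_i (p n 0 i)^-1) *m V n.
Proof.
set G := RHS; suff h : G *m P n = 1%:M by rewrite -[LHS]mul1mx -h -mulmxA mulmxV ?mulmx1.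
rewrite /G (precE PE) conj_diagM ?sinemx2K//.
transitivity (V n *m diag_mx (const_mx 1) *m V n); last first.
  by rewrite diag_const_mx mulmx1 sinemx2K.
congr (V n *m diag_mx _ *m V n); apply/rowP => i; rewrite !mxE mulVf//.
by have := prec_eig_neq0 i; rewrite /p mxE.
Qed.

Lemma rank_conj_diag n (d : 'rV[C]_(n * n)) :
  (\rank (V n *m diag_mx d *m V n) <= #|[pred i | (d 0 i != 0)%R]|)%N.
Proof.
apply: (leq_trans (mxrankM_maxl _ _)); apply: (leq_trans (mxrankM_maxr _ _)).
exact: rank_diag_mx_le.
Qed.

Lemma bounded_by_sinemx2 n : bounded_by (V n) 1.
Proof. by apply: bounded_by_unitary; rewrite sinemx2_adj sinemx2K. Qed.

(** [invmx (P n)] is split into [G1], of small rank but uncontrolled norm, and [G2], of norm at most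
    1/d. With X - P = A + N, the terms containing [G1] or [A] have small rank, and [G2 *m N] has
    small norm. *)
Lemma prec_quotient_small : ev_small (fun n => invmx (P n) *m X n - 1%:M).
Proof.
move=> e e0; have e3 : 0 < e / 3 by rewrite divr_gt0.
have [d d0 [n1 h1]] := prec_eig_small e3.
(* The first bound serves the rank of [A], the second absorbs the factor 1/d in the norm of
   [G2 *m N]. *)
pose w := Num.min (e / 3) (e / 3 * d).
have w0 : 0 < w by rewrite lt_min e3 mulr_gt0.
have [n2 h2] := XP w0.
exists (maxn n1 n2) => n; rewrite geq_max => /andP[/h1 h3 /h2 [A [N [ZE hA hN]]]].
pose r1 : 'rV[C]_(n * n) := \row_i (if re (p n 0 i) < d then (p n 0 i)^-1 else 0).
pose r2 : 'rV[C]_(n * n) := \row_i (if re (p n 0 i) < d then 0 else (p n 0 i)^-1).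
pose G1 := V n *m diag_mx r1 *m V n; pose G2 := V n *m diag_mx r2 *m V n.
have GE : invmx (P n) = G1 + G2.
  rewrite invmx_prec /G1 /G2 conj_diagD; congr (V n *m diag_mx _ *m V n).
  by apply/rowP => i; rewrite !mxE; case: ifP => _; rewrite ?addr0 ?add0r.
have hG2 : bounded_by G2 (1 * d^-1 * 1).
  apply: (bounded_byM _ (@bounded_by_sinemx2 _)); apply: (bounded_byM (@bounded_by_sinemx2 _)).
  apply: bounded_by_diag => i; rewrite mxE; case: ltP => [_|hd].
    by rewrite -[0]/(0%:C) cmodC normr0 invr_ge0 ltW.
  have pc : d <= cmod (p n 0 i) by apply: (le_trans hd); apply: (le_trans (ler_norm _)); exact: Re_le_cmod.
  have p0 : 0 < cmod (p n 0 i) by apply: lt_le_trans pc.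
  have -> : cmod (p n 0 i)^-1 = (cmod (p n 0 i))^-1.
    apply: (mulIf (lt0r_neq0 p0)); rewrite -cmodM !mulVf ?prec_eig_neq0 ?lt0r_neq0//.
    by rewrite -[1]/(1%:C) cmodC normr1.
  by rewrite lef_pV2.
exists (G1 *m (X n - P n) + G2 *m A), (G2 *m N); split.
- by rewrite -addrA -mulmxDr -ZE -mulmxDl -GE mulmxBr mulVmx.
- apply: (@le_trans _ _ (e / 3 * (n * n)%:R + w * (n * n)%:R)); last first.
    rewrite -mulrDl; apply: ler_wpM2r => //.
    have : w <= e / 3 by rewrite ge_min lexx.
    lra.
  apply: le_trans (lerD h3 hA); rewrite -natrD ler_nat.
  apply: (leq_trans (mxrank_add _ _)); apply: leq_add; last exact: mxrankM_maxr.
  apply: (leq_trans (mxrankM_maxl _ _)); apply: (leq_trans (rank_conj_diag _)).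
  apply/subset_leq_card/fintype.subsetP => i; rewrite !inE mxE.
  by case: ifP => //; rewrite eqxx.
- apply: bounded_byS (bounded_byM hG2 hN).
    by rewrite !mulr1 mul1r mulr_ge0 ?invr_ge0// ltW.
  rewrite mul1r mulr1 mulrC ler_pdivrMr//.
  have : w <= e / 3 * d by rewrite ge_min lexx orbT.
  have := mulr_gt0 e0 d0; lra.
Qed.

Lemma count_prec_singvals (e eta : R) : 0 < e -> 0 < eta -> eta < 1 ->
  exists n0, forall n, (n0 <= n)%N ->
  (count (fun s => eta < `|s - 1|)%R (singvals (invmx (P n) *m X n)))%:R <= e * (n * n)%:R.
Proof.
move=> e0 eta0 eta1; pose w := Num.min (e / 3) (eta / 20).
have we : w <= e / 3 by rewrite ge_min lexx.
have weta : w <= eta / 20 by rewrite ge_min lexx orbT.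
have w0 : 0 < w by rewrite lt_min !divr_gt0.
have [n0 h] := prec_quotient_small w0; exists n0 => n /h [A [N [E hA hN]]].
have w1 : w <= 1 by lra.
have w10 : 10 * w < eta by lra.
have := singvals_cluster E hN w0 w1 w10 eta1; rewrite addrC subrK -(ler_nat R).
move/le_trans; apply; rewrite natrM.
have := ler_wpM2r (ler0n R (n * n)) we; lra.
Qed.

Lemma count_prec_eigvals (e eta : R) : 0 < e -> 0 < eta ->
  (forall n, im (s n) = 0) -> (forall n, (X n)^t* = X n) ->
  exists n0, forall n, (n0 <= n)%N ->
  (count (fun z : C => ~~ ((im z == 0) && (`|re z - 1| <= eta)%R))
    (eigvals (invmx (P n) *m X n)))%:R <= e * (n * n)%:R.
Proof.
move=> e0 eta0 sR XH; have e10 : 0 < e / 10 by rewrite divr_gt0.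
have [d d0 [n1 h1]] := prec_eig_small e10.
have ed0 : 0 < eta * d by rewrite mulr_gt0.
pose w := Num.min (e / 2) (eta * d / 2).
have we : w <= e / 2 by rewrite ge_min lexx.
have wd : w < eta * d by rewrite gt_min; apply/orP; right; lra.
have w0 : 0 < w by rewrite lt_min !divr_gt0.
have [n2 h2] := XP w0.
exists (maxn n1 n2) => n; rewrite geq_max => /andP[/h1 h3 /h2 [A [N [ZE hA hN]]]].
have pE i : p n 0 i = (re (p n 0 i))%:C.
  by apply: complex_eqP; rewrite ?ReC ?ImC// /p mxE ImD ImC sR addr0.
have PV : P n = V n *m diag_mx (\row_i (re (p n 0 i))%:C) *m (V n)^t*.
  rewrite sinemx2_adj (precE PE); congr (V n *m diag_mx _ *m V n).
  by apply/rowP => i; rewrite [RHS]mxE -pE.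
have iPV : invmx (P n) = V n *m diag_mx (\row_i ((re (p n 0 i))^-1)%:C) *m (V n)^t*.
  rewrite sinemx2_adj invmx_prec; congr (V n *m diag_mx _ *m V n).
  by apply/rowP => i; rewrite [LHS]mxE [RHS]mxE [in LHS]pE fmorphV.
have PH : (P n)^t* = P n.
  rewrite PV !trmxC_mul trmxCK !mulmxA; congr (V n *m _ *m _).
  rewrite tr_diag_mx map_diag_mx; congr diag_mx; apply/rowP => i; rewrite !mxE.
  by apply: complex_eqP; rewrite ?Re_conj ?Im_conj ?ImC ?oppr0.
(* [K2] is the spectral projection of [P n] onto eigenvalues below [d]; on its kernel [P n] is at
   least [d] and its inverse at most 1/d. *)
pose bad : 'rV[C]_(n * n) := \row_i (if re (p n 0 i) < d then 1 else 0).
pose K2 := V n *m diag_mx bad *m V n.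
have rK : (\rank K2 <= #|[pred i | (re (p n 0 i) < d)%R]|)%N.
  apply: (leq_trans (rank_conj_diag _)); apply/subset_leq_card/fintype.subsetP => i.
  by rewrite !inE mxE; case: ifP => //; rewrite eqxx.
have hK (v : 'rV[C]_(n * n)) : v *m K2 = 0 -> forall i, re (p n 0 i) < d -> (v *m V n) 0 i = 0.
  move=> h i hi; have : v *m K2 *m V n = 0 by rewrite h mul0mx.
  rewrite /K2 -!mulmxA sinemx2K mulmx1 mulmxA => /(congr1 (fun M : 'rV[C]_(n * n) => M 0 i)).
  by rewrite mul_mx_diag mxE [bad _ _]mxE hi mulr1 => ->; rewrite mxE.
have sqnV (v : 'rV[C]_(n * n)) : sqn v = sqn (v *m V n) by rewrite sqn_unitary// sinemx2_adj sinemx2K.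
have cm0 : cmod (0 : C) = 0 by rewrite -[0 : C]/(0%:C) cmodC normr0.
have cnt := pencil_small (K2 := K2) PH (XH n) (Punit n) d0 eta0 (ltW w0) wd ZE hN _ _.
apply: (@le_trans _ _ (5 * (e / 10 * (n * n)%:R) + w * (n * n)%:R)); last first.
  have := ler_wpM2r (ler0n R (n * n)) we; lra.
have h5 : (\rank K2)%:R <= e / 10 * (n * n)%:R by apply: le_trans h3; rewrite ler_nat.
apply: (le_trans (y := 5 * (\rank K2)%:R + (\rank A)%:R)); last by lra.
rewrite -natrM -natrD ler_nat; apply: cnt => v /hK hv.
- rewrite PV qform_congr qform_diag sqnV /sqn mulr_sumr; apply: ler_sum => i _.
  case: (ltP (re (p n 0 i)) d) => [/hv ->|hi]; last by rewrite ler_wpM2r ?sqr_ge0.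
  by rewrite cm0 expr0n !mulr0.
- rewrite iPV qform_congr qform_diag sqnV /sqn mulr_sumr; apply: ler_sum => i _.
  case: (ltP (re (p n 0 i)) d) => [/hv ->|hi].
    by rewrite cm0 expr0n !mulr0.
  by rewrite ler_wpM2r ?sqr_ge0// lef_pV2// posrE// (lt_le_trans d0).
Qed.

End PreconditionedSpectrum.

(** * From clustering at 1 to distributions *)

Section ClusterDistributions.
Context {R : realType}.
Local Notation C := (CC R).
Local Notation re z := (complex.Re (z : C)).
Local Notation im z := (complex.Im (z : C)).

Let admissible_one : admissible (leb2 R) (torus R) (fun=> 1 : C).
Proof. exact: (admissible_real (measurable_cst (1 : R))). Qed.

Let limit_one (g : C) :
  (fine (leb2 R (torus R)))^-1%:C * cintegral (leb2 R) (torus R) (fun=> g) = g.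
Proof. by rewrite mean_cintegral !mean_cst; case: g. Qed.

Lemma sigma_distr_one (Q : mxseq R) :
  (forall e eta : R, 0 < e -> 0 < eta -> eta < 1 -> exists n0, forall n, (n0 <= n)%N ->
    (count (fun s => eta < `|s - 1|)%R (singvals (Q n)))%:R <= e * (n * n)%:R) ->
  sigma_distr (leb2 R) Q (torus R) (fun=> 1).
Proof.
move=> hQ; split=> // F cF csF; have [K K0 hK] := compact_support_bounded cF csF.
rewrite limit_one; have -> : cmod (1 : C) = 1 by rewrite -[1]/(1%:C) cmodC normr1.
apply: (cvg_cst_distr K0) => // [n|e e0]; first exact: size_singvals.
have eC : (0 : C) < e%:C by rewrite ltcR.
have /cvgrPdist_le/(_ _ eC)/nbhs_ballP[d /= d0 hd] := cF 1.
pose eta := Num.min (d / 2) 2^-1.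
have eta0 : 0 < eta by rewrite lt_min invr_gt0 divr_gt0/=.
have etad : eta < d by rewrite gt_min; apply/orP; left; lra.
have eta1 : eta < 1 by rewrite gt_min; apply/orP; right; lra.
have [n0 h] := hQ _ _ e0 eta0 eta1.
exists (fun s => eta < `|s - 1|)%R, n0; split=> // z; rewrite -leNgt => hz.
have := hd z; rewrite /ball/= distrC (le_lt_trans hz)// => /(_ isT).
by rewrite distrC normCmod lecR.
Qed.

Lemma lambda_distr_one (Q : mxseq R) :
  (forall e eta : R, 0 < e -> 0 < eta -> exists n0, forall n, (n0 <= n)%N ->
    (count (fun z : C => ~~ ((im z == 0) && (`|re z - 1| <= eta)%R))
      (eigvals (Q n)))%:R <= e * (n * n)%:R) ->
  lambda_distr (leb2 R) Q (torus R) (fun=> 1).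
Proof.
move=> hQ; split=> // F cF csF; have [K K0 hK] := compact_support_bounded cF csF.
rewrite limit_one; apply: (cvg_cst_distr K0) => // [n|e e0]; first exact: size_eigvals.
have [d d0 hd] := uniform_continuityC 1 cF e0.
have d2 : 0 < d / 2 by rewrite divr_gt0.
have [n0 h] := hQ _ _ e0 d2.
exists (fun z : C => ~~ ((im z == 0) && (`|re z - 1| <= d / 2)%R)), n0; split=> // z.
rewrite negbK => /andP[/eqP iz rz]; apply/ltW; rewrite -[1]/(1%:C); apply: hd.
  by rewrite ler01 lexx.
have -> : z - 1%:C = (re z - 1)%:C by apply: complex_eqP; rewrite ?ReD ?ImD ?ReN ?ImN ?ReC ?ImC ?iz ?subr0.
by rewrite cmodC; lra.
Qed.

End ClusterDistributions.

(** * The scaled diagonal sampling matrix *)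

Section Perturbation.
Context {R : realType}.
Local Notation C := (CC R).
Local Notation im z := (complex.Im (z : C)).
Variables (alpha : R) (mu : plane R -> C).
Hypothesis alpha1 : 1 < alpha.

Lemma DmxE n : Dmx mu n = diag_mx (\row_i mu (samplept i)).
Proof. by congr diag_mx; apply/rowP => i; rewrite !mxE /samplept; case: mxtens_unindex. Qed.

Lemma step_powR_le n : step n `^ alpha <= step n :> R.
Proof.
rewrite -[leRHS]powRr1 ?invr_ge0//; apply: ger_powR; last exact: ltW.
by rewrite invr_gt0 ltr0n/= invf_le1 ?ler1n.
Qed.

(** All but few samples of [mu] are bounded by one fixed M, and h^alpha M is at most h M, which
    tends to 0. *)
Lemma scaled_Dmx_small :
  (forall M : R, 0 < M -> riemann_integrable (trunc mu M)) ->
  ev_small (fun n => (step n `^ alpha)%:C *: Dmx mu n).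
Proof.
move=> hmu e e0; have [M M0 [n1 h1]] := count_large_values hmu e0.
have [n2 h2] := ev_natP M e0.
exists (maxn n1 n2) => n; rewrite geq_max => /andP[/h1 h3 /h2 h4].
have -> : (step n `^ alpha)%:C *: Dmx mu n = diag_mx (\row_i ((step n `^ alpha)%:C * mu (samplept i))).
  by rewrite DmxE -linearZ; congr diag_mx; apply/rowP => i; rewrite !mxE.
apply: small_diag; first exact: ltW.
apply: le_trans h3; rewrite ler_nat; apply/subset_leq_card/fintype.subsetP => i.
rewrite !inE mxE; apply: contraTT; rewrite -!leNgt => hM.
rewrite cmodM cmodC ger0_norm ?powR_ge0//.
apply: (@le_trans _ _ (step n * M)); first by apply: ler_pM; rewrite ?powR_ge0 ?cmod_ge0 ?step_powR_le.
rewrite mulrC ler_pdivrMr ?ltr0n//; apply: (le_trans h4); apply: ler_wpM2l; first exact: ltW.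
by rewrite ler_nat.
Qed.

Lemma samplept_unit_square n (i : 'I_(n * n)) : unit_square R (samplept i).
Proof.
have h (k : 'I_n) : `[0, 1]%classic (k.+1%:R * step n : R).
  by rewrite /= in_itv/= mulr_ge0 ?invr_ge0//= ler_pdivrMr ?ltr0n// mul1r ler_nat ltnW// ltnS ltn_ord.
by split; exact: h.
Qed.

Lemma trmxC_toepc (c : nat -> nat -> R) n : (toepc c n)^t* = toepc c n.
Proof.
apply/matrixP => i j; rewrite !mxE !toepcE.
rewrite [`|_ - (mxtens_unindex i).1|%N]distnC [`|_ - (mxtens_unindex i).2|%N]distnC.
by apply: complex_eqP; rewrite ?Re_conj ?Im_conj ?ImC ?oppr0.
Qed.

Lemma trmxC_scaled_Dmx n : (forall x, unit_square R x -> im (mu x) = 0) ->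
  ((step n `^ alpha)%:C *: Dmx mu n)^t* = (step n `^ alpha)%:C *: Dmx mu n.
Proof.
move=> hmu; rewrite trmxC_scale; congr (_ *: _).
rewrite DmxE tr_diag_mx map_diag_mx; congr diag_mx; apply/rowP => i; rewrite !mxE.
by apply: complex_eqP; rewrite ?Re_conj ?Im_conj ?hmu ?oppr0//; exact: samplept_unit_square.
Qed.

End Perturbation.

Theorem theorem7 (R : realType) (alpha : R) (mu : plane R -> CC R)
    (mubar : nat -> CC R) (P : mxseq R) :
  1 < alpha < 2 ->
  (forall K : R, exists2 x, unit_square R x & K < cmod (mu x)) ->
  (forall M : R, 0 < M -> riemann_integrable (trunc mu M)) ->
  (forall x, unit_square R x -> trunc mu M x @[M --> +oo] --> mu x) ->
  (step n `^ alpha)%:C * mubar n @[n --> \oo] --> (0 : CC R) ->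
  let t := t_symb alpha in
  let one : plane R -> CC R := fun=> 1 in
  let B := toeplitz t in
  let Q : mxseq R := fun n =>
    invmx (P n) *m (B n + (step n `^ alpha)%:C *: Dmx mu n) in
  (forall n, P n = tau2 t n) \/
  (forall n, P n = tau2 t n + ((step n `^ alpha)%:C * mubar n)%:M) ->
  [/\ is_GLT P (fun p => t p.2) /\ sigma_distr (leb2 R) P (torus R) t,
      (forall n, P n \in unitmx) ->
        is_GLT Q (fun=> 1) /\ sigma_distr (leb2 R) Q (torus R) one,
      (forall x, unit_square R x -> complex.Im (mu x) = 0) ->
        (forall n, complex.Im (mubar n) = 0) ->
        lambda_distr (leb2 R) P (torus R) t &
      (forall n, P n \in unitmx) ->
        (forall x, unit_square R x -> complex.Im (mu x) = 0) ->
        (forall n, complex.Im (mubar n) = 0) ->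
        lambda_distr (leb2 R) Q (torus R) one].
Proof.
move=> /andP[alpha1 _] _ hmu _ hbar t one B Q PE.
have hf := even_approx_fracsym alpha1.
pose c := fcoef (fracsym alpha).
have tE n : tau2 t n = tauc c n by rewrite /t t_symbE tau2_even.
(* Both choices of [P] become a tau matrix plus a scalar shift tending to 0, the shift being 0 for
   the first choice. *)
have [s [Ps s0 sR]] : exists s : nat -> CC R, [/\ (forall n, P n = tauc c n + (s n)%:M),
    (forall e : R, 0 < e -> exists n0, forall n, (n0 <= n)%N -> cmod (s n) <= e) &
    (forall n, complex.Im (mubar n) = 0) -> forall n, complex.Im (s n) = 0].
  have cm0 : cmod (0 : CC R) = 0 by rewrite -[0 : CC R]/(0%:C) cmodC normr0.
  case: PE => PE.
    exists (fun=> 0); split=> // [n|e e0].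
      by rewrite PE tE raddf0 addr0.
    by exists 0%N => n _; rewrite cm0 ltW.
  exists (fun n => (step n `^ alpha)%:C * mubar n); split=> [n|e e0|h n].
  - by rewrite PE tE.
  - have eC : (0 : CC R) < e%:C by rewrite ltcR.
    have hb : ((step n `^ alpha)%:C * mubar n : CC R) @[n --> \oo] --> (0 : CC R) := hbar.
    have /cvgrPdist_le/(_ _ eC)[n0 _ hn] := hb.
    by exists n0 => n /hn /=; rewrite sub0r normrN normCmod lecR.
  - by rewrite ImM ReC ImC h mulr0 mul0r addr0.
have BE n : B n = toepc c n by rewrite /B /t t_symbE toeplitz_even.
pose X n := B n + (step n `^ alpha)%:C *: Dmx mu n.
have BP : ev_small (fun n => P n - toepc c n).
  move=> e e0; have e4 : 0 < e / 4 by rewrite divr_gt0.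
  have [n1 h1] := fro_toeplitz_tau_small hf e4; have [n2 h2] := s0 _ e4.
  exists (maxn n1 n2) => n; rewrite geq_max => /andP[/h1 h3 /h2 h4].
  have -> : P n - toepc c n = - (toepc c n - tauc c n) + (s n)%:M.
    by rewrite Ps opprB addrAC.
  have -> : e = 2 * (e / 4 + e / 4) by field.
  by apply: smallD; [exact: ltW|exact: ltW|exact: smallN|exact: small_scalar].
have XP : ev_small (fun n => X n - P n).
  move=> e e0; have e4 : 0 < e / 4 by rewrite divr_gt0.
  have [n1 h1] := scaled_Dmx_small alpha1 hmu e4; have [n2 h2] := BP _ e4.
  exists (maxn n1 n2) => n; rewrite geq_max => /andP[/h1 h3 /h2 h4].
  have -> : X n - P n = (step n `^ alpha)%:C *: Dmx mu n - (P n - toepc c n).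
    by rewrite /X BE opprB addrCA addrA.
  have -> : e = 2 * (e / 4 + e / 4) by field.
  by apply: smallD; [exact: ltW|exact: ltW|exact: h3|exact: smallN].
split.
- split; last exact: sigma_distr_prec alpha1 Ps s0.
  by rewrite /t t_symbE; exact: is_GLT_even hf BP.
- move=> Pu; split; last first.
    apply: sigma_distr_one => e eta e0 eta0 eta1.
    exact: (count_prec_singvals alpha1 Ps s0 Pu XP).
  apply: (@is_GLT_even R Q (fun=> 1)) => [|e e0]; first exact: even_approx_one.
  have [n0 h] := prec_quotient_small alpha1 Ps s0 Pu XP e0.
  by exists n0 => n /h; rewrite toepc_one.
- by move=> _ _; exact: lambda_distr_prec alpha1 Ps s0.
- move=> Pu muR mubR; apply: lambda_distr_one => e eta e0 eta0.
  apply: (count_prec_eigvals alpha1 Ps s0 Pu XP e0 eta0 (sR mubR)) => n.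
  by rewrite /X BE trmxC_add trmxC_toepc trmxC_scaled_Dmx.
Qed.
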